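(* Let $\Omega\subset\mathbb{R}^d$ be an open set of finite measure, and let $\lambda_1(\Omega)<\lambda_2(\Omega)\le\dots$ be the eigenvalues (counted with multiplicity) of the operator $\mathcal H=\frac12\log(-\Delta)$ in $\Omega$ with Dirichlet condition $\varphi=0$ on $\mathbb{R}^d\setminus\Omega$. Then the Riesz means of the eigenvalues satisfy $$\lim_{\lambda\to\infty}e^{-d\lambda}\sum_k(\lambda-\lambda_k(\Omega))_+=\frac{1}{(2\pi)^d}\,|\Omega|\,|B_d|\,d^{-1}.$$
   Context: Here $d\ge1$ is an integer, $\Omega$ is nonempty, $|\cdot|$ of a set is Lebesgue measure, $B_d$ is the unit ball in $\mathbb{R}^d$, and $(t)_+=\max\{t,0\}$. The Fourier transform is $\widehat\varphi(\xi)=\int_{\mathbb{R}^d}e^{-ix\cdot\xi}\varphi(x)\,dx$, and $L^2(\Omega)$ is identified with the functions in $L^2(\mathbb{R}^d)$ vanishing on $\mathbb{R}^d\setminus\Omega$. Let $\mathbb{H}(\Omega)\subset L^2(\Omega)$ be the closure (completion) of $C_c^\infty(\Omega)$ with respect to the norm $\|\varphi\|_*$ given by $\|\varphi\|_*^2=\int_{\mathbb{R}^d}\log(e+|\xi|)\,|\widehat\varphi(\xi)|^2\,d\xi$. The quadratic form $$(\varphi,\varphi)_{\log}=\frac{1}{(2\pi)^d}\int_{\mathbb{R}^d}\log(|\xi|)\,|\widehat\varphi(\xi)|^2\,d\xi$$ (with associated sesquilinear form $(\varphi,\psi)_{\log}=\frac{1}{(2\pi)^d}\int_{\mathbb{R}^d}\log(|\xi|)\,\widehat\varphi(\xi)\overline{\widehat\psi(\xi)}\,d\xi$)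 with domain $\mathbb{H}(\Omega)$ is closed, symmetric and semibounded in $L^2(\Omega)$; $\mathcal H$ is the associated self-adjoint operator in $L^2(\Omega)$. Eigenvalues are understood weakly: $\varphi\in\mathbb{H}(\Omega)\setminus\{0\}$ is an eigenfunction with eigenvalue $\lambda$ if $(\varphi,\psi)_{\log}=\lambda\int_\Omega\varphi\overline{\psi}\,dx$ for all $\psi\in\mathbb{H}(\Omega)$. The spectrum is discrete: there is a sequence of eigenvalues $\lambda_1(\Omega)<\lambda_2(\Omega)\le\dots$, $\lambda_k(\Omega)\to\infty$, with a corresponding complete orthonormal system of eigenfunctions in $L^2(\Omega)$. *)

(* Defs.v *)
From HB Require Import structures.
From mathcomp Require Import all_boot all_order all_algebra.
From mathcomp Require Import all_classical all_reals all_analysis.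
From mathcomp Require Import complex.

Set Implicit Arguments.
Unset Strict Implicit.
Unset Printing Implicit Defensive.
Import Order.TTheory GRing.Theory Num.Theory.
Import numFieldNormedType.Exports.

Local Open Scope classical_set_scope.
Local Open Scope ring_scope.

(** Lebesgue measure on row vectors.  The sigma-algebra on ['rV[R]_n] is the
    one generated by the coordinate maps, as for [n.-tuple R] in the library;
    it is the Borel sigma-algebra, so "measurable" below always means Borel
    measurable.  This loses nothing: every Lebesgue class has a Borel
    representative. *)

Fact rV_display : measure_display. Proof. exact: default_measure_display. Qed.

Section measurable_rV.
Context {R : realType} (n : nat).

Definition rV_coord (i : 'I_n) (x : 'rV[R]_n) : R := x ord0 i.

Let rV_set0 : g_sigma_preimage rV_coord set0.
Proof. exact: sigma_algebra0. Qed.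

Let rV_setC A : g_sigma_preimage rV_coord A -> g_sigma_preimage rV_coord (~` A).
Proof. exact: sigma_algebraC. Qed.

Let rV_bigcup (F : _^nat) : (forall i, g_sigma_preimage rV_coord (F i)) ->
  g_sigma_preimage rV_coord (\bigcup_i (F i)).
Proof. exact: sigma_algebra_bigcup. Qed.

HB.instance Definition _ := @isMeasurable.Build rV_display
  'rV[R]_n (g_sigma_preimage rV_coord) rV_set0 rV_setC rV_bigcup.

Lemma measurable_rV_coord (i : 'I_n) :
  measurable_fun [set: 'rV[R]_n] (rV_coord i).
Proof.
move=> _ Y mY; rewrite setTI; apply: sub_sigma_algebra => /=.
rewrite -bigcup_seq/=; exists i => /=; first by rewrite mem_index_enum.
by exists Y => //; rewrite setTI.
Qed.

Lemma measurable_fun_rVP d (T : measurableType d) (f : T -> 'rV[R]_n) :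
  (forall i, measurable_fun [set: T] (rV_coord i \o f)) ->
  measurable_fun [set: T] f.
Proof.
move=> mf.
have : g_sigma_preimage (fun i => rV_coord i \o f) `<=` measurable.
  apply: smallest_sub; first exact: sigma_algebra_measurable.
  rewrite -bigcup_seq; apply: bigcup_sub => i _ _ [B mB <-].
  exact: mf.
by rewrite g_sigma_preimage_comp => h _ A mA; apply: h; exists A.
Qed.

End measurable_rV.

Section rV_cons.
Context {R : realType} (n : nat).

Definition rV_cons (p : R * 'rV[R]_n) : 'rV[R]_n.+1 :=
  row_mx (const_mx p.1 : 'rV[R]_1) p.2.

Definition rV_uncons (x : 'rV[R]_n.+1) : R * 'rV[R]_n :=
  (x ord0 ord0, \row_i x ord0 (lift ord0 i)).

Lemma rV_cons0 p : rV_cons p ord0 ord0 = p.1.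
Proof.
have -> : ord0 = lshift n ord0 :> 'I_(1 + n) by apply/val_inj.
by rewrite (row_mxEl (const_mx p.1 : 'rV[R]_1) p.2) mxE.
Qed.

Lemma rV_consS p i : rV_cons p ord0 (lift ord0 i) = p.2 ord0 i.
Proof.
have -> : lift ord0 i = rshift 1 i :> 'I_(1 + n) by apply/val_inj.
by rewrite (row_mxEr (const_mx p.1 : 'rV[R]_1) p.2).
Qed.

Lemma rV_consK : cancel rV_cons rV_uncons.
Proof.
move=> [x y]; rewrite /rV_uncons rV_cons0; congr pair.
by apply/rowP => i; rewrite mxE rV_consS.
Qed.

Lemma rV_unconsK : cancel rV_uncons rV_cons.
Proof.
move=> x; apply/rowP => i; case: (unliftP ord0 i) => [j|] ->.
  by rewrite rV_consS /= mxE.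
by rewrite rV_cons0.
Qed.

Lemma measurable_rV_cons : measurable_fun setT rV_cons.
Proof.
apply: measurable_fun_rVP => i; case: (unliftP ord0 i) => [j|] ->.
  rewrite (_ : _ \o _ = rV_coord j \o snd); last first.
    by apply/funext => p; rewrite /= /rV_coord rV_consS.
  by apply: measurableT_comp => //; exact: measurable_rV_coord.
rewrite (_ : _ \o _ = fst) //.
by apply/funext => p; rewrite /= /rV_coord rV_cons0.
Qed.

Lemma measurable_rV_uncons : measurable_fun setT rV_uncons.
Proof.
apply/measurable_fun_pairP; split.
  exact: (measurable_rV_coord (ord0 : 'I_n.+1)).
apply: measurable_fun_rVP => i.
rewrite (_ : _ \o _ = rV_coord (lift ord0 i)); first exact: measurable_rV_coord.
by apply/funext => x; rewrite /= /rV_coord mxE.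
Qed.

End rV_cons.

Section lebesgue_rV_step.
Context {R : realType} (n : nat).
Variable m : {sigma_finite_measure set 'rV[R]_n -> \bar R}.
Local Open Scope ereal_scope.

Definition lebesgue_rV_step : set 'rV[R]_n.+1 -> \bar R :=
  pushforward (@lebesgue_measure R \x m) (@rV_cons R n).

Let step0 : lebesgue_rV_step set0 = 0.
Proof. by rewrite /lebesgue_rV_step /pushforward preimage_set0 measure0. Qed.

Let step_ge0 A : 0 <= lebesgue_rV_step A.
Proof. by rewrite /lebesgue_rV_step /pushforward measure_ge0. Qed.

Let step_sigma_additive : semi_sigma_additive lebesgue_rV_step.
Proof.
have mcons A : measurable A -> measurable (@rV_cons R n @^-1` A).
  by move=> mA; rewrite -[X in measurable X]setTI; exact: measurable_rV_cons.
move=> F mF tF mUF; rewrite /lebesgue_rV_step /pushforward preimage_bigcup.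
apply: measure_semi_sigma_additive.
- by move=> k; exact: mcons.
- apply/trivIsetP => /= i j _ _ ij; rewrite -preimage_setI.
  by move/trivIsetP : tF => /(_ _ _ _ _ ij) ->//; rewrite preimage_set0.
- by rewrite -preimage_bigcup; exact: mcons.
Qed.

HB.instance Definition _ := isMeasure.Build _ _ _ lebesgue_rV_step
  step0 step_ge0 step_sigma_additive.

Let step_sigma_finite : sigma_finite setT lebesgue_rV_step.
Proof.
have /sigma_finiteP[F [TF ndF Foo]] := sigma_finiteT (@lebesgue_measure R).
have /sigma_finiteP[G [TG ndG Goo]] := sigma_finiteT m.
exists (fun k => @rV_uncons R n @^-1` (F k `*` G k)).
  rewrite -preimage_bigcup (_ : \bigcup_k _ = setT) ?preimage_setT//.
  apply/seteqP; split=> // -[x y] _ /=.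
  have [i _ Fix] : (\bigcup_k F k) x by rewrite -TF.
  have [j _ Gjy] : (\bigcup_k G k) y by rewrite -TG.
  exists (maxn i j) => //; split => /=.
    by move: x Fix; exact/subsetPset/ndF/leq_maxl.
  by move: y Gjy; exact/subsetPset/ndG/leq_maxr.
move=> k; have [mF Fkoo] := Foo k; have [mG Gkoo] := Goo k; split.
  rewrite -[X in measurable X]setTI; apply: measurable_rV_uncons => //.
  exact: measurableX.
rewrite /lebesgue_rV_step /pushforward -comp_preimage.
rewrite (_ : _ \o _ = id); last by apply/funext => p /=; rewrite rV_consK.
by rewrite preimage_id product_measure1E// lte_mul_pinfty// ge0_fin_numE.
Qed.

HB.instance Definition _ := @Measure_isSigmaFinite.Build _ _ _
  lebesgue_rV_step step_sigma_finite.

End lebesgue_rV_step.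

Fixpoint lebesgue_rV (R : realType) (n : nat) :
    {sigma_finite_measure set 'rV[R]_n -> \bar R} :=
  match n return {sigma_finite_measure set 'rV[R]_n -> \bar R} with
  | 0 => \d_(0 : 'rV[R]_0)
  | n'.+1 => lebesgue_rV_step (lebesgue_rV R n')
  end.

Section euclidean.
Context {R : realType} {d : nat}.
Implicit Types x y : 'rV[R]_d.

Definition dotp x y : R := \sum_i x ord0 i * y ord0 i.

(* [`|x|] on ['rV[R]_d] is the sup norm in the library. *)
Definition enorm x : R := Num.sqrt (dotp x x).

Definition eball : set 'rV[R]_d := [set x | enorm x < 1].

End euclidean.

Section log_laplacian.
Context {R : realType} {d : nat}.
Local Open Scope complex_scope.
Local Notation V := 'rV[R]_d.
Local Notation leb := (lebesgue_rV R d).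
Implicit Types (Omega : set V) (f g phi psi : V -> R[i]).

Definition cmeasurable f :=
  measurable_fun setT (fun x => complex.Re (f x)) /\
  measurable_fun setT (fun x => complex.Im (f x)).

Definition cintegral (D : set V) f : R[i] :=
  (\int[leb]_(x in D) complex.Re (f x)) +i*
  (\int[leb]_(x in D) complex.Im (f x)).

Definition expi (t : R) : R[i] := cos t +i* sin t.

Definition fourier f (xi : V) : R[i] :=
  cintegral setT (fun x => expi (- dotp x xi) * f x).

Definition sqnorm2 f : \bar R := (\int[leb]_x ((Normc.normc (f x) ^+ 2)%:E))%E.

Definition L2 Omega f :=
  [/\ cmeasurable f, (forall x, ~ Omega x -> f x = 0) & (sqnorm2 f < +oo)%E].

Definition inner Omega f g : R[i] := cintegral Omega (fun x => f x * (g x)^*).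

(* All iterated directional derivatives exist and are differentiable. *)
Definition smooth (u : V -> R) :=
  forall (s : seq V) (x : V), differentiable (foldr (fun v w => 'D_v w) u s) x.

Definition test_function Omega f :=
  [/\ smooth (fun x => complex.Re (f x)), smooth (fun x => complex.Im (f x)),
      compact (closure [set x | f x != 0]) &
      closure [set x | f x != 0] `<=` Omega].

Definition sqnorm_star f : \bar R :=
  (\int[leb]_xi
     ((ln (expR 1 + enorm xi) * Normc.normc (fourier f xi) ^+ 2)%:E))%E.

(* The weight of [sqnorm_star] is at least 1, so by Plancherel the completion
   of the test functions is this closure inside L^2(Omega). *)
Definition HH Omega phi :=
  L2 Omega phi /\
  forall eps : R, 0 < eps -> exists2 f, test_function Omega f &
    (sqnorm_star (fun x => (phi x - f x)%R) < eps%:E)%E.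

Definition log_form phi psi : R[i] :=
  (((2 * pi) ^- d)%:C *
   cintegral setT (fun xi =>
     (ln (enorm xi))%:C * (fourier phi xi * (fourier psi xi)^*)))%R.

Definition eigenfunction Omega (mu : R) phi :=
  [/\ HH Omega phi, ~ {ae leb, forall x, phi x = 0} &
      forall psi, HH Omega psi ->
        log_form phi psi = mu%:C * inner Omega phi psi].

Definition orthonormal_system Omega (phi : nat -> V -> R[i]) :=
  forall j k, inner Omega (phi j) (phi k) = (j == k)%:R.

Definition complete_system Omega (phi : nat -> V -> R[i]) :=
  forall f, L2 Omega f ->
    (fun n => sqnorm2 (fun x =>
       (f x - \sum_(k < n) inner Omega f (phi k) * phi k x)%R))
      @ \oo --> 0%E.

(* [lam k] is the (k+1)-st eigenvalue in Omega.  Multiplicities are counted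
   because the eigenfunctions form an orthonormal basis of L^2(Omega). *)
Definition dirichlet_eigenvalues Omega (lam : nat -> R) :=
  [/\ lam 0%N < lam 1%N,
      {homo lam : j k / (j <= k)%N >-> j <= k},
      lam @ \oo --> +oo &
      exists phi : nat -> V -> R[i],
        [/\ (forall k, eigenfunction Omega (lam k) (phi k)),
            orthonormal_system Omega phi & complete_system Omega phi]].

Definition riesz_mean (lam : nat -> R) (l : R) : \bar R :=
  (\sum_(0 <= k <oo) (Num.max (l - lam k) 0)%:E)%E.

End log_laplacian.

(* Main.v *)
(** Write f^ for the Fourier transform of f.

    Upper bound.  Since (2 pi)^d (l - lam_k) is the integral of (l - ln|xi|)
    |phi_k^(xi)|^2, it is at most that of (l - ln|xi|)_+ |phi_k^(xi)|^2; Bessel's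
    inequality for the truncated plane wave 1_Omega e^(i x xi) bounds
    sum_k |phi_k^(xi)|^2 by |Omega|, and the layer-cake formula gives
    int (l - ln|xi|)_+ dxi = |B_d| e^(d l) / d.

    Lower bound (Berezin).  Take a real test function g with |g| <= 1 close to
    1_Omega in L^2 and u_xi = e^(i x xi) g, c_k(xi) = <u_xi, phi_k>.  The sum
    sum_k lam_k |c_k(xi)|^2 is at most (2 pi)^(-d) int ln|eta| |u_xi^(eta)|^2 deta
    <= ln(max(|xi|, M)) |g|^2 + C_g / M, because u_xi^ = g^(. - xi) and
    ln|eta| <= ln(max(|xi|, M)) + |eta - xi| / M.  Multiplying l - lam_k by
    |c_k(xi)|^2, summing and integrating over |xi| < e^l, where
    int |c_k(xi)|^2 dxi <= (2 pi)^d, gives the bound with M = e^(l/2).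

    Plancherel's theorem is obtained by damping the Fourier side with
    exp(-e sum |xi_i|), whose transform is a product of Poisson kernels: the
    defect is int int (a x - a y)^2 P_e(x - y), which tends to 0 for indicators
    of open sets, hence for all of L^2. *)

From HB Require Import structures.
Require Import Defs.
From mathcomp Require Import all_boot all_order all_algebra.
From mathcomp Require Import all_classical all_reals all_analysis.
From mathcomp Require Import measurable_realfun complex ring lra.
Set Implicit Arguments.
Unset Strict Implicit.
Unset Printing Implicit Defensive.
Import Order.TTheory GRing.Theory Num.Theory.
Import numFieldNormedType.Exports.
Local Open Scope classical_set_scope.
Local Open Scope ring_scope.

(** * Lebesgue measure on row vectors *)

(** The weight ln|xi| is unbounded at both ends. Near the origin the finite measure of Omega
    controls it: Cauchy-Schwarz against a truncated plane wave gives |f^(xi)|^2 <= |Omega| |f|^2,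
    and ln|xi| is integrable there. Hence the form converges on H(Omega) and is bounded below by -C
    |f|^2.

    A truncated plane wave lies in L^2(Omega) but need not lie in H(Omega): it serves Bessel's
    inequality, not the weak eigenvalue equation. This forces a smooth g in the lower bound. The
    condition |g| <= 1 yields int |c_k|^2 <= (2 pi)^d, because the conjugate of c_k is the transform
    of g phi_k. That some g is close to 1_Omega follows from completeness: finite sums of
    eigenfunctions approximate 1_Omega, and eigenfunctions are limits of test functions.

    Pythagoras is applied to finite sums, and the lower bound of the form makes the remainder cost
    at most C times its squared L^2 norm, which tends to 0.

    The errors in the lower bound have sizes M^d and e^(d l) / M; M = e^(l/2) makes both negligible
    for fixed g, and only afterwards does g approach 1_Omega. *)

Section lebesgue_rV_lemmas.
Context {R : realType}.
Implicit Types (n : nat).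

Lemma ball_rVE n (x : 'rV[R]_n) (e : R) : 0 < e ->
  ball x e = \bigcap_(i in [set: 'I_n]) (@rV_coord R n i @^-1` ball (x ord0 i) e).
Proof.
move=> e0; apply/seteqP; split=> [y [_ xy] i _|y xy]; first exact: xy.
by split=> // i j; rewrite ord1; exact: xy.
Qed.

Lemma measurable_ball_rV n (x : 'rV[R]_n) (e : R) : 0 < e -> measurable (ball x e).
Proof.
move=> e0; rewrite ball_rVE//; apply: fin_bigcap_measurable => // i _.
rewrite -[X in measurable X]setTI; apply: measurable_rV_coord => //.
exact: measurable_ball.
Qed.

(** Countably many balls, with rational centres and radii 1/(k+1), exhaust an open set. An index
    whose ball leaves [A] contributes the empty set, so one countable index type serves every
    [A]. *)
Lemma open_measurable_rV n (A : set 'rV[R]_n) : open A -> measurable A.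
Proof.
move=> oA.
pose F (p : 'rV[rat]_n * nat) : set 'rV[R]_n :=
  let B := ball (map_mx (@ratr R) p.1) p.2.+1%:R^-1 in
  if pselect (B `<=` A) then B else set0.
have -> : A = \bigcup_p F p.
  apply/seteqP; split=> [x Ax|x [p _]]; last first.
    by rewrite /F; case: pselect => // BA /BA.
  have /nbhs_ballP[r /= r0 xrA] : nbhs x A by exact: open_nbhs_nbhs.
  (* A radius below [r / 2] ensures that a ball of this size containing [x] lies in [ball x r]. *)
  have [k kr] : exists k : nat, k.+1%:R^-1 < r / 2.
    have r20 : 0 < r / 2 by rewrite divr_gt0.
    have := near_infty_natSinv_lt (PosNum r20).
    by move=> [N _ H]; exists N; exact: (H N (leqnn N)).
  have k0 : 0 < k.+1%:R^-1 :> R by [].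
  have /choice[q qx] : forall i : 'I_n, exists q : rat,
     `|x ord0 i - ratr q| < k.+1%:R^-1.
    move=> i.
    have : x ord0 i - k.+1%:R^-1 < x ord0 i + k.+1%:R^-1 by rewrite ltrD2l gtrN.
    move=> /rat_in_itvoo[q]; rewrite in_itv/= => /andP[q1 q2]; exists q.
    by rewrite ltr_distlC q1 q2.
  exists (\row_i q i, k) => //; rewrite /F /=.
  have qB : ball (map_mx ratr (\row_i q i) : 'rV[R]_n) k.+1%:R^-1 x.
    by split=> // i j; rewrite !ord1 !mxE /ball/= distrC; exact: qx.
  case: pselect => // -[] y yB; apply: xrA.
  apply: (@le_ball _ _ x (k.+1%:R^-1 + k.+1%:R^-1)).
    by rewrite (splitr r) lerD// ltW.
  by apply: ball_triangle yB; apply: ball_sym.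
apply: countable_bigcupT_measurable; first exact: countableP.
by move=> p; rewrite /F /=; case: (pselect _) => ?;
  [exact: measurable_ball_rV|exact: measurable0].
Qed.

(** Exhibits a generating family closed under intersection, as Dynkin induction from open sets
    requires. *)
Lemma measurable_rV_openE n : @measurable _ 'rV[R]_n = <<s @open 'rV[R]_n >>.
Proof.
apply/seteqP; split; last first.
  apply: smallest_sub; first exact: sigma_algebra_measurable.
  by move=> A /=; exact: open_measurable_rV.
apply: smallest_sub; first exact: smallest_sigma_algebra.
rewrite -bigcup_seq => _ [i _] [B mB <-].
have -> : <<s @open 'rV[R]_n >> =
   @measurable _ (g_sigma_algebraType (@open 'rV[R]_n)) by [].
have mi : measurable_fun
    [set: g_sigma_algebraType (@open 'rV[R]_n)] (@rV_coord R n i).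
  apply: (@measurability _ _ _ _ _ _ (@RGenOpens.G R)).
    exact: RGenOpens.measurableE.
  move=> _ [_ [x [y ->]] <-]; rewrite setTI; apply: sub_sigma_algebra.
  by apply: open_comp => // z _; exact: coord_continuous.
exact: mi.
Qed.

Lemma continuous_measurable_rV n (f : 'rV[R]_n -> R) :
  continuous f -> measurable_fun setT f.
Proof.
move=> cf; apply: (@measurability _ _ _ _ _ _ (@RGenOpens.G R)).
  exact: RGenOpens.measurableE.
move=> _ [_ [x [y ->]] <-]; rewrite setTI; apply: open_measurable_rV.
by apply: open_comp => // z _; exact: cf.
Qed.

Lemma measurable_box n (r : R) : measurable [set x : 'rV[R]_n | forall i, `|x ord0 i| <= r].
Proof.
rewrite (_ : [set _ | _] = \bigcap_(i in [set: 'I_n]) (@rV_coord R n i @^-1` `[- r, r])).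
  apply: fin_bigcap_measurable => // i _.
  by rewrite -[X in measurable X]setTI; exact: measurable_rV_coord.
apply/seteqP; split=> y yB i.
  by move=> _ /=; rewrite in_itv/= -ler_norml; exact: yB.
by have := yB i I; rewrite /= in_itv/= -ler_norml.
Qed.

Lemma measurable_rV_affine n (s : R) (c : 'rV[R]_n) :
  measurable_fun setT (fun x : 'rV[R]_n => s *: x + c).
Proof.
apply: measurable_fun_rVP => i.
rewrite (_ : _ \o _ = (fun x => s * @rV_coord R n i x + c ord0 i)); last first.
  by apply/funext => x /=; rewrite /rV_coord !mxE.
apply: measurable_funD => //; apply: measurable_funM => //.
exact: measurable_rV_coord.
Qed.

Lemma measurable_rV_sub n :
  measurable_fun setT (fun z : 'rV[R]_n * 'rV[R]_n => z.1 - z.2).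
Proof.
apply: measurable_fun_rVP => i.
rewrite (_ : _ \o _ = (fun z => @rV_coord R n i z.1 - @rV_coord R n i z.2)); last first.
  by apply/funext => x /=; rewrite /rV_coord !mxE.
by apply: measurable_funB; apply: measurableT_comp => //; exact: measurable_rV_coord.
Qed.

Local Open Scope ereal_scope.

Lemma ge0_integral_rV0 (F : 'rV[R]_0 -> \bar R) : measurable_fun setT F ->
  \int[lebesgue_rV R 0]_x F x = F 0%R.
Proof. by move=> mF; rewrite /= integral_dirac// diracT mul1e. Qed.

Lemma ge0_integral_rVS n (F : 'rV[R]_n.+1 -> \bar R) : measurable_fun setT F ->
  (forall x, 0 <= F x) ->
  \int[lebesgue_rV R n.+1]_x F x =
  \int[lebesgue_measure]_t \int[lebesgue_rV R n]_y F (rV_cons (t, y)).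
Proof.
move=> mF F0; have mc := @measurable_rV_cons R n.
rewrite [LHS](_ : _ = \int[pushforward (@lebesgue_measure R \x lebesgue_rV R n)
  (@rV_cons R n)]_x F x); last exact: eq_measure_integral.
rewrite ge0_integral_pushforward// preimage_setT fubini_tonelli1//=.
exact: measurableT_comp.
Qed.

Lemma integral_rVS n (F : 'rV[R]_n.+1 -> \bar R) : measurable_fun setT F ->
  (@lebesgue_measure R \x lebesgue_rV R n).-integrable setT (F \o @rV_cons R n) ->
  (lebesgue_rV R n.+1).-integrable setT F /\
  \int[lebesgue_rV R n.+1]_x F x =
  \int[(@lebesgue_measure R \x lebesgue_rV R n)]_z F (rV_cons z).
Proof.
move=> mF iF; have mc := @measurable_rV_cons R n; split; last first.
  rewrite [LHS](_ : _ = \int[pushforward (@lebesgue_measure R \x lebesgue_rV R n)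
    (@rV_cons R n)]_x F x); last exact: eq_measure_integral.
  by rewrite integral_pushforward// preimage_setT.
apply/integrableP; split => //.
have /integrableP[_] := iF.
rewrite ge0_integral_rVS//; last exact: measurableT_comp.
by rewrite fubini_tonelli1//; do ! apply: measurableT_comp => //.
Qed.

(** Lebesgue measure is determined by half-open intervals, and the preimage of such an interval
    under [t -> s t + c] has length divided by [s]. *)
Lemma lebesgue_measure_affine (s c : R) (A : set R) : (0 < s)%R -> measurable A ->
  s%:E * pushforward lebesgue_measure
    (fun t => (s * t + c)%R : measurableTypeR R) A = lebesgue_measure A.
Proof.
move=> s0 mA.
have mf : measurable_fun setT (fun t => (s * t + c)%R : measurableTypeR R).
  by apply: measurable_funD => //; exact: measurable_funM.
(* The measure structure on a pushforward takes the measurability proof as an argument, so it is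
   named explicitly before being scaled. *)
pose p : {measure set (measurableTypeR R) -> \bar R} := measure_function_pushforward__canonical__measure_function_Measure lebesgue_measure mf.
pose nu := mscale (NngNum (ltW s0)) p.
apply/esym/(@lebesgue_measure_unique _ nu) => //= _ [[a b]] _ <-.
rewrite /nu /mscale/= /pushforward /= (_ : _ @^-1` _ = `]((a - c) / s)%R, ((b - c) / s)%R]%classic); last first.
  apply/seteqP; split=> x /=; rewrite !in_itv/= ltr_pdivrMr// ler_pdivlMr// mulrC ltrBlDr lerBrDr//.
rewrite [LHS]lebesgue_measure_itv [X in _ = _ * X]lebesgue_measure_itv/= !lte_fin ltr_pM2r ?invr_gt0// ltrD2r.
case: ifPn => _; last by rewrite mule0.
by rewrite -!EFinB -EFinM; congr EFin; field; rewrite gt_eqF.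
Qed.

Lemma ge0_integral_affine1 (s c : R) (F : R -> \bar R) : (0 < s)%R ->
  measurable_fun setT F -> (forall x, 0 <= F x) ->
  \int[lebesgue_measure]_t F (s * t + c)%R =
  (s^-1)%:E * \int[lebesgue_measure]_t F t.
Proof.
move=> s0 mF F0.
have mf : measurable_fun setT (fun t => (s * t + c)%R : measurableTypeR R).
  by apply: measurable_funD => //; exact: measurable_funM.
pose p := measure_function_pushforward__canonical__measure_function_Measure lebesgue_measure mf.
rewrite [X in _ = _ * X](_ : _ = \int[mscale (NngNum (ltW s0)) p]_t F t); last first.
  by apply: eq_measure_integral => A mA _; exact: (esym (lebesgue_measure_affine c s0 mA)).
rewrite ge0_integral_mscale// ge0_integral_pushforward// preimage_setT muleA -EFinM.
by rewrite mulVf ?gt_eqF// mul1e.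
Qed.

Lemma ge0_integral_opp1 (F : R -> \bar R) :
  measurable_fun setT F -> (forall x, 0 <= F x) ->
  \int[lebesgue_measure]_t F (- t)%R = \int[lebesgue_measure]_t F t.
Proof.
move=> mF F0.
have mf : measurable_fun setT (-%R : R -> measurableTypeR R) by [].
rewrite [RHS](_ : _ = \int[pushforward lebesgue_measure (-%R : R -> measurableTypeR R)]_t F t); last first.
  by apply: eq_measure_integral => A mA _; exact: (esym (lebesgue_measureN mA)).
by rewrite ge0_integral_pushforward// preimage_setT.
Qed.

Lemma rV0_eq (x y : 'rV[R]_0) : x = y.
Proof. by apply/rowP => -[]. Qed.

Lemma rV_cons_affine n (s t : R) (y : 'rV[R]_n) (c : 'rV[R]_n.+1) :
  (s *: rV_cons (t, y) + c)%R =
  rV_cons ((s * t + (rV_uncons c).1)%R, (s *: y + (rV_uncons c).2)%R).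
Proof.
apply/rowP => i; case: (unliftP ord0 i) => [j|] ->.
  by rewrite [LHS]mxE [X in (X + _)%R]mxE !rV_consS /= [RHS]mxE [X in _ = (X + _)%R]mxE [X in _ = (_ + X)%R]mxE.
by rewrite [LHS]mxE [X in (X + _)%R]mxE !rV_cons0.
Qed.

(** Tonelli treats one coordinate at a time; each contributes a factor [s^-1]. *)
Lemma ge0_integral_rV_affine n (s : R) (c : 'rV[R]_n) (F : 'rV[R]_n -> \bar R) :
  (0 < s)%R -> measurable_fun setT F -> (forall x, 0 <= F x) ->
  \int[lebesgue_rV R n]_x F (s *: x + c)%R =
  (s ^- n)%:E * \int[lebesgue_rV R n]_x F x.
Proof.
move=> s0; elim: n c F => [|n IHn] c F mF F0.
  rewrite !ge0_integral_rV0//.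
    by rewrite expr0 invr1 mul1e; congr F; exact: rV0_eq.
  apply: measurableT_comp => //; exact: measurable_rV_affine.
have mFc : measurable_fun setT (F \o @rV_cons R n).
  by apply: measurableT_comp => //; exact: measurable_rV_cons.
rewrite !ge0_integral_rVS//; last first.
  by apply: measurableT_comp => //; exact: measurable_rV_affine.
under eq_integral do under eq_integral do rewrite rV_cons_affine.
have mG t : measurable_fun setT (fun y => F (rV_cons (t, y))).
  exact: (measurableT_comp mFc (pair1_measurable t)).
transitivity (\int[lebesgue_measure]_t ((s ^- n)%:E *
   \int[lebesgue_rV R n]_y F (rV_cons ((s * t + (rV_uncons c).1)%R, y)))).
  by apply: eq_integral => t _; exact: IHn.
have mH := measurable_fun_fubini_tonelli_F (m2 := lebesgue_rV R n) (F \o @rV_cons R n) mFc (fun x => F0 _).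
rewrite (@ge0_integral_affine1 _ _ (fun t => (s ^- n)%:E *
   \int[lebesgue_rV R n]_y F (rV_cons (t, y))))//; last 2 first.
- exact: measurable_funeM.
- move=> t; apply: mule_ge0; first by rewrite lee_fin invr_ge0 exprn_ge0 ?ltW.
  exact: integral_ge0.
rewrite ge0_integralZl_EFin//; last 2 first.
- by move=> t _; exact: integral_ge0.
- by rewrite invr_ge0 exprn_ge0 ?ltW.
by rewrite muleA -EFinM -invfM exprS.
Qed.

Lemma ge0_integral_rV_opp n (F : 'rV[R]_n -> \bar R) :
  measurable_fun setT F -> (forall x, 0 <= F x) ->
  \int[lebesgue_rV R n]_x F (- x)%R = \int[lebesgue_rV R n]_x F x.
Proof.
have moppr m : measurable_fun setT (-%R : 'rV[R]_m -> 'rV[R]_m).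
  rewrite (_ : -%R = (fun x => (0 : 'rV_m) - x)%R); last by apply/funext => x; rewrite sub0r.
  exact: (measurableT_comp (@measurable_rV_sub m) (pair1_measurable (0%R : 'rV[R]_m))).
elim: n F => [|n IHn] F mF F0.
  rewrite !ge0_integral_rV0//; first by congr F; exact: rV0_eq.
  by apply: (measurableT_comp mF); exact: moppr.
have mFc : measurable_fun setT (F \o @rV_cons R n).
  by apply: measurableT_comp => //; exact: measurable_rV_cons.
have mFo : measurable_fun setT (fun x : 'rV[R]_n.+1 => F (- x)%R).
  by apply: (measurableT_comp mF); exact: moppr.
rewrite (ge0_integral_rVS mFo (fun x => F0 _)) (ge0_integral_rVS mF F0).
have oppE t (y : 'rV[R]_n) : (- rV_cons (t, y))%R = rV_cons (- t, - y)%R.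
  apply/rowP => i; case: (unliftP ord0 i) => [j|] ->.
    by rewrite [LHS]mxE !rV_consS /= mxE.
  by rewrite [LHS]mxE !rV_cons0.
under eq_integral do under eq_integral do rewrite oppE.
have mG t : measurable_fun setT (fun y => F (rV_cons (t, y))).
  exact: (measurableT_comp mFc (pair1_measurable t)).
transitivity (\int[lebesgue_measure]_t
   \int[lebesgue_rV R n]_y F (rV_cons ((- t)%R, y))).
  by apply: eq_integral => t _; exact: (IHn (fun y => F (rV_cons (_, y)))).
have mH := measurable_fun_fubini_tonelli_F (m2 := lebesgue_rV R n) (F \o @rV_cons R n) mFc (fun x => F0 _).
rewrite (@ge0_integral_opp1 (fun t =>
   \int[lebesgue_rV R n]_y F (rV_cons (t, y))))//.
by move=> t; exact: integral_ge0.
Qed.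

Lemma ge0_integral_rV_sub n (c : 'rV[R]_n) (F : 'rV[R]_n -> \bar R) :
  measurable_fun setT F -> (forall x, 0 <= F x) ->
  \int[lebesgue_rV R n]_x F (x - c)%R = \int[lebesgue_rV R n]_x F x.
Proof.
move=> mF F0; have := ge0_integral_rV_affine (- c)%R ltr01 mF F0.
rewrite expr1n invr1 mul1e => <-.
by apply: eq_integral => x _; rewrite scale1r.
Qed.

(** Induction on the dimension: the set sits in the product of an interval and a lower-dimensional
    box. In dimension 0 the measure is a Dirac mass. *)
Lemma bounded_lebesgue_rV_lty n (r : R) (A : set 'rV[R]_n) : measurable A ->
  (forall x i, A x -> `|x ord0 i| <= r)%R -> lebesgue_rV R n A < +oo.
Proof.
elim: n A => [|n IHn] A mA Ar.
  by rewrite /= /dirac/= indicE; case: (_ \in _); rewrite ?ltry.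
pose B : set 'rV[R]_n := [set y | forall i, `|y ord0 i| <= r]%R.
have mB : measurable B by exact: measurable_box.
apply: (@le_lt_trans _ _ ((@lebesgue_measure R \x lebesgue_rV R n) (`[(- r)%R, r] `*` B))).
  rewrite [X in X <= _](_ : _ = (@lebesgue_measure R \x lebesgue_rV R n) (@rV_cons R n @^-1` A))//.
  apply: le_measure; rewrite ?inE.
  - by rewrite -[X in measurable X]setTI; exact: measurable_rV_cons.
  - exact: measurableX.
  - move=> [t y] /= Aty; split => /=.
      rewrite in_itv/= -ler_norml; have := Ar _ ord0 Aty; by rewrite rV_cons0.
    by move=> i; have := Ar _ (lift ord0 i) Aty; rewrite rV_consS.
rewrite product_measure1E// lte_mul_pinfty//.
  rewrite ge0_fin_numE// [ltLHS](lebesgue_measure_itv `[(- r)%R, r])/=; case: ifPn => // _.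
  by rewrite -EFinB ltry.
by apply: IHn => // x i; apply.
Qed.

End lebesgue_rV_lemmas.

(** * Products of functions of separate variables *)

Section product_integral.
Local Open Scope ereal_scope.
Context d1 d2 (T1 : measurableType d1) (T2 : measurableType d2) (R : realType).
Variable m1 : {sigma_finite_measure set T1 -> \bar R}.
Variable m2 : {sigma_finite_measure set T2 -> \bar R}.

Lemma integrable_prod (f : T1 -> R) (g : T2 -> R) :
  m1.-integrable setT (EFin \o f) -> m2.-integrable setT (EFin \o g) ->
  (m1 \x m2).-integrable setT (fun z => (f z.1 * g z.2)%:E).
Proof.
move=> fi gi.
have /integrableP[mf foo] := fi; have /integrableP[mg goo] := gi.
apply/integrable12ltyP.
  apply/measurable_EFinP; apply: measurable_funM.
    by apply: measurableT_comp => //; exact/measurable_EFinP.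
  by apply: measurableT_comp => //; exact/measurable_EFinP.
rewrite (eq_integral (fun x => `|(f x)%:E| * \int[m2]_y `|(g y)%:E|)); last first.
  move=> x _; rewrite -ge0_integralZl//; last exact: measurableT_comp.
  by apply: eq_integral => y _ /=; rewrite normrM.
rewrite ge0_integralZr//; first by rewrite lte_mul_pinfty// ?integral_ge0// ge0_fin_numE// integral_ge0.
- exact: measurableT_comp.
- exact: integral_ge0.
Qed.

Lemma integral_prod (f : T1 -> R) (g : T2 -> R) :
  m1.-integrable setT (EFin \o f) -> m2.-integrable setT (EFin \o g) ->
  \int[m1 \x m2]_z (f z.1 * g z.2)%:E =
  (\int[m1]_x (f x)%:E) * (\int[m2]_y (g y)%:E).
Proof.
move=> fi gi.
rewrite -integral12_prod_meas1; last exact: integrable_prod.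
have gfin := integrable_fin_num measurableT gi.
rewrite /fubini_F (eq_integral (fun x => (f x)%:E * \int[m2]_y (g y)%:E)); last first.
  by move=> x _; rewrite -integralZl.
by rewrite -(fineK gfin) integralZr.
Qed.

End product_integral.

(** * The Poisson kernel and its Fourier transform *)

Section poisson1.
Context {R : realType}.
Local Notation mu := (@lebesgue_measure R).
Implicit Types e x t : R.

Definition expabs e t : R := expR (- (e * `|t|)).
(** The Fourier transform of [expabs e], that is, 2 pi times the Poisson kernel of the half-plane at
    height [e]. *)
Definition poisson1 e x : R := 2 * e / (e ^+ 2 + x ^+ 2).

Lemma poisson1_ge0 e x : 0 < e -> 0 <= poisson1 e x.
Proof. by move=> e0; rewrite divr_ge0 ?mulr_ge0 ?addr_ge0 ?sqr_ge0 ?ltW. Qed.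

Lemma expR_scale_cvg0 e : 0 < e -> expR (- (e * t)) @[t --> +oo] --> 0.
Proof.
move=> e0; have := @cvgr_expR R => /(_ _ _)H.
apply: (@cvg_comp _ _ _ (fun t => e * t) (fun t => expR (- t)) _ (pinfty_nbhs R)).
  exact: gt0_cvgMry.
exact: cvgr_expR.
Qed.

Lemma is_derive_expN e t : is_derive t 1 (fun t => expR (- (e * t))) (- e * expR (- (e * t))).
Proof.
apply: is_derive_eq.
by rewrite /GRing.scale/= mulr1 mulrN mulrC mulNr.
Qed.

Lemma integral0y_expR e : 0 < e ->
  (\int[mu]_(t in `[0%R, +oo[) (expR (- (e * t)))%:E = (e^-1)%:E)%E.
Proof.
move=> e0.
rewrite (@ge0_continuous_FTC2y _ _ (fun t => - e^-1 * expR (- (e * t))) _ 0).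
- by rewrite mulr0 oppr0 expR0 mulr1 sub0e -EFinN opprK.
- by move=> t _; exact: expR_ge0.
- apply: continuous_subspaceT => t; apply: differentiable_continuous.
  by apply/derivable1_diffP.
- rewrite -(mulr0 (- e^-1)); apply: cvgM; first exact: cvg_cst.
  exact: expR_scale_cvg0.
- by move=> t _.
- apply: cvg_at_right_filter.
  have : derivable (fun t => - e^-1 * expR (- (e * t))) 0 1 by [].
  by move=> /derivable1_diffP/differentiable_continuous.
- move=> t _; rewrite derive1E deriveM// derive_cst.
  have -> := @derive_val _ _ _ _ _ _ _ (is_derive_expN e t).
  by rewrite scaler0 addr0 /GRing.scale/= mulrA mulrNN mulVf ?mul1r// gt_eqF.
Qed.

Lemma is_derive_cosM x t : is_derive t 1 (fun t => cos (x * t)) (- (x * sin (x * t))).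
Proof.
apply: is_derive_eq.
by rewrite /GRing.scale/= mulr1 mulNr mulrC.
Qed.

Lemma is_derive_sinM x t : is_derive t 1 (fun t => sin (x * t)) (x * cos (x * t)).
Proof.
apply: is_derive_eq.
by rewrite /GRing.scale/= mulr1 mulrC.
Qed.

(** The added 1 makes the integrand nonnegative, so the fundamental theorem of calculus on a
    half-line applies directly; its contribution is subtracted again in [integral_expabs_cos]. *)
Lemma integral0y_expR_cos e x : 0 < e ->
  (\int[mu]_(t in `[0%R, +oo[) (expR (- (e * t)) * (1 + cos (x * t)))%:E =
   (e^-1 + e / (e ^+ 2 + x ^+ 2))%:E)%E.
Proof.
move=> e0; have ex0 : e ^+ 2 + x ^+ 2 != 0.
  by rewrite gt_eqF// ltr_pwDl ?sqr_ge0// exprn_gt0.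
(* [expR (- (e * t)) * G t] is the antiderivative: the fraction comes from the damped cosine,
   [- e^-1] from the added 1. It vanishes at infinity because [G] is bounded. *)
pose G t := (x * sin (x * t) - e * cos (x * t)) / (e ^+ 2 + x ^+ 2) - e^-1.
pose F t := expR (- (e * t)) * G t.
have dF t : is_derive t 1 F (expR (- (e * t)) * (1 + cos (x * t))).
  have dE := is_derive_expN e t; have dC := is_derive_cosM x t.
  have dS := is_derive_sinM x t.
  rewrite /F /G; apply: is_derive_eq.
  rewrite /GRing.scale/=; field.
  by rewrite ex0 gt_eqF.
have cF t : {for t, continuous F}.
  by apply: differentiable_continuous; apply/derivable1_diffP; apply: ex_derive.
rewrite (@ge0_continuous_FTC2y _ _ F _ 0).
- rewrite /F /G !mulr0 oppr0 expR0 sin0 cos0 sub0e -EFinN; congr EFin; field.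
  by rewrite ex0 gt_eqF.
- move=> t _; rewrite mulr_ge0 ?expR_ge0//; have := cos_geN1 (x * t); lra.
- apply: continuous_subspaceT => t; apply: differentiable_continuous.
  by apply/derivable1_diffP.
- apply/cvgr0Pnorm_lt => /= d d0.
  pose M := (`|x| + e) / (e ^+ 2 + x ^+ 2) + e^-1 + 1.
  have exp : 0 < e ^+ 2 + x ^+ 2 by rewrite ltr_pwDl ?sqr_ge0// exprn_gt0.
  have M0 : 0 < M.
    have h1 : 0 <= (`|x| + e) / (e ^+ 2 + x ^+ 2).
      by apply: divr_ge0; [apply: addr_ge0 => //|]; exact: ltW.
    have h2 : 0 <= e^-1 by rewrite invr_ge0 ltW.
    by rewrite /M; lra.
  have GM t : `|G t| <= M.
    rewrite /G /M (le_trans (ler_normB _ _))//.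
    rewrite normrM [in leLHS]normfV (gtr0_norm exp) [X in _ + X]gtr0_norm ?invr_gt0//.
    rewrite -[leLHS]addr0 lerD// lerD2r ler_pM2r ?invr_gt0//.
    rewrite (le_trans (ler_normB _ _))// lerD//.
      by rewrite normrM ler_piMr// ler_norml sin_geN1 sin_le1.
    rewrite normrM (gtr0_norm e0); apply: ler_piMr; first exact: ltW.
    by rewrite ler_norml cos_geN1 cos_le1.
  have /cvgr0Pnorm_lt/(_ (d / M)) := expR_scale_cvg0 e0.
  rewrite divr_gt0// => /(_ isT); apply: filterS => t.
  rewrite ltr_pdivlMr// => H; rewrite /F normrM.
  by apply: le_lt_trans H; rewrite ler_wpM2l.
- by move=> t _; apply: ex_derive.
- by apply: cvg_at_right_filter; exact: cF.
- by move=> t _; rewrite derive1E; apply: derive_val.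
Qed.

Lemma continuous_expabs e : continuous (expabs e).
Proof.
move=> t; apply: (@continuous_comp _ _ _ (fun t => - (e * `|t|)) expR); last exact: continuous_expR.
by apply: cvgN; apply: cvgM; [exact: cvg_cst|exact: norm_continuous].
Qed.

Lemma measurable_expabs e : measurable_fun setT (expabs e).
Proof. by apply: continuous_measurable_fun; exact: continuous_expabs. Qed.

Lemma integral_expabs e : 0 < e -> (\int[mu]_t (expabs e t)%:E = (2 / e)%:E)%E.
Proof.
move=> e0; rewrite ge0_symfun_integralT.
- transitivity (2%:E * \int[mu]_(t in `[0%R, +oo[) (expR (- (e * t)))%:E)%E.
    congr (_ * _)%E; rewrite -set_itvcy; apply: eq_integral => t /[!inE]/=.
    by rewrite in_itv/= andbT /expabs => /ger0_norm ->.
  by rewrite integral0y_expR.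
- by move=> t; exact: expR_ge0.
- exact: continuous_expabs.
- by move=> t /=; rewrite /expabs normrN.
Qed.

Lemma integrable_expabs e : 0 < e -> mu.-integrable setT (EFin \o expabs e).
Proof.
move=> e0; apply/integrableP; split.
  by apply/measurable_EFinP; exact: measurable_expabs.
under eq_integral do rewrite /= ger0_norm ?expR_ge0//.
by rewrite integral_expabs// ltry.
Qed.

Lemma measurable_cosM x : measurable_fun setT (fun t : R => cos (x * t)).
Proof.
apply: continuous_measurable_fun => t.
apply: (@continuous_comp _ _ _ (fun t => x * t) cos); last exact: continuous_cos.
by apply: cvgM; [exact: cvg_cst|exact: cvg_id].
Qed.

Lemma measurable_sinM x : measurable_fun setT (fun t : R => sin (x * t)).
Proof.
apply: continuous_measurable_fun => t.
apply: (@continuous_comp _ _ _ (fun t => x * t) sin); last exact: continuous_sin.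
by apply: cvgM; [exact: cvg_cst|exact: cvg_id].
Qed.

Lemma integrable_expabs_cos e x : 0 < e ->
  mu.-integrable setT (fun t => (expabs e t * cos (x * t))%:E).
Proof.
move=> e0; apply: (le_integrable _ _ _ (integrable_expabs e0)) => //=.
  by apply/measurable_EFinP/measurable_funM; [exact: measurable_expabs|exact: measurable_cosM].
move=> t _; rewrite lee_fin normrM ler_piMr//.
by rewrite ler_norml cos_geN1 cos_le1.
Qed.

Lemma integrable_expabs_sin e x : 0 < e ->
  mu.-integrable setT (fun t => (expabs e t * sin (x * t))%:E).
Proof.
move=> e0; apply: (le_integrable _ _ _ (integrable_expabs e0)) => //=.
  by apply/measurable_EFinP/measurable_funM; [exact: measurable_expabs|exact: measurable_sinM].
move=> t _; rewrite lee_fin normrM ler_piMr//.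
by rewrite ler_norml sin_geN1 sin_le1.
Qed.

Lemma integral_expabs_cos e x : 0 < e ->
  (\int[mu]_t (expabs e t * cos (x * t))%:E = (poisson1 e x)%:E)%E.
Proof.
move=> e0.
have H : (\int[mu]_t (expabs e t * (1 + cos (x * t)))%:E =
    (2 * (e^-1 + e / (e ^+ 2 + x ^+ 2)))%:E)%E.
  rewrite ge0_symfun_integralT.
  - transitivity (2%:E * \int[mu]_(t in `[0%R, +oo[) (expR (- (e * t)) * (1 + cos (x * t)))%:E)%E.
      congr (_ * _)%E; rewrite -set_itvcy; apply: eq_integral => t /[!inE]/=.
      by rewrite in_itv/= andbT /expabs => /ger0_norm ->.
    by rewrite integral0y_expR_cos.
  - move=> t; rewrite mulr_ge0 ?expR_ge0//; have := cos_geN1 (x * t); lra.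
  - move=> t; apply: cvgM; first exact: continuous_expabs.
    apply: cvgD; first exact: cvg_cst.
    apply: (@continuous_comp _ _ _ (fun t => x * t) cos); last exact: continuous_cos.
    by apply: cvgM; [exact: cvg_cst|exact: cvg_id].
  - by move=> t /=; rewrite /expabs normrN mulrN cosN.
move: H; under eq_integral do rewrite mulrDr mulr1 EFinD.
rewrite integralD//=; [|exact: integrable_expabs|exact: integrable_expabs_cos].
rewrite integral_expabs// => H.
have fin : (\int[mu]_t (expabs e t * cos (x * t))%:E)%E \is a fin_num.
  by apply: integrable_fin_num => //; exact: integrable_expabs_cos.
move: H; rewrite -(fineK fin) -EFinD => -[] H; congr EFin.
by move: H; rewrite /poisson1 mulrDr => /addrI ->; rewrite mulrA.
Qed.

Lemma integral_opp1 (F : R -> \bar R) : measurable_fun setT F ->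
  (\int[mu]_t F (- t)%R = \int[mu]_t F t)%E.
Proof.
move=> mF; rewrite integralE [RHS]integralE; congr (_ - _)%E.
  transitivity (\int[mu]_t (F^\+ (- t)%R))%E; first by apply: eq_integral => t _; rewrite !funeposE.
  by apply: ge0_integral_opp1; [exact: measurable_funepos|].
transitivity (\int[mu]_t (F^\- (- t)%R))%E; first by apply: eq_integral => t _; rewrite !funenegE.
by apply: ge0_integral_opp1; [exact: measurable_funeneg|].
Qed.

Lemma integral_expabs_sin e x : 0 < e ->
  (\int[mu]_t (expabs e t * sin (x * t))%:E = 0)%E.
Proof.
move=> e0; have fi := integrable_expabs_sin x e0.
have fin := integrable_fin_num measurableT fi.
(* The integrand is odd, so the integral equals its own opposite; being finite, it is 0. *)
have := integral_opp1 (measurable_int _ fi).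
under eq_integral do rewrite /expabs normrN mulrN sinN mulrN EFinN.
rewrite integralN/=; last exact: integrable_add_def.
rewrite -(fineK fin) -EFinN => -[] H; congr EFin.
by move: H; rewrite /expabs; set a := fine _ => H; lra.
Qed.

Lemma continuous_poisson1 e : 0 < e -> continuous (poisson1 e).
Proof.
move=> e0 t; apply: cvgM; first exact: cvg_cst.
apply: cvgV; first by rewrite gt_eqF// ltr_pwDl ?sqr_ge0// exprn_gt0.
apply: cvgD; first exact: cvg_cst.
exact: exprn_continuous.
Qed.

Lemma integral_poisson1 e : 0 < e ->
  (\int[mu]_t (poisson1 e t)%:E = (2 * pi)%:E)%E.
Proof.
move=> e0; rewrite ge0_symfun_integralT.
- rewrite -set_itvcy (@ge0_continuous_FTC2y _ _ (fun t => 2 * atan (t / e)) _ pi).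
  + by rewrite mul0r atan0 mulr0 sube0.
  + by move=> t _; exact: poisson1_ge0.
  + by apply: continuous_subspaceT; exact: continuous_poisson1.
  + rewrite [X in _ --> X](_ : _ = 2 * (pi / 2)); last by field.
    apply: cvgM; first exact: cvg_cst.
    apply: (@cvg_comp _ _ _ (fun t => t / e) atan _ (pinfty_nbhs R)).
      by apply: gt0_cvgMly; [rewrite invr_gt0|exact: cvg_id].
    exact: cvgy_atan.
  + by move=> t _.
  + apply: cvg_at_right_filter.
    have : derivable (fun t => 2 * atan (t / e)) 0 1 by [].
    by move=> /derivable1_diffP/differentiable_continuous.
  + move=> t _; rewrite derive1E; apply: derive_val.
    apply: is_derive_eq.
    rewrite /GRing.scale/= /poisson1; field.
    by rewrite !gt_eqF// ltr_pwDl ?sqr_ge0 ?exprn_gt0.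
- by move=> t; exact: poisson1_ge0.
- exact: continuous_poisson1.
- by move=> t /=; rewrite /poisson1 sqrrN.
Qed.
End poisson1.

(** * The kernel and its transform in dimension [n] *)

Section poisson_rV.
Context {R : realType}.
Implicit Types (e : R) (n : nat).

Lemma dotpC n (x y : 'rV[R]_n) : dotp x y = dotp y x.
Proof. by apply: eq_bigr => i _; rewrite mulrC. Qed.

Lemma dotpDr n (z x y : 'rV[R]_n) : dotp z (x + y) = dotp z x + dotp z y.
Proof. by rewrite /dotp -big_split; apply: eq_bigr => i _; rewrite mxE mulrDr. Qed.

Lemma dotpNr n (z x : 'rV[R]_n) : dotp z (- x) = - dotp z x.
Proof. by rewrite /dotp -sumrN; apply: eq_bigr => i _; rewrite mxE mulrN. Qed.

Lemma dotpBr n (z x y : 'rV[R]_n) : dotp z (x - y) = dotp z x - dotp z y.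
Proof. by rewrite dotpDr dotpNr. Qed.

Lemma dotpDl n (x y z : 'rV[R]_n) : dotp (x + y) z = dotp x z + dotp y z.
Proof. by rewrite dotpC dotpDr !(dotpC z). Qed.

Lemma dotpBl n (x y z : 'rV[R]_n) : dotp (x - y) z = dotp x z - dotp y z.
Proof. by rewrite dotpC dotpBr !(dotpC z). Qed.

Lemma dotpZr n (s : R) (z x : 'rV[R]_n) : dotp z (s *: x) = s * dotp z x.
Proof. by rewrite /dotp mulr_sumr; apply: eq_bigr => i _; rewrite mxE mulrCA. Qed.

Lemma measurable_dotp n : measurable_fun setT (fun p : 'rV[R]_n * 'rV[R]_n => dotp p.1 p.2).
Proof.
apply: measurable_sum => i; apply: measurable_funM.
  by apply: (measurableT_comp (@measurable_rV_coord R n i)); exact: measurable_fst.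
by apply: (measurableT_comp (@measurable_rV_coord R n i)); exact: measurable_snd.
Qed.

Lemma measurable_dotpr n (z : 'rV[R]_n) : measurable_fun setT (fun x => dotp z x).
Proof. exact: (measurableT_comp (@measurable_dotp n) (pair1_measurable z)). Qed.

Lemma dotp_cons n (z : 'rV[R]_n.+1) t (y : 'rV[R]_n) :
  dotp z (rV_cons (t, y)) = (rV_uncons z).1 * t + dotp (rV_uncons z).2 y.
Proof.
rewrite /dotp big_ord_recl rV_cons0; congr (_ + _).
by apply: eq_bigr => i _; rewrite rV_consS mxE.
Qed.

Lemma measurable_cos : measurable_fun [set: R] (@cos R).
Proof. by apply: continuous_measurable_fun; exact: continuous_cos. Qed.

Lemma measurable_sin : measurable_fun [set: R] (@sin R).
Proof. by apply: continuous_measurable_fun; exact: continuous_sin. Qed.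

(** Damping by the sum of the coordinates' absolute values, rather than by the Euclidean norm, makes
    both the function and its transform factor over coordinates. *)
Definition expabs_rV e n (x : 'rV[R]_n) : R := \prod_i expabs e (x ord0 i).
Definition poisson_rV e n (z : 'rV[R]_n) : R := \prod_i poisson1 e (z ord0 i).

Lemma expabs_rV_cons e n t (y : 'rV[R]_n) :
  expabs_rV e (rV_cons (t, y)) = expabs e t * expabs_rV e y.
Proof.
rewrite /expabs_rV big_ord_recl rV_cons0; congr (_ * _).
by apply: eq_bigr => i _; rewrite rV_consS.
Qed.

Lemma poisson_rV_uncons e n (z : 'rV[R]_n.+1) :
  poisson_rV e z = poisson1 e (rV_uncons z).1 * poisson_rV e (rV_uncons z).2.
Proof.
by rewrite /poisson_rV big_ord_recl; congr (_ * _); apply: eq_bigr => i _; rewrite mxE.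
Qed.

Lemma expabs_rV_ge0 e n (x : 'rV[R]_n) : 0 <= expabs_rV e x.
Proof. by apply: prodr_ge0 => i _; exact: expR_ge0. Qed.

Lemma poisson_rV_ge0 e n (x : 'rV[R]_n) : 0 < e -> 0 <= poisson_rV e x.
Proof. by move=> e0; apply: prodr_ge0 => i _; exact: poisson1_ge0. Qed.

Lemma measurable_expabs_rV e n : measurable_fun setT (@expabs_rV e n).
Proof.
apply: measurable_prod => i _; apply: (measurableT_comp (measurable_expabs e)).
exact: measurable_rV_coord.
Qed.

Lemma measurable_poisson1 e : 0 < e -> measurable_fun setT (poisson1 e).
Proof. by move=> e0; apply: continuous_measurable_fun; exact: continuous_poisson1. Qed.

Lemma measurable_poisson_rV e n : 0 < e -> measurable_fun setT (@poisson_rV e n).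
Proof.
move=> e0; apply: measurable_prod => i _.
apply: (measurableT_comp (measurable_poisson1 e0)).
exact: measurable_rV_coord.
Qed.

Lemma poisson_rVN e n (z : 'rV[R]_n) : poisson_rV e (- z) = poisson_rV e z.
Proof. by apply: eq_bigr => i _; rewrite /poisson1 mxE sqrrN. Qed.

Local Open Scope ereal_scope.

Lemma integral_poisson_rV e n : (0 < e)%R ->
  \int[lebesgue_rV R n]_z (poisson_rV e z)%:E = ((2 * pi) ^+ n)%:E.
Proof.
move=> e0; elim: n => [|n IHn].
  rewrite ge0_integral_rV0; first by rewrite /poisson_rV big_ord0 expr0.
  by apply/measurable_EFinP; exact: measurable_poisson_rV.
rewrite ge0_integral_rVS; last 2 first.
- by apply/measurable_EFinP; exact: measurable_poisson_rV.
- by move=> x; rewrite lee_fin poisson_rV_ge0.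
transitivity (\int[lebesgue_measure]_t ((poisson1 e t)%:E * ((2 * pi) ^+ n)%:E)).
  apply: eq_integral => t _; rewrite -IHn -ge0_integralZl_EFin//.
  - by apply: eq_integral => y _; rewrite poisson_rV_uncons rV_consK.
  - by move=> y _; rewrite lee_fin poisson_rV_ge0.
  - by apply/measurable_EFinP; exact: measurable_poisson_rV.
  - exact: poisson1_ge0.
rewrite ge0_integralZr//; last 3 first.
- by apply/measurable_EFinP; exact: measurable_poisson1.
- by move=> t _; rewrite lee_fin poisson1_ge0.
- by rewrite lee_fin exprn_ge0// mulr_ge0// pi_ge0.
by rewrite integral_poisson1// -EFinM exprS.
Qed.

Lemma integrable_expabs_rV e n : (0 < e)%R ->
  (lebesgue_rV R n).-integrable setT (EFin \o @expabs_rV e n).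
Proof.
move=> e0; elim: n => [|n IHn].
  apply/integrableP; split; first by apply/measurable_EFinP; exact: measurable_expabs_rV.
  rewrite ge0_integral_rV0 ?ltry//.
  by apply: measurableT_comp => //; apply/measurable_EFinP; exact: measurable_expabs_rV.
apply: (integral_rVS _ _).1; first by apply/measurable_EFinP; exact: measurable_expabs_rV.
have := integrable_prod (integrable_expabs e0) IHn.
by apply: eq_integrable => // -[t y] _ /=; rewrite expabs_rV_cons.
Qed.

Lemma integrable_expabs_rV_cos e n (z : 'rV[R]_n) : (0 < e)%R ->
  (lebesgue_rV R n).-integrable setT (fun x => (expabs_rV e x * cos (dotp z x))%:E).
Proof.
move=> e0; apply: (le_integrable _ _ _ (@integrable_expabs_rV e n e0)) => //=.
  apply/measurable_EFinP/measurable_funM; first exact: measurable_expabs_rV.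
  by apply: (measurableT_comp measurable_cos); exact: measurable_dotpr.
move=> t _; rewrite lee_fin normrM ler_piMr//.
by rewrite ler_norml cos_geN1 cos_le1.
Qed.

Lemma integrable_expabs_rV_sin e n (z : 'rV[R]_n) : (0 < e)%R ->
  (lebesgue_rV R n).-integrable setT (fun x => (expabs_rV e x * sin (dotp z x))%:E).
Proof.
move=> e0; apply: (le_integrable _ _ _ (@integrable_expabs_rV e n e0)) => //=.
  apply/measurable_EFinP/measurable_funM; first exact: measurable_expabs_rV.
  by apply: (measurableT_comp measurable_sin); exact: measurable_dotpr.
move=> t _; rewrite lee_fin normrM ler_piMr//.
by rewrite ler_norml sin_geN1 sin_le1.
Qed.

(** Both integrals go through the induction together, since the addition formulas mix them when a
    coordinate is split off. Every product containing a sine integral vanishes, leaving the product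
    of cosine integrals. *)
Lemma integral_expabs_rV_cos_sin e n (z : 'rV[R]_n) : (0 < e)%R ->
  \int[lebesgue_rV R n]_x (expabs_rV e x * cos (dotp z x))%:E = (poisson_rV e z)%:E /\
  \int[lebesgue_rV R n]_x (expabs_rV e x * sin (dotp z x))%:E = 0.
Proof.
move=> e0; elim: n z => [|n IHn] z.
  rewrite !ge0_integral_rV0; last 2 first.
  - exact: (measurable_int _ (integrable_expabs_rV_sin z e0)).
  - exact: (measurable_int _ (integrable_expabs_rV_cos z e0)).
  by rewrite /expabs_rV /poisson_rV /dotp !big_ord0 cos0 sin0 mulr1 mulr0.
have [IHc IHs] := IHn (rV_uncons z).2; set z0 := (rV_uncons z).1.
set z' := (rV_uncons z).2 in IHc IHs *.
have c1 := integrable_expabs_cos z0 e0; have s1 := integrable_expabs_sin z0 e0.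
have cn := integrable_expabs_rV_cos z' e0.
have sn := integrable_expabs_rV_sin z' e0.
have icc := integrable_prod c1 cn; have iss := integrable_prod s1 sn.
have isc := integrable_prod s1 cn; have ics := integrable_prod c1 sn.
have vcc := integral_prod c1 cn; have vss := integral_prod s1 sn.
have vsc := integral_prod s1 cn; have vcs := integral_prod c1 sn.
have icz : (@lebesgue_measure R \x lebesgue_rV R n).-integrable setT
    ((fun x => (expabs_rV e x * cos (dotp z x))%:E) \o @rV_cons R n).
  have := integrableB measurableT icc iss; apply: eq_integrable => // -[t y] _ /=.
  rewrite expabs_rV_cons dotp_cons cosD -EFinB; congr EFin; rewrite -/z0 -/z'; ring.
have isz : (@lebesgue_measure R \x lebesgue_rV R n).-integrable setT
    ((fun x => (expabs_rV e x * sin (dotp z x))%:E) \o @rV_cons R n).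
  have := integrableD measurableT isc ics; apply: eq_integrable => // -[t y] _ /=.
  rewrite expabs_rV_cons dotp_cons sinD -EFinD; congr EFin; rewrite -/z0 -/z'; ring.
rewrite (integral_rVS _ icz).2; last exact: (measurable_int _ (integrable_expabs_rV_cos z e0)).
rewrite (integral_rVS _ isz).2; last exact: (measurable_int _ (integrable_expabs_rV_sin z e0)).
split.
- transitivity (\int[@lebesgue_measure R \x lebesgue_rV R n]_p
     ((fun p => (expabs e p.1 * cos (z0 * p.1) * (expabs_rV e p.2 * cos (dotp z' p.2)))%:E) \-
      (fun p => (expabs e p.1 * sin (z0 * p.1) * (expabs_rV e p.2 * sin (dotp z' p.2)))%:E)) p).
    apply: eq_integral => -[t y] _ /=.
    rewrite expabs_rV_cons dotp_cons cosD -EFinB; congr EFin; rewrite -/z0 -/z'; ring.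
  rewrite integralB// vcc vss IHc IHs mule0 sube0 integral_expabs_cos// -EFinM.
  by rewrite poisson_rV_uncons.
- transitivity (\int[@lebesgue_measure R \x lebesgue_rV R n]_p
     ((fun p => (expabs e p.1 * sin (z0 * p.1) * (expabs_rV e p.2 * cos (dotp z' p.2)))%:E) \+
      (fun p => (expabs e p.1 * cos (z0 * p.1) * (expabs_rV e p.2 * sin (dotp z' p.2)))%:E)) p).
    apply: eq_integral => -[t y] _ /=.
    rewrite expabs_rV_cons dotp_cons sinD -EFinD; congr EFin; rewrite -/z0 -/z'; ring.
  by rewrite integralD// vsc vcs IHs mule0 adde0 integral_expabs_sin// mul0e.
Qed.

End poisson_rV.

(** * Measurability and sigma-finiteness for iterated integrals *)

Section parametric_integral.
Context d1 d2 (T1 : measurableType d1) (T2 : measurableType d2) (R : realType).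
Variable m2 : {sigma_finite_measure set T2 -> \bar R}.

(** The domination makes [f + g] nonnegative, so Tonelli yields measurability of its partial
    integral; subtracting the constant integral of [g] gives the claim. *)
Lemma measurable_Rintegral_param (f : T1 * T2 -> R) (g : T2 -> R) :
  measurable_fun setT f -> m2.-integrable setT (EFin \o g) ->
  (forall x y, `|f (x, y)| <= g y) ->
  measurable_fun setT (fun x => \int[m2]_y f (x, y)).
Proof.
move=> mf gi fg; have /integrableP[/measurable_EFinP mg _] := gi.
have fi x : m2.-integrable setT (fun y => (f (x, y))%:E).
  apply: (le_integrable _ _ _ gi) => //=.
    by apply/measurable_EFinP; exact: (measurableT_comp mf (pair1_measurable x)).
  by move=> y _; rewrite lee_fin (le_trans (fg x y))// ler_norm.
apply: (@eq_measurable_fun _ _ _ _ _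
   (fun x => fine (\int[m2]_y (f (x, y) + g y)%:E)%E - \int[m2]_y g y)).
  move=> x _; rewrite [X in fine X](_ : _ = \int[m2]_y ((f (x, y))%:E + (g y)%:E))%E//.
  rewrite integralD// fineD; [|exact: integrable_fin_num..].
  by rewrite addrK.
apply: measurable_funB => //; apply: measurableT_comp => //.
apply: (measurable_fun_fubini_tonelli_F (m2 := m2) (fun z => (f z + g z.2)%:E)).
  apply/measurable_EFinP; apply: measurable_funD => //.
  exact: measurableT_comp.
move=> [x y]; rewrite lee_fin/=; have := fg x y; rewrite ler_norml => /andP[h _].
by rewrite -lerBlDr sub0r.
Qed.
End parametric_integral.

Section product_sigma_finite.
Local Open Scope ereal_scope.
Context d1 d2 (T1 : measurableType d1) (T2 : measurableType d2) (R : realType).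
Variable m1 : {sigma_finite_measure set T1 -> \bar R}.
Variable m2 : {sigma_finite_measure set T2 -> \bar R}.

(* An alias of [m1 \x m2]: on [m1 \x m2] itself the inferred sigma-finite
   structure is the one for subprobability measures. *)
Definition sigma_finite_prod := m1 \x m2.

HB.instance Definition _ := Measure.on sigma_finite_prod.

Let sigma_finite_prodT : sigma_finite setT sigma_finite_prod.
Proof.
have /sigma_finiteP[F [TF ndF Foo]] := sigma_finiteT m1.
have /sigma_finiteP[G [TG ndG Goo]] := sigma_finiteT m2.
exists (fun k => F k `*` G k) => [|k].
  apply/seteqP; split=> // -[x y] _.
  have [i _ Fix] : (\bigcup_k F k) x by rewrite -TF.
  have [j _ Gjy] : (\bigcup_k G k) y by rewrite -TG.
  exists (maxn i j) => //; split => /=.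
    by move: x Fix; exact/subsetPset/ndF/leq_maxl.
  by move: y Gjy; exact/subsetPset/ndG/leq_maxr.
have [? ?] := Foo k; have [? ?] := Goo k; split; first exact: measurableX.
by rewrite /sigma_finite_prod product_measure1E// lte_mul_pinfty// ge0_fin_numE.
Qed.

HB.instance Definition _ := @Measure_isSigmaFinite.Build _ _ _
  sigma_finite_prod sigma_finite_prodT.

End product_sigma_finite.

(** * Plancherel's theorem *)

Section real_plancherel.
Context {R : realType} (n : nat).
Local Notation V := 'rV[R]_n.
Local Notation L := (lebesgue_rV R n).
Implicit Types (a b : V -> R) (e : R).

(** For real [a], [cosF a] and [- sinF a] are the real and imaginary parts of the Fourier
    transform. *)
Definition cosF a (xi : V) : R := \int[L]_x (a x * cos (dotp x xi)).
Definition sinF a (xi : V) : R := \int[L]_x (a x * sin (dotp x xi)).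

Lemma normr_cos_le1 (x : R) : `|cos x| <= 1.
Proof. by rewrite ler_norml cos_geN1 cos_le1. Qed.

Lemma normr_sin_le1 (x : R) : `|sin x| <= 1.
Proof. by rewrite ler_norml sin_geN1 sin_le1. Qed.

Lemma measurable_swap_dotp : measurable_fun setT (fun p : V * V => dotp p.2 p.1).
Proof. by apply: eq_measurable_fun (@measurable_dotp R n) => p _; exact: dotpC. Qed.

Lemma integrable_cosF a xi : L.-integrable setT (EFin \o a) ->
  L.-integrable setT (fun x => (a x * cos (dotp x xi))%:E).
Proof.
move=> ai; have /integrableP[/measurable_EFinP ma _] := ai.
apply: (le_integrable _ _ _ ai) => //=.
  apply/measurable_EFinP/measurable_funM => //.
  apply: (measurableT_comp (@measurable_cos R)).
  by apply: eq_measurable_fun (measurable_dotpr xi) => x _; exact: dotpC.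
by move=> x _; rewrite lee_fin normrM ler_piMr// normr_cos_le1.
Qed.

Lemma integrable_sinF a xi : L.-integrable setT (EFin \o a) ->
  L.-integrable setT (fun x => (a x * sin (dotp x xi))%:E).
Proof.
move=> ai; have /integrableP[/measurable_EFinP ma _] := ai.
apply: (le_integrable _ _ _ ai) => //=.
  apply/measurable_EFinP/measurable_funM => //.
  apply: (measurableT_comp (@measurable_sin R)).
  by apply: eq_measurable_fun (measurable_dotpr xi) => x _; exact: dotpC.
by move=> x _; rewrite lee_fin normrM ler_piMr// normr_sin_le1.
Qed.

Lemma measurable_cosF a : L.-integrable setT (EFin \o a) -> measurable_fun setT (cosF a).
Proof.
move=> ai; have /integrableP[/measurable_EFinP ma _] := ai.
apply: (measurable_Rintegral_param (f := fun z => a z.2 * cos (dotp z.2 z.1)) (g := fun x => `|a x|)).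
- apply: measurable_funM; first exact: measurableT_comp.
  by apply: (measurableT_comp (@measurable_cos R)); exact: measurable_swap_dotp.
- exact: integrable_norm.
- by move=> x y /=; rewrite normrM ler_piMr// normr_cos_le1.
Qed.

Lemma measurable_sinF a : L.-integrable setT (EFin \o a) -> measurable_fun setT (sinF a).
Proof.
move=> ai; have /integrableP[/measurable_EFinP ma _] := ai.
apply: (measurable_Rintegral_param (f := fun z => a z.2 * sin (dotp z.2 z.1)) (g := fun x => `|a x|)).
- apply: measurable_funM; first exact: measurableT_comp.
  by apply: (measurableT_comp (@measurable_sin R)); exact: measurable_swap_dotp.
- exact: integrable_norm.
- by move=> x y /=; rewrite normrM ler_piMr// normr_sin_le1.
Qed.

Local Open Scope ereal_scope.

(** Squares of integrals are double integrals, and cos s cos t + sin s sin t = cos (s - t). *)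
Lemma sqr_cosF_sinF a xi : L.-integrable setT (EFin \o a) ->
  (cosF a xi ^+ 2 + sinF a xi ^+ 2)%:E =
  \int[L \x L]_z (a z.1 * a z.2 * cos (dotp (z.1 - z.2) xi))%:E.
Proof.
move=> ai; have ci := integrable_cosF xi ai; have si := integrable_sinF xi ai.
have cci := integrable_prod ci ci; have ssi := integrable_prod si si.
rewrite EFinD !expr2 !EFinM /cosF /sinF.
rewrite /Rintegral !fineK; [|exact: integrable_fin_num..].
rewrite -!integral_prod// -integralD//; apply: eq_integral => -[x y] _ /=.
rewrite -EFinD; congr EFin; rewrite dotpBl cosB; ring.
Qed.

Lemma measurable_poisson_sub e : (0 < e)%R ->
  measurable_fun setT (fun z : V * V => poisson_rV e (z.1 - z.2)).
Proof.
move=> e0; apply: (measurableT_comp (@measurable_poisson_rV R e n e0)).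
exact: measurable_rV_sub.
Qed.

(** Damping makes the integrand in [(x, y, xi)] absolutely integrable, dominated by [|a x| |a y|]
    times the damping factor. Fubini then allows the [xi] integral to be done first, which produces
    the kernel at [x - y]. *)
Lemma integral_sqr_cosF_sinF a e : (0 < e)%R -> L.-integrable setT (EFin \o a) ->
  (L \x L).-integrable setT (fun z => (a z.1 * a z.2 * poisson_rV e (z.1 - z.2))%:E) /\
  \int[L]_xi (expabs_rV e xi * (cosF a xi ^+ 2 + sinF a xi ^+ 2))%:E =
  \int[L \x L]_z (a z.1 * a z.2 * poisson_rV e (z.1 - z.2))%:E.
Proof.
move=> e0 ai; have aai := integrable_prod ai ai.
have Ki := @integrable_expabs_rV R e n e0.
pose LL : {sigma_finite_measure set (V * V)%type -> \bar R} := sigma_finite_prod L L.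
have aaKi := @integrable_prod _ _ _ _ R LL L (fun z => (a z.1 * a z.2)%R) _ aai Ki.
have /integrableP[/measurable_EFinP ma _] := ai.
pose F (w : (V * V) * V) : \bar R :=
  (a w.1.1 * a w.1.2 * (expabs_rV e w.2 * cos (dotp (w.1.1 - w.1.2) w.2)))%:E.
have Fi : (LL \x L).-integrable setT F.
  apply: (le_integrable _ _ _ aaKi) => //=.
    apply/measurable_EFinP; apply: measurable_funM.
      apply: measurable_funM; apply: measurableT_comp => //; exact: measurableT_comp.
    apply: measurable_funM.
      by apply: (measurableT_comp (@measurable_expabs_rV R e n)).
    apply: (measurableT_comp (@measurable_cos R)).
    apply: (measurableT_comp (@measurable_dotp R n)
      (g := fun w : (V * V) * V => (w.1.1 - w.1.2, w.2)%R)).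
    apply: measurable_fun_pair => //.
    exact: (measurableT_comp (@measurable_rV_sub R n) measurable_fst).
  move=> w _; rewrite lee_fin !normrM ler_wpM2l// ?mulr_ge0//.
  by rewrite ler_piMr// normr_cos_le1.
have FE z : fubini_F L F z = (a z.1 * a z.2 * poisson_rV e (z.1 - z.2))%:E.
  rewrite /fubini_F /F /= EFinM -(integral_expabs_rV_cos_sin (z.1 - z.2) e0).1.
  rewrite -integralZl//; exact: integrable_expabs_rV_cos.
have GE xi : fubini_G LL F xi = (expabs_rV e xi * (cosF a xi ^+ 2 + sinF a xi ^+ 2))%:E.
  rewrite /fubini_G /F /= EFinM sqr_cosF_sinF// -integralZl//.
    by apply: eq_integral => z _; rewrite -EFinM; congr EFin; ring.
  apply: (le_integrable _ _ _ aai) => //=.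
    apply/measurable_EFinP; apply: measurable_funM.
      by apply: measurable_funM; apply: measurableT_comp.
    apply: (measurableT_comp (@measurable_cos R)).
    have := measurableT_comp (measurable_dotpr xi) (@measurable_rV_sub R n).
    by apply: eq_measurable_fun => z _; exact: dotpC.
  by move=> z _; rewrite lee_fin normrM ler_piMr// normr_cos_le1.
split.
  have := integrable_fubini_F Fi.
  by apply: eq_integrable => // z _; exact: FE.
have /esym := Fubini Fi.
under eq_integral do rewrite -/(fubini_G LL F _) GE.
by move=> ->; apply: eq_integral => z _; exact: FE.
Qed.

Lemma integral_poisson_subr e (x : V) : (0 < e)%R ->
  \int[L]_y (poisson_rV e (x - y))%:E = ((2 * pi) ^+ n)%:E.
Proof.
move=> e0; rewrite -(integral_poisson_rV n e0).
rewrite -(@ge0_integral_rV_sub R n x (fun y => (poisson_rV e y)%:E)).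
- by apply: eq_integral => y _; rewrite -poisson_rVN opprB.
- by apply/measurable_EFinP; exact: measurable_poisson_rV.
- by move=> y; rewrite lee_fin poisson_rV_ge0.
Qed.

Lemma ge0_integral_poisson_prod1 e (f : V -> R) : (0 < e)%R -> measurable_fun setT f ->
  (forall x, 0 <= f x)%R ->
  \int[L \x L]_z (f z.1 * poisson_rV e (z.1 - z.2))%:E =
  ((2 * pi) ^+ n)%:E * \int[L]_x (f x)%:E.
Proof.
move=> e0 mf f0; rewrite fubini_tonelli1; last 2 first.
- apply/measurable_EFinP/measurable_funM; first exact: measurableT_comp.
  exact: measurable_poisson_sub.
- by move=> z; rewrite lee_fin mulr_ge0// poisson_rV_ge0.
rewrite /fubini_F -ge0_integralZl//; last 3 first.
- exact/measurable_EFinP.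
- by move=> x _; rewrite lee_fin.
- by rewrite lee_fin exprn_ge0// mulr_ge0// pi_ge0.
apply: eq_integral => x _ /=; rewrite muleC -(integral_poisson_subr x e0).
rewrite -ge0_integralZl_EFin//.
- by move=> y _; rewrite lee_fin poisson_rV_ge0.
- apply/measurable_EFinP.
  exact: (measurableT_comp (measurable_poisson_sub e0) (pair1_measurable x)).
Qed.

Lemma ge0_integral_poisson_prod2 e (f : V -> R) : (0 < e)%R -> measurable_fun setT f ->
  (forall x, 0 <= f x)%R ->
  \int[L \x L]_z (f z.2 * poisson_rV e (z.1 - z.2))%:E =
  ((2 * pi) ^+ n)%:E * \int[L]_x (f x)%:E.
Proof.
move=> e0 mf f0.
have mF : measurable_fun setT (fun z : V * V => (f z.2 * poisson_rV e (z.1 - z.2))%:E).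
  apply/measurable_EFinP/measurable_funM; first exact: measurableT_comp.
  exact: measurable_poisson_sub.
have F0 z : 0 <= (f z.2 * poisson_rV e (z.1 - z.2))%:E.
  by rewrite lee_fin mulr_ge0// poisson_rV_ge0.
rewrite fubini_tonelli2// -(ge0_integral_poisson_prod1 e0 mf f0).
rewrite fubini_tonelli1; last 2 first.
- apply/measurable_EFinP/measurable_funM; first exact: measurableT_comp.
  exact: measurable_poisson_sub.
- by move=> z; rewrite lee_fin mulr_ge0// poisson_rV_ge0.
apply: eq_integral => y _; apply: eq_integral => x _ /=.
by rewrite -poisson_rVN opprB.
Qed.

(** Applied with [c = 2] to bound the defect and with [c = 1/2] in the exact identity. *)
Lemma ge0_integral_poisson_sum e (c : R) a : (0 < e)%R -> (0 <= c)%R -> measurable_fun setT a ->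
  \int[L \x L]_z ((c * a z.1 ^+ 2 * poisson_rV e (z.1 - z.2))%:E +
    (c * a z.2 ^+ 2 * poisson_rV e (z.1 - z.2))%:E) =
  (2 * c * (2 * pi) ^+ n)%:E * \int[L]_x (a x ^+ 2)%:E.
Proof.
move=> e0 c0 ma; have ma2 : measurable_fun setT (fun x => c * a x ^+ 2)%R.
  by apply: measurable_funM => //; exact: measurable_funX.
have a20 x : (0 <= c * a x ^+ 2)%R by rewrite mulr_ge0// sqr_ge0.
rewrite ge0_integralD//; last 4 first.
- by move=> z _; rewrite lee_fin mulr_ge0 ?poisson_rV_ge0.
- apply/measurable_EFinP/measurable_funM; last exact: measurable_poisson_sub.
  exact: (measurableT_comp ma2 measurable_fst).
- by move=> z _; rewrite lee_fin mulr_ge0 ?poisson_rV_ge0.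
- apply/measurable_EFinP/measurable_funM; last exact: measurable_poisson_sub.
  exact: (measurableT_comp ma2 measurable_snd).
rewrite (ge0_integral_poisson_prod1 e0 ma2 a20) (ge0_integral_poisson_prod2 e0 ma2 a20).
under eq_integral do rewrite EFinM.
rewrite ge0_integralZl_EFin//; last 2 first.
- by move=> x _; rewrite lee_fin sqr_ge0.
- by apply/measurable_EFinP; exact: measurable_funX.
rewrite muleA -EFinM -ge0_muleDl ?lee_fin ?mulr_ge0 ?exprn_ge0 ?mulr_ge0 ?pi_ge0//.
by rewrite -EFinD (_ : _ + _ = 2 * c * (2 * pi) ^+ n)%R//; ring.
Qed.

(* The defect in Plancherel's identity when the Fourier side is damped by
   [expabs_rV e]; it vanishes as [e] tends to 0. *)
Definition poissonE e a : \bar R :=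
  \int[L \x L]_z ((a z.1 - a z.2) ^+ 2 * poisson_rV e (z.1 - z.2))%:E.

Lemma measurable_poissonE e a : (0 < e)%R -> measurable_fun setT a ->
  measurable_fun setT (fun z => ((a z.1 - a z.2) ^+ 2 * poisson_rV e (z.1 - z.2))%:E).
Proof.
move=> e0 ma; apply/measurable_EFinP/measurable_funM; last exact: measurable_poisson_sub.
by apply: measurable_funX; apply: measurable_funB; apply: measurableT_comp.
Qed.

Lemma poissonE_ge0 e a : (0 < e)%R -> 0 <= poissonE e a.
Proof.
by move=> e0; apply: integral_ge0 => z _; rewrite lee_fin mulr_ge0 ?sqr_ge0 ?poisson_rV_ge0.
Qed.

Lemma poissonE_le e a : (0 < e)%R -> measurable_fun setT a ->
  poissonE e a <= (4 * (2 * pi) ^+ n)%:E * \int[L]_x (a x ^+ 2)%:E.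
Proof.
move=> e0 ma; have ma2 : measurable_fun setT (fun x => 2 * a x ^+ 2)%R.
  by apply: measurable_funM => //; exact: measurable_funX.
apply: (@le_trans _ _ (\int[L \x L]_z ((2 * a z.1 ^+ 2 * poisson_rV e (z.1 - z.2))%:E +
    (2 * a z.2 ^+ 2 * poisson_rV e (z.1 - z.2))%:E))).
  apply: ge0_le_integral => //.
  - by move=> z _; rewrite lee_fin mulr_ge0 ?sqr_ge0 ?poisson_rV_ge0.
  - exact: measurable_poissonE.
  - apply: emeasurable_funD; apply/measurable_EFinP/measurable_funM; try exact: measurable_poisson_sub.
    + exact: (measurableT_comp ma2 measurable_fst).
    + exact: (measurableT_comp ma2 measurable_snd).
  - move=> z _; rewrite -EFinD lee_fin -mulrDl ler_wpM2r ?poisson_rV_ge0//.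
    have := sqr_ge0 (a z.1 + a z.2); nra.
by rewrite (ge0_integral_poisson_sum e0 _ ma)// -natrM.
Qed.

Lemma poissonE_add e a b : (0 < e)%R -> measurable_fun setT a -> measurable_fun setT b ->
  poissonE e (fun x => a x + b x)%R <= 2%:E * poissonE e a + 2%:E * poissonE e b.
Proof.
move=> e0 ma mb; have mE := measurable_poissonE e0.
have E0 (c : V -> R) (z : V * V) : 0 <= ((c z.1 - c z.2) ^+ 2 * poisson_rV e (z.1 - z.2))%:E.
  by rewrite lee_fin mulr_ge0 ?sqr_ge0 ?poisson_rV_ge0.
rewrite -!ge0_integralZl_EFin//; [|exact: mE..].
rewrite -ge0_integralD//; last 4 first.
- by move=> z _; rewrite mule_ge0.
- by apply: measurable_funeM; exact: mE.
- by move=> z _; rewrite mule_ge0.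
- by apply: measurable_funeM; exact: mE.
apply: ge0_le_integral => //.
- by move=> z _; exact: (E0 (fun x => a x + b x)%R).
- by apply: (mE (fun x => a x + b x)%R); exact: measurable_funD.
- by apply: emeasurable_funD; apply: measurable_funeM; exact: mE.
- move=> z _; rewrite -!EFinM -EFinD lee_fin !mulrA -mulrDl ler_wpM2r ?poisson_rV_ge0//.
  have := sqr_ge0 (a z.1 - a z.2 - (b z.1 - b z.2)); nra.
Qed.

Lemma poissonE_scale e a (c : R) : (0 < e)%R -> measurable_fun setT a ->
  poissonE e (fun x => c * a x)%R = (c ^+ 2)%:E * poissonE e a.
Proof.
move=> e0 ma; rewrite -ge0_integralZl_EFin ?sqr_ge0//.
- by apply: eq_integral => z _; rewrite -EFinM; congr EFin; ring.
- by move=> z _; rewrite lee_fin mulr_ge0 ?sqr_ge0 ?poisson_rV_ge0.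
- exact: measurable_poissonE.
Qed.

(** Polarisation: 2 (a x) (a y) = (a x)^2 + (a y)^2 - (a x - a y)^2, where the two squares are
    integrated against a kernel of mass [(2 * pi) ^+ n] in either variable. *)
Lemma poisson_identity e a : (0 < e)%R -> L.-integrable setT (EFin \o a) ->
  \int[L]_x (a x ^+ 2)%:E < +oo ->
  \int[L]_xi (expabs_rV e xi * (cosF a xi ^+ 2 + sinF a xi ^+ 2))%:E +
    2^-1%:E * poissonE e a = ((2 * pi) ^+ n)%:E * \int[L]_x (a x ^+ 2)%:E.
Proof.
move=> e0 ai a2; have [Ji ->] := integral_sqr_cosF_sinF e0 ai.
have /integrableP[/measurable_EFinP ma _] := ai.
have Efin : poissonE e a < +oo.
  apply: (le_lt_trans (poissonE_le e0 ma)); rewrite lte_mul_pinfty// lee_fin.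
  by rewrite mulr_ge0// exprn_ge0// mulr_ge0// pi_ge0.
have Ei : (L \x L).-integrable setT (fun z => ((a z.1 - a z.2) ^+ 2 * poisson_rV e (z.1 - z.2))%:E).
  apply/integrableP; split; first exact: measurable_poissonE.
  apply: le_lt_trans Efin; rewrite le_eqVlt; apply/orP; left; apply/eqP.
  apply: eq_integral => z _.
  by rewrite gee0_abs// lee_fin mulr_ge0 ?sqr_ge0 ?poisson_rV_ge0.
rewrite -integralZl// -integralD//; last exact: integrableZl.
transitivity (\int[L \x L]_z ((2^-1 * a z.1 ^+ 2 * poisson_rV e (z.1 - z.2))%:E +
    (2^-1 * a z.2 ^+ 2 * poisson_rV e (z.1 - z.2))%:E)).
  by apply: eq_integral => z _; rewrite -EFinM -!EFinD; congr EFin; field.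
by rewrite (ge0_integral_poisson_sum e0 _ ma)// mulfV// mul1r.
Qed.

End real_plancherel.

(** * Vanishing of the Poisson defect on L^2 *)

Section dominated.
Local Open Scope ereal_scope.
Context d (T : measurableType d) (R : realType) (mu : {measure set T -> \bar R}).

Lemma ge0_dominated_cvg0 (f_ : nat -> T -> \bar R) (g : T -> \bar R) :
  (forall k, measurable_fun setT (f_ k)) -> (forall k x, 0 <= f_ k x) ->
  (forall x, f_ ^~ x @ \oo --> 0) -> mu.-integrable setT g ->
  (forall k x, f_ k x <= g x) ->
  (fun k => \int[mu]_x f_ k x) @ \oo --> 0.
Proof.
move=> mf f0 fc gi fg.
have [||_ _] := @dominated_convergence _ _ _ mu setT measurableT f_ (cst 0) g
  mf (measurable_cst _) _ gi _.
- exact: aeW.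
- by apply: aeW => x k _; rewrite gee0_abs.
by rewrite integral0.
Qed.

Lemma integrable_indic_lty (A : set T) : measurable A -> mu A < +oo ->
  mu.-integrable setT (fun x => (\1_A x)%:E).
Proof.
move=> mA Aoo; apply/integrableP; split.
  by apply/measurable_EFinP; exact: measurable_indic.
rewrite (eq_integral (fun x => (\1_A x)%:E)); last by move=> x _; rewrite gee0_abs.
by rewrite integral_indic// setIT.
Qed.
End dominated.

Section plancherel_density.
Context {R : realType} (n : nat).
Local Notation V := 'rV[R]_n.
Local Notation L := (lebesgue_rV R n).
Implicit Types (a b : V -> R).

Definition epsn (m : nat) : R := m.+1%:R^-1.

Lemma epsn_gt0 m : 0 < epsn m. Proof. by rewrite invr_gt0. Qed.

Lemma epsn_lt (r : R) : 0 < r -> \forall m \near \oo, epsn m < r.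
Proof. by move=> r0; exact: (near_infty_natSinv_lt (PosNum r0)). Qed.

Local Open Scope ereal_scope.

Lemma ge0_cvg0P (u : nat -> \bar R) : (forall m, 0 <= u m) ->
  (forall delta : R, (0 < delta)%R -> \forall m \near \oo, u m <= delta%:E) <->
  u @ \oo --> 0.
Proof.
move=> u0; split=> [H|/fine_cvgP[Hf Hc] d d0].
  apply/fine_cvgP; split.
    have := H _ ltr01; apply: filterS => m um.
    by rewrite ge0_fin_numE// (le_lt_trans um)// ltry.
  apply/cvgr0Pnorm_le => d d0; have := H _ d0; apply: filterS => m um /=.
  have ufin : u m \is a fin_num by rewrite ge0_fin_numE// (le_lt_trans um)// ltry.
  by rewrite ger0_norm ?fine_ge0// -lee_fin fineK.
have /cvgr0Pnorm_lt/(_ _ d0) := Hc.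
move: Hf; apply: filterS2 => m fm /= fd.
by rewrite -(fineK fm) lee_fin; apply/ltW; apply: le_lt_trans fd; exact: ler_norm.
Qed.

(** The defect is followed along a sequence of parameters only: this suffices for Plancherel and
    suits dominated convergence. *)
Definition poisson_null a := forall delta : R, (0 < delta)%R ->
  \forall m \near \oo, poissonE (epsn m) a <= delta%:E.

Lemma poisson_nullD a b : measurable_fun setT a -> measurable_fun setT b ->
  poisson_null a -> poisson_null b -> poisson_null (fun x => a x + b x)%R.
Proof.
move=> ma mb na nb d d0; have d4 : (0 < d / 4)%R by rewrite divr_gt0.
have Ha := na _ d4; have Hb := nb _ d4; near=> m.
rewrite (le_trans (poissonE_add (epsn_gt0 m) ma mb))//.
rewrite (_ : d%:E = 2%:E * (d / 4)%:E + 2%:E * (d / 4)%:E); last first.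
  by rewrite -!EFinM -EFinD; congr EFin; field.
by apply: leeD; rewrite lee_pmul2l//; near: m.
Unshelve. all: by end_near. Qed.

Lemma poisson_nullZ a (c : R) : measurable_fun setT a ->
  poisson_null a -> poisson_null (fun x => c * a x)%R.
Proof.
move=> ma na d d0; have c0 : (0 < c ^+ 2 + 1)%R by rewrite ltr_wpDl ?sqr_ge0.
have Ha := na _ (divr_gt0 d0 c0); near=> m.
rewrite poissonE_scale//; last exact: epsn_gt0.
apply: (@le_trans _ _ ((c ^+ 2 + 1)%:E * (d / (c ^+ 2 + 1))%:E)).
  apply: lee_pmul; rewrite ?lee_fin ?sqr_ge0 ?poissonE_ge0 ?epsn_gt0// ?lerDl//.
  by near: m.
by rewrite -EFinM mulrC divfK// gt_eqF.
Unshelve. all: by end_near. Qed.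

(** [poissonE_le] controls the defect by the L^2 norm uniformly in the parameter, so this class is
    closed in L^2. *)
Lemma poisson_null_approx a : measurable_fun setT a ->
  (forall delta : R, (0 < delta)%R -> exists b, [/\ measurable_fun setT b, poisson_null b &
     \int[L]_x ((a x - b x) ^+ 2)%:E <= delta%:E]) -> poisson_null a.
Proof.
(* With 16 = 2 * 2 * 4, the part [a - b] contributes at most 2 * 4 (2 pi)^n * d / C = d / 2; the
   part [b] contributes at most 2 * d / 4. *)
move=> ma H d d0; pose C : R := (16 * (2 * pi) ^+ n)%R.
have C0 : (0 < C)%R by rewrite mulr_gt0// exprn_gt0// mulr_gt0// pi_gt0.
have [b [mb nb ab]] := H _ (divr_gt0 d0 C0).
have d4 : (0 < d / 4)%R by rewrite divr_gt0.
have Hb := nb _ d4; near=> m.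
have -> : a = (fun x => b x + (a x - b x))%R by apply/funext => x; rewrite addrC subrK.
have mab : measurable_fun setT (fun x => a x - b x)%R by exact: measurable_funB.
rewrite (le_trans (poissonE_add (epsn_gt0 m) mb mab))//.
rewrite (_ : d%:E = 2%:E * (d / 4)%:E + 2%:E * ((4 * (2 * pi) ^+ n)%:E * (d / C)%:E)); last first.
  rewrite -!EFinM -EFinD; congr EFin; rewrite /C; field.
  by rewrite gt_eqF// exprn_gt0// mulr_gt0// pi_gt0.
apply: leeD; rewrite lee_pmul2l//; first by near: m.
apply: (le_trans (poissonE_le (epsn_gt0 m) mab)); rewrite lee_pmul2l ?lte_fin//.
by rewrite mulr_gt0// exprn_gt0// mulr_gt0// pi_gt0.
Unshelve. all: by end_near. Qed.

Lemma eq_poisson_null a b : a =1 b -> poisson_null a -> poisson_null b.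
Proof. by move=> /funext ->. Qed.

Lemma poisson_rV_scale e (w : V) : (0 < e)%R ->
  poisson_rV e (e *: w) = (e ^- n * poisson_rV 1 w)%R.
Proof.
move=> e0; rewrite /poisson_rV.
rewrite (eq_bigr (fun i => e^-1 * poisson1 1 (w ord0 i)))%R; last first.
  move=> i _; rewrite mxE /poisson1; field.
  by apply/and3P; split; rewrite gt_eqF// ltr_pwDl ?sqr_ge0 ?exprn_gt0.
by rewrite big_split/= prodr_const card_ord exprVn.
Qed.

(** The substitution [z = e w] turns the kernel into the fixed integrable one and the region into
    [|e w| >= r], which loses every point [w] as [e] tends to 0; dominated convergence concludes. *)
Lemma poisson_tail (r delta : R) : (0 < r)%R -> (0 < delta)%R ->
  \forall m \near \oo,
   \int[L]_z (\1_(~` ball (0%R : V) r) z * poisson_rV (epsn m) z)%:E <= delta%:E.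
Proof.
move=> r0 d0.
have mB : measurable (~` ball (0%R : V) r) by apply: measurableC; exact: measurable_ball_rV.
pose F (m : nat) (w : V) : \bar R := (\1_(~` ball (0%R : V) r) (epsn m *: w) * poisson_rV 1 w)%:E.
have mp e : (0 < e)%R -> measurable_fun setT (@poisson_rV R e n).
  by move=> e0; exact: measurable_poisson_rV.
have mI m : measurable_fun setT (fun w : V => \1_(~` ball (0%R : V) r) (epsn m *: w) : R).
  have := measurableT_comp (@measurable_indic _ _ R setT _ mB)
    (@measurable_rV_affine R n (epsn m) 0%R).
  by apply: eq_measurable_fun => w _ /=; rewrite addr0.
have FE m : \int[L]_z (\1_(~` ball (0%R : V) r) z * poisson_rV (epsn m) z)%:E = \int[L]_w F m w.
  have e0 := epsn_gt0 m; set e := epsn m in e0 *.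
  have en0 : (0 < e ^- n)%R by rewrite invr_gt0 exprn_gt0.
  have mG : measurable_fun setT (fun z : V => (\1_(~` ball (0%R : V) r) z * poisson_rV e z)%:E).
    by apply/measurable_EFinP; apply: measurable_funM; [exact: measurable_indic|exact: mp].
  have G0 (z : V) : 0 <= (\1_(~` ball (0%R : V) r) z * poisson_rV e z)%:E.
    by rewrite lee_fin mulr_ge0 ?poisson_rV_ge0.
  have := ge0_integral_rV_affine (0%R : V) e0 mG G0.
  rewrite (eq_integral (fun w => (e ^- n)%:E * F m w)); last first.
    by move=> w _; rewrite addr0 poisson_rV_scale// /F -EFinM; congr EFin; rewrite /e; ring.
  rewrite ge0_integralZl_EFin ?ltW//; last 2 first.
  - by move=> w _; rewrite lee_fin mulr_ge0 ?poisson_rV_ge0.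
  - by apply/measurable_EFinP; apply: measurable_funM; [exact: mI|exact: mp].
  move=> /(congr1 (fun t => (e ^+ n)%:E * t)).
  by rewrite !muleA -EFinM mulfV ?gt_eqF ?exprn_gt0// !mul1e => ->.
have pint : L.-integrable setT (fun w : V => (poisson_rV 1 w)%:E).
  apply/integrableP; split; first by apply/measurable_EFinP; exact: mp.
  rewrite (eq_integral (fun w : V => (poisson_rV 1 w)%:E)) ?integral_poisson_rV ?ltry//.
  by move=> w _; rewrite gee0_abs// lee_fin poisson_rV_ge0.
have H : (fun m => \int[L]_x F m x) @ \oo --> 0.
  apply: (ge0_dominated_cvg0 _ _ _ pint).
  - by move=> m; apply/measurable_EFinP; apply: measurable_funM; [exact: mI|exact: mp].
  - by move=> m w; rewrite lee_fin mulr_ge0 ?poisson_rV_ge0.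
  - move=> w; apply: cvg_near_cst.
    have rw : (0 < r / (`|w| + 1))%R by rewrite divr_gt0// ltr_wpDl.
    have := epsn_lt rw; apply: filterS => m; rewrite ltr_pdivlMr ?ltr_wpDl// => mr.
    rewrite /F indicE memNset ?mul0r//=; apply: contrapT => /=.
    rewrite notK => -[]; rewrite -ball_normE /ball_/= sub0r normrN normrZ.
    rewrite (gtr0_norm (epsn_gt0 m)); apply: le_lt_trans mr.
    by rewrite ler_pM2l ?epsn_gt0// lerDl.
  - move=> m w; rewrite lee_fin.
    by rewrite ler_piMl ?poisson_rV_ge0// indicE; case: (_ \in _).
move/ge0_cvg0P : H => /(_ _)/(_ _ d0) H.
have F0 m : 0 <= \int[L]_x F m x.
  by apply: integral_ge0 => w _; rewrite lee_fin mulr_ge0 ?poisson_rV_ge0.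
by have := H F0; apply: filterS => m; rewrite FE.
Qed.

(** The squared difference of indicators is 1 exactly when one point is in [A] and the other is not;
    the kernel being even, the two cases contribute equally. Measurability in [x] is recorded for
    dominated convergence. *)
Lemma poissonE_indic e (A : set V) : (0 < e)%R -> measurable A ->
  poissonE e (\1_A : V -> R) =
  2%:E * \int[L]_x \int[L]_y (\1_A x * (\1_(~` A) y * poisson_rV e (x - y)))%:E /\
  measurable_fun setT (fun x => \int[L]_y (\1_A x * (\1_(~` A) y * poisson_rV e (x - y)))%:E).
Proof.
move=> e0 mA; have mAc := measurableC mA.
have mi B : measurable B -> measurable_fun setT (\1_B : V -> R) by exact: measurable_indic.
pose F (z : V * V) : \bar R := (\1_A z.1 * (\1_(~` A) z.2 * poisson_rV e (z.1 - z.2)))%:E.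
pose G (z : V * V) : \bar R := (\1_A z.2 * (\1_(~` A) z.1 * poisson_rV e (z.1 - z.2)))%:E.
have mF : measurable_fun setT F.
  apply/measurable_EFinP; apply: measurable_funM.
    exact: (measurableT_comp (mi _ mA) measurable_fst).
  apply: measurable_funM; last exact: measurable_poisson_sub.
  exact: (measurableT_comp (mi _ mAc) measurable_snd).
have mG : measurable_fun setT G.
  apply/measurable_EFinP; apply: measurable_funM.
    exact: (measurableT_comp (mi _ mA) measurable_snd).
  apply: measurable_funM; last exact: measurable_poisson_sub.
  exact: (measurableT_comp (mi _ mAc) measurable_fst).
have F0 z : 0 <= F z by rewrite lee_fin !mulr_ge0// poisson_rV_ge0.
have G0 z : 0 <= G z by rewrite lee_fin !mulr_ge0// poisson_rV_ge0.
split; last exact: (measurable_fun_fubini_tonelli_F (m2 := L) F mF F0).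
set X := \int[L]_x _.
have FX : \int[L]_x fubini_F L F x = X by [].
have GX : \int[L]_x fubini_G L G x = X.
  rewrite /X; apply: eq_integral => x _; apply: eq_integral => y _; rewrite /G /=.
  by rewrite -(poisson_rVN _ (x - y)) opprB.
have X0 : 0 <= X by rewrite -FX; apply: integral_ge0 => x _; exact: integral_ge0.
transitivity (X + X); last first.
  move: X X0 {FX GX} => X X0; rewrite (_ : 2%:E = (1 + 1)%:E)// EFinD.
  by rewrite ge0_muleDl ?mul1e// lee01.
rewrite -[X in X + _]FX -GX -(fubini_tonelli1 F mF F0) -(fubini_tonelli2 G mG G0).
rewrite -ge0_integralD; [|exact: measurableT|by move=> z _|exact: mF|by move=> z _|exact: mG].
apply: eq_integral => -[x y] _; rewrite /F /G -EFinD; congr EFin => /=.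
rewrite !indicE !in_setC; case: (x \in A); case: (y \in A) => /=; ring.
Qed.

(** A point of an open set has a ball inside it, so the inner integral over the complement is at
    most a Poisson tail. The finite measure makes [(2 * pi) ^+ n] times the indicator an integrable
    majorant. *)
Lemma poisson_null_open (A : set V) : open A -> L A < +oo ->
  poisson_null (\1_A : V -> R).
Proof.
move=> oA Aoo; have mA := open_measurable_rV oA; have mAc := measurableC mA.
pose f_ m (x : V) := \int[L]_y (\1_A x * (\1_(~` A) y * poisson_rV (epsn m) (x - y)))%:E.
have f0 m x : 0 <= f_ m x.
  by apply: integral_ge0 => y _; rewrite lee_fin !mulr_ge0// poisson_rV_ge0// epsn_gt0.
have mf m : measurable_fun setT (f_ m) := (poissonE_indic (epsn_gt0 m) mA).2.
have C0 : (0 <= (2 * pi) ^+ n :> R)%R by rewrite exprn_ge0// mulr_ge0// pi_ge0.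
have mk m (x : V) : measurable_fun setT (fun y : V => poisson_rV (epsn m) (x - y)).
  exact: (measurableT_comp (measurable_poisson_sub (epsn_gt0 m)) (pair1_measurable x)).
have mi B : measurable B -> measurable_fun setT (\1_B : V -> R) by exact: measurable_indic.
have fg m x : f_ m x <= (((2 * pi) ^+ n) * \1_A x)%:E.
  rewrite mulrC EFinM -(integral_poisson_subr x (epsn_gt0 m)) -ge0_integralZl_EFin//; last 2 first.
  - by move=> y _; rewrite lee_fin poisson_rV_ge0// epsn_gt0.
  - by apply/measurable_EFinP; exact: mk.
  apply: ge0_le_integral => //.
  - by move=> y _; rewrite lee_fin !mulr_ge0// poisson_rV_ge0// epsn_gt0.
  - apply/measurable_EFinP; apply: measurable_funM => //.
    by apply: measurable_funM; [exact: mi|exact: mk].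
  - by apply/measurable_EFinP; apply: measurable_funM => //; exact: mk.
  - move=> y _; rewrite -EFinM lee_fin ler_wpM2l// ler_piMl ?poisson_rV_ge0 ?epsn_gt0//.
have gi : L.-integrable setT (fun x => (((2 * pi) ^+ n) * \1_A x)%:E).
  under eq_fun do rewrite EFinM; apply: integrableZl => //.
  exact: integrable_indic_lty.
have fcvg x : f_ ^~ x @ \oo --> 0.
  have [Ax|nAx] := pselect (A x); last first.
    rewrite (_ : f_ ^~ x = cst 0); first exact: cvg_cst.
    apply/funext => m; apply: integral0_eq => y _.
    by rewrite indicE memNset// mul0r.
  have /nbhs_ballP[r /= r0 xrA] : nbhs x A by exact: open_nbhs_nbhs.
  have key (y : V) : ~ A y -> ~ ball (0%R : V) r (y - x)%R.
    apply: contra_not => yr; apply: xrA; move: yr.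
    by rewrite -!ball_normE /ball_/= sub0r opprB.
  apply/ge0_cvg0P => // d d0; have := poisson_tail r0 d0; apply: filterS => m.
  apply: le_trans.
  have mG : measurable_fun setT (fun z : V => (\1_(~` ball (0%R : V) r) z * poisson_rV (epsn m) z)%:E).
    apply/measurable_EFinP; apply: measurable_funM; last by apply: measurable_poisson_rV; exact: epsn_gt0.
    by apply: mi; apply: measurableC; exact: measurable_ball_rV.
  have G0 (z : V) : 0 <= (\1_(~` ball (0%R : V) r) z * poisson_rV (epsn m) z)%:E.
    by rewrite lee_fin mulr_ge0 ?poisson_rV_ge0// epsn_gt0.
  rewrite -(ge0_integral_rV_sub x mG G0).
  apply: ge0_le_integral => //.
  - by move=> y _; rewrite lee_fin !mulr_ge0// poisson_rV_ge0// epsn_gt0.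
  - apply/measurable_EFinP; apply: measurable_funM => //.
    by apply: measurable_funM; [exact: mi|exact: mk].
  - have := measurableT_comp mG (@measurable_rV_affine R n 1 (- x)).
    by apply: eq_measurable_fun => y _ /=; rewrite scale1r.
  - move=> y _; rewrite lee_fin -(poisson_rVN _ (y - x)) opprB mulrA ler_wpM2r ?poisson_rV_ge0 ?epsn_gt0//.
    rewrite indicE (mem_set Ax) mul1r !indicE.
    have [yA|//] := boolP (y \in ~` A); rewrite mem_set//; apply: key.
    exact: (set_mem yA).
have /ge0_cvg0P H := ge0_dominated_cvg0 mf f0 fcvg gi fg.
move=> d d0.
have d2 : (0 < d / 2)%R by rewrite divr_gt0.
have := H (fun m => integral_ge0 _ (fun x _ => f0 m x)) _ d2; apply: filterS => m Hm.
rewrite (poissonE_indic (epsn_gt0 m) mA).1 (_ : d%:E = 2%:E * (d / 2)%:E).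
  by rewrite lee_pmul2l.
by rewrite -EFinM; congr EFin; field.
Qed.

Lemma indic_approx (B : set V) (B_ : nat -> set V) : measurable B -> L B < +oo ->
  (forall k, measurable (B_ k)) -> (forall k, B_ k `<=` B) ->
  (forall x, B x -> \forall k \near \oo, B_ k x) ->
  (fun k => \int[L]_x ((\1_B x - \1_(B_ k) x : R) ^+ 2)%:E) @ \oo --> 0.
Proof.
move=> mB Boo mB_ sB cB.
pose f_ k (x : V) : \bar R := ((\1_B x - \1_(B_ k) x : R) ^+ 2)%:E.
have mf k : measurable_fun setT (f_ k).
  by apply/measurable_EFinP/measurable_funX; apply: measurable_funB; exact: measurable_indic.
have fc x : f_ ^~ x @ \oo --> 0.
  apply: cvg_near_cst; have [Bx|nBx] := pselect (B x).
    have := cB _ Bx; apply: filterS => k Bkx.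
    by rewrite /f_ !indicE (mem_set Bx) (mem_set Bkx) subrr expr0n.
  apply: nearW => k; rewrite /f_ !indicE memNset// memNset; last by move/sB.
  by rewrite subrr expr0n.
have fB k x : f_ k x <= (\1_B x)%:E.
  rewrite lee_fin !indicE.
  have [/set_mem/sB/mem_set -> /=|/= _] := boolP (x \in B_ k).
    by rewrite subrr expr0n.
  by rewrite subr0; case: (_ \in _); rewrite ?expr1n ?expr0n.
apply: (ge0_dominated_cvg0 mf _ fc (integrable_indic_lty mB Boo)) => //.
by move=> k x; rewrite lee_fin sqr_ge0.
Qed.

(* Intersecting with an open set of finite measure makes the Dynkin argument
   work although complements have infinite measure. *)
Lemma poisson_null_setI (D A : set V) : open D -> L D < +oo -> measurable A ->
  poisson_null (\1_(A `&` D) : V -> R).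
Proof.
move=> oD Doo mA; have mD := open_measurable_rV oD.
have mi B : measurable B -> measurable_fun setT (\1_B : V -> R) by exact: measurable_indic.
apply: (dynkin_induction (G := @open V) (P := fun A => poisson_null (\1_(A `&` D) : V -> R))).
- exact: measurable_rV_openE.
- by move=> B C oB oC; exact: openI.
- by rewrite setTI; exact: poisson_null_open.
- move=> B oB; apply: poisson_null_open; first exact: openI.
  by apply: le_lt_trans Doo; apply: le_measure; rewrite ?inE//; apply: measurableI => //; exact: open_measurable_rV.
- move=> B mB nB.
  apply: (@eq_poisson_null (fun x => \1_D x + (-1) * \1_(B `&` D) x)%R).
    move=> x; rewrite !indicE !in_setI in_setC.
    by case: (x \in B); case: (x \in D) => /=; ring.
  apply: poisson_nullD; first exact: mi.
  + by apply: measurable_funM => //; apply: mi; exact: measurableI.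
  + exact: poisson_null_open.
  + by apply: poisson_nullZ => //; apply: mi; exact: measurableI.
(* Finite disjoint unions are null by additivity of indicators. They converge in L^2 to the full
   union, because everything stays inside [D], of finite measure. *)
- move=> F mF tF nF.
  pose B_ k := \big[setU/set0]_(i < k) F i `&` D.
  have mB_ k : measurable (\big[setU/set0]_(i < k) F i) by exact: bigsetU_measurable.
  have nB_ k : poisson_null (\1_(B_ k) : V -> R).
    elim: k => [|k IHk].
      rewrite /B_ big_ord0 set0I; apply: poisson_null_open; first exact: open0.
      by rewrite measure0.
    apply: (@eq_poisson_null (fun x => \1_(B_ k) x + \1_(F k `&` D) x)%R).
      move=> x; rewrite /B_ big_ord_recr/= !indicE !in_setI in_setU.
      have [xF|//] := boolP (x \in F k); last by rewrite orbF andFb addr0.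
      rewrite orbT [x \in \big[setU/set0]_(i < k) F i](_ : _ = false) ?add0r//.
      apply/negbTE/negP => /set_mem; rewrite -bigcup_mkord => -[i /= ik Fix].
      have := tF i k I I (ex_intro _ x (conj Fix (set_mem xF))).
      by move=> E; rewrite E ltnn in ik.
    apply: poisson_nullD => //; apply: mi; exact: measurableI.
  apply: poisson_null_approx.
    by apply: mi; apply: measurableI => //; exact: bigcup_measurable.
  move=> d d0.
  have mUD : measurable (\bigcup_k F k `&` D) by apply: measurableI => //; exact: bigcup_measurable.
  have : (fun k => \int[L]_x ((\1_(\bigcup_k F k `&` D) x - \1_(B_ k) x : R) ^+ 2)%:E) @ \oo --> 0.
    apply: indic_approx => //.
    + by apply: le_lt_trans Doo; apply: le_measure; rewrite ?inE.
    + by move=> k; exact: measurableI.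
    + move=> k x [+ Dx]; rewrite -bigcup_mkord => -[i _ Fix]; split => //.
      by exists i.
    + move=> x [[i _ Fix] Dx]; exists i.+1 => // k /= ik; split => //.
      by rewrite -bigcup_mkord; exists i.
  move/ge0_cvg0P => /(_ _ _ d0)[].
    by move=> k; apply: integral_ge0 => x _; rewrite lee_fin sqr_ge0.
  move=> N _ /(_ N (leqnn N)) HN.
  exists (\1_(B_ N)); split => //.
  by apply: mi; exact: measurableI.
- by rewrite -measurable_rV_openE.
Qed.

(** Intersections with growing open balls, which have finite measure, converge to [A] in L^2. *)
Lemma poisson_null_indic (A : set V) : measurable A -> L A < +oo ->
  poisson_null (\1_A : V -> R).
Proof.
move=> mA Aoo; apply: poisson_null_approx; first exact: measurable_indic.
move=> d d0.
have k0 k : (0 < k.+1%:R :> R)%R by [].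
have : (fun k => \int[L]_x ((\1_A x - \1_(A `&` ball (0%R : V) k.+1%:R) x : R) ^+ 2)%:E) @ \oo --> 0.
  apply: indic_approx => //.
  - by move=> k; apply: measurableI => //; exact: measurable_ball_rV.
  - move=> x Ax; have := nbhs_infty_gtr (`|x|); apply: filterS => k xk; split => //.
    rewrite -ball_normE /ball_/= sub0r normrN (lt_trans xk)// ltr_nat//.
move/ge0_cvg0P => /(_ _ _ d0)[].
  by move=> k; apply: integral_ge0 => x _; rewrite lee_fin sqr_ge0.
move=> N _ /(_ N (leqnn N)) HN.
have mB := measurable_ball_rV (0%R : V) (k0 N).
exists (\1_(A `&` ball (0%R : V) N.+1%:R)); split => //.
  by apply: measurable_indic; exact: measurableI.
apply: poisson_null_setI => //; first exact: ball_open.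
apply: (@bounded_lebesgue_rV_lty _ _ N.+1%:R) => // x i [_ /(_ ord0 i)].
by rewrite -ball_normE /ball_/= mxE sub0r normrN => /ltW.
Qed.

Lemma poisson_null0 : poisson_null (fun _ : V => 0%R).
Proof.
move=> d d0; apply: nearW => m; rewrite /poissonE integral0_eq ?lee_fin ?ltW//.
by move=> z _; rewrite subrr expr0n mul0r.
Qed.

Lemma poisson_null_sum (I : Type) (s : seq I) (f : I -> V -> R) :
  (forall i, measurable_fun setT (f i)) -> (forall i, poisson_null (f i)) ->
  poisson_null (fun x => \sum_(i <- s) f i x)%R.
Proof.
move=> mf nf; elim: s => [|i s IHs].
  by apply: eq_poisson_null poisson_null0 => x; rewrite big_nil.
apply: (@eq_poisson_null (fun x => f i x + \sum_(i <- s) f i x)%R).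
  by move=> x; rewrite big_cons.
by apply: poisson_nullD => //; exact: measurable_sum.
Qed.

Import HBNNSimple.

(** A square-integrable simple function takes each nonzero value on a set of finite measure, by
    Chebyshev's inequality, so the indicator case applies term by term. *)
Lemma poisson_null_nnsfun (f : {nnsfun V >-> R}) :
  \int[L]_x (f x ^+ 2)%:E < +oo -> poisson_null f.
Proof.
move=> f2.
have -> : (f : V -> R) = (fun x : V => \sum_(r <- finmap.enum_fset (fset_set (range f))) (r * \1_(f @^-1` [set r]) x))%R.
  by apply/funext => x; rewrite [LHS]fimfunE fsbig_finite.
apply: poisson_null_sum => r.
  by apply: measurable_funM => //; exact: measurable_indic.
have [->|r0] := eqVneq r 0%R.
  by apply: eq_poisson_null poisson_null0 => x; rewrite mul0r.
apply: poisson_nullZ; first exact: measurable_indic.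
apply: poisson_null_indic => //.
have r2 : (0 < r ^+ 2)%R by rewrite exprn_even_gt0.
have : (r ^+ 2)%:E * L (f @^-1` [set r]) <= \int[L]_x (f x ^+ 2)%:E.
  rewrite -[X in L X]setIT -integral_indic// -ge0_integralZl_EFin//; last 2 first.
  - by apply/measurable_EFinP; exact: measurable_indic.
  - exact: ltW.
  apply: ge0_le_integral => //.
  - by move=> x _; rewrite -EFinM lee_fin mulr_ge0// ltW.
  - by apply/measurable_EFinP; apply: measurable_funM => //; exact: measurable_indic.
  - by apply/measurable_EFinP; apply: measurable_funX.
  - move=> x _; rewrite -EFinM lee_fin indicE.
    have [/set_mem/= ->|_] := boolP (x \in _); first by rewrite mulr1.
    by rewrite mulr0 sqr_ge0.
move=> /le_lt_trans/(_ f2); case: (L _) => [s| |] //; rewrite ?ltry//.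
by rewrite mulry gtr0_sg// mul1e.
Qed.

(** Simple functions increasing to [a] satisfy [(a - g)^2 <= a^2], hence converge to it in L^2. *)
Lemma poisson_null_ge0 a : measurable_fun setT a -> (forall x, 0 <= a x)%R ->
  \int[L]_x (a x ^+ 2)%:E < +oo -> poisson_null a.
Proof.
move=> ma a0 a2; have mEa : measurable_fun setT (EFin \o a) by exact/measurable_EFinP.
pose g := nnsfun_approx measurableT mEa.
have ga k x : (g k x <= a x)%R.
  rewrite /g nnsfun_approxE -lee_fin.
  by apply: (@le_approx _ _ _ setT (EFin \o a)) => // y _; rewrite lee_fin.
have gc x : (fun k => g k x) @ \oo --> a x.
  have : EFin \o g ^~ x @ \oo --> (EFin \o a) x.
    by apply: cvg_nnsfun_approx => // y _; rewrite lee_fin.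
  by move/fine_cvg.
have ai : L.-integrable setT (fun x => (a x ^+ 2)%:E).
  apply/integrableP; split; first by apply/measurable_EFinP; exact: measurable_funX.
  rewrite (eq_integral (fun x => (a x ^+ 2)%:E))//.
  by move=> x _; rewrite gee0_abs// lee_fin sqr_ge0.
have : (fun k => \int[L]_x ((a x - g k x) ^+ 2)%:E) @ \oo --> 0.
  apply: (ge0_dominated_cvg0 _ _ _ ai).
  - move=> k; apply/measurable_EFinP; apply: measurable_funX; exact: measurable_funB.
  - by move=> k x; rewrite lee_fin sqr_ge0.
  - move=> x; rewrite [X in _ --> X](_ : _ = ((a x - a x) ^+ 2)%:E); last by rewrite subrr expr0n.
    apply: cvg_EFin; first exact: nearW.
    apply: (@cvg_comp _ _ _ (fun k => a x - g k x)%R (fun t => t ^+ 2)%R _ (nbhs (a x - a x)%R)).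
      by apply: cvgB => //; exact: cvg_cst.
    exact: exprn_continuous.
  - move=> k x; rewrite lee_fin ler_sqr ?nnegrE ?subr_ge0 ?ga// gerBl.
    exact: fun_ge0.
move=> /ge0_cvg0P H; apply: poisson_null_approx => // d d0.
have I0 k : 0 <= \int[L]_x ((a x - g k x) ^+ 2)%:E.
  by apply: integral_ge0 => x _; rewrite lee_fin sqr_ge0.
have [N _ /(_ N (leqnn N)) HN] := H I0 _ d0.
exists (g N); split => //; apply: poisson_null_nnsfun.
apply: le_lt_trans a2; apply: ge0_le_integral => //.
- by move=> x _; rewrite lee_fin sqr_ge0.
- by apply/measurable_EFinP; apply: measurable_funX.
- by apply/measurable_EFinP; apply: measurable_funX.
- by move=> x _; rewrite lee_fin ler_sqr ?nnegrE ?ga//; exact: fun_ge0.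
Qed.

Lemma poisson_null_L2 a : measurable_fun setT a ->
  \int[L]_x (a x ^+ 2)%:E < +oo -> poisson_null a.
Proof.
move=> ma a2.
(* The sign [s] is 1 or -1: positive and negative parts are treated at once. *)
have H (s : R) : (s ^+ 2 = 1)%R -> poisson_null (fun x => Num.max (s * a x) 0)%R.
  move=> s1; apply: poisson_null_ge0.
  - by apply: measurable_maxr => //; exact: measurable_funM.
  - by move=> x; rewrite le_max lexx orbT.
  - apply: le_lt_trans a2; apply: ge0_le_integral => //.
    + by move=> x _; rewrite lee_fin sqr_ge0.
    + by apply/measurable_EFinP; apply: measurable_funX; apply: measurable_maxr => //; exact: measurable_funM.
    + by apply/measurable_EFinP; apply: measurable_funX.
    + move=> x _; rewrite lee_fin maxEle; case: ifPn => _; first by rewrite expr0n sqr_ge0.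
      by rewrite exprMn s1 mul1r.
apply: (@eq_poisson_null (fun x => Num.max (1 * a x) 0 + (-1) * Num.max ((-1) * a x) 0)%R).
  move=> x; rewrite mul1r !mulN1r; have [h|h] := leP 0%R (a x).
    by rewrite max_r ?oppr_le0// subr0.
  by rewrite max_l ?oppr_ge0 ?ltW// add0r opprK.
apply: poisson_nullD.
- by apply: measurable_maxr => //; exact: measurable_funM.
- by apply: measurable_funM => //; apply: measurable_maxr => //; exact: measurable_funM.
- by apply: H; rewrite expr1n.
- apply: poisson_nullZ; last by apply: H; rewrite sqrrN expr1n.
  by apply: measurable_maxr => //; exact: measurable_funM.
Qed.

Lemma expabs_rVE e (x : V) : expabs_rV e x = expR (- (e * \sum_i `|x ord0 i|))%R.
Proof.
rewrite mulr_sumr -sumrN /expabs_rV /expabs.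
by elim/big_rec2: _ => [|i y1 y2 _ ->]; rewrite ?expR0// expRD.
Qed.

(** In one direction the damped integrals increase to the full one and stay below the right-hand
    side, the defect being nonnegative. In the other the damping is at most 1 and the defect tends
    to 0. *)
Lemma plancherel_real a : L.-integrable setT (EFin \o a) ->
  \int[L]_x (a x ^+ 2)%:E < +oo ->
  \int[L]_xi (cosF a xi ^+ 2 + sinF a xi ^+ 2)%:E =
  ((2 * pi) ^+ n)%:E * \int[L]_x (a x ^+ 2)%:E.
Proof.
move=> ai a2; have /integrableP[/measurable_EFinP ma _] := ai.
set T := _ * _; pose G (xi : V) := (cosF a xi ^+ 2 + sinF a xi ^+ 2)%R.
have mG : measurable_fun setT G.
  by apply: measurable_funD; apply: measurable_funX; [exact: measurable_cosF|exact: measurable_sinF].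
have G0 xi : (0 <= G xi)%R by rewrite addr_ge0// sqr_ge0.
pose J m := \int[L]_xi (expabs_rV (epsn m) xi * G xi)%:E.
have JE m : J m + 2^-1%:E * poissonE (epsn m) a = T.
  exact: (poisson_identity (epsn_gt0 m) ai a2).
have S0 (xi : V) : (0 <= \sum_i `|xi ord0 i|)%R by apply: sumr_ge0.
have K1 m (xi : V) : (expabs_rV (epsn m) xi <= 1)%R.
  by rewrite expabs_rVE -expR0 ler_expR oppr_le0 mulr_ge0// ltW// epsn_gt0.
have mJ m : measurable_fun setT (fun xi => (expabs_rV (epsn m) xi * G xi)%:E).
  by apply/measurable_EFinP; apply: measurable_funM => //; exact: measurable_expabs_rV.
have J0 m xi : 0 <= (expabs_rV (epsn m) xi * G xi)%:E.
  by rewrite lee_fin mulr_ge0// expabs_rV_ge0.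
have mEG : measurable_fun setT (EFin \o G) by exact/measurable_EFinP.
apply/eqP; rewrite eq_le; apply/andP; split.
- have Kc (xi : V) : (fun m => (expabs_rV (epsn m) xi * G xi)%:E) @ \oo --> (G xi)%:E.
    apply: cvg_EFin; first exact: nearW.
    rewrite -[X in _ --> X]mul1r; apply: cvgM; last exact: cvg_cst.
    under eq_fun do rewrite expabs_rVE.
    set S := (\sum_i _)%R.
    have ec : (fun m => - (epsn m * S))%R @ \oo --> (0 : R)%R.
      rewrite -[X in _ --> X]oppr0 -[X in _ --> (- X)%R](mul0r S).
      by apply: cvgN; apply: cvgM; [exact: (@cvg_harmonic R)|exact: cvg_cst].
    have H := cvg_comp _ _ ec (@continuous_expR R 0%R).
    by rewrite expR0 in H; exact: H.
  have Jc : J @ \oo --> \int[L]_xi (G xi)%:E.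
    have := @cvg_monotone_convergence _ _ _ L setT measurableT
      (fun m xi => (expabs_rV (epsn m) xi * G xi)%:E) mJ (fun m xi _ => J0 m xi).
    rewrite (eq_integral (fun xi => (G xi)%:E)); last by move=> xi _; exact/cvg_lim.
    apply=> xi _ k m km; rewrite lee_fin ler_wpM2r// !expabs_rVE ler_expR lerN2.
    by rewrite ler_wpM2r// lef_pV2 ?posrE// ler_nat ltnS.
  rewrite -(cvg_lim _ Jc)//; apply: lime_le; first by apply/cvg_ex; eexists; exact: Jc.
  apply: nearW => m.
  by rewrite -(JE m) leeDl// mule_ge0 ?lee_fin ?invr_ge0// poissonE_ge0// epsn_gt0.
- apply/lee_addgt0Pr => d d0.
  have [N _ /(_ N (leqnn N)) HN] := poisson_null_L2 ma a2 d0.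
  rewrite -(JE N); apply: leeD.
    apply: ge0_le_integral => //.
    by move=> xi _; rewrite lee_fin ler_piMl.
  apply: le_trans HN; rewrite -[leRHS]mul1e lee_wpmul2r ?lee_fin ?invf_le1 ?ler1n//.
  by apply: poissonE_ge0; exact: epsn_gt0.
Qed.

End plancherel_density.

(** * Complex-valued functions and weighted forms *)

Section complex_basics.
Context {R : realType}.
Local Open Scope complex_scope.
Implicit Types x y z : R[i].

Definition sqc z : R := complex.Re z ^+ 2 + complex.Im z ^+ 2.

Lemma cplx_eq x y : complex.Re x = complex.Re y -> complex.Im x = complex.Im y -> x = y.
Proof. by case: x y => [a b] [c d] /= -> ->. Qed.

Lemma ReM x y : complex.Re (x * y) = complex.Re x * complex.Re y - complex.Im x * complex.Im y.
Proof. by case: x y => [a b] [c d]. Qed.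

Lemma ImM x y : complex.Im (x * y) = complex.Re x * complex.Im y + complex.Im x * complex.Re y.
Proof. by case: x y => [a b] [c d]. Qed.

Lemma ReD x y : complex.Re (x + y) = complex.Re x + complex.Re y.
Proof. by case: x y => [a b] [c d]. Qed.

Lemma ImD x y : complex.Im (x + y) = complex.Im x + complex.Im y.
Proof. by case: x y => [a b] [c d]. Qed.

Lemma ReN x : complex.Re (- x) = - complex.Re x. Proof. by case: x. Qed.
Lemma ImN x : complex.Im (- x) = - complex.Im x. Proof. by case: x. Qed.
Lemma Re_conj x : complex.Re (x^*) = complex.Re x. Proof. by case: x. Qed.
Lemma Im_conj x : complex.Im (x^*) = - complex.Im x. Proof. by case: x. Qed.

Definition ReImE := (ReM, ImM, ReD, ImD, ReN, ImN, Re_conj, Im_conj).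

Lemma sqc_ge0 z : 0 <= sqc z. Proof. by rewrite addr_ge0// sqr_ge0. Qed.

Lemma normc_sqr z : Normc.normc z ^+ 2 = sqc z.
Proof. by case: z => a b; rewrite /Normc.normc sqr_sqrtr// addr_ge0// sqr_ge0. Qed.

Lemma sqcM x y : sqc (x * y) = sqc x * sqc y.
Proof. rewrite /sqc !ReImE; ring. Qed.

Lemma sqc_conj x : sqc (x^*) = sqc x.
Proof. by rewrite /sqc !ReImE sqrrN. Qed.

Lemma sqcN x : sqc (- x) = sqc x.
Proof. by rewrite /sqc !ReImE !sqrrN. Qed.

Lemma sqcD_le x y : sqc (x + y) <= 2 * sqc x + 2 * sqc y.
Proof.
rewrite /sqc !ReImE.
have := sqr_ge0 (complex.Re x - complex.Re y).
have := sqr_ge0 (complex.Im x - complex.Im y); nra.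
Qed.

Lemma sqcB_le x y : sqc (x - y) <= 2 * sqc x + 2 * sqc y.
Proof. by rewrite (le_trans (sqcD_le _ _))// sqcN. Qed.

Lemma mulc_conj x : x * x^* = (sqc x)%:C.
Proof. by apply: cplx_eq; rewrite !ReImE /= /sqc; ring. Qed.

Lemma sqc_expi (t : R) : sqc (expi t) = 1.
Proof. by rewrite /sqc /= cos2Dsin2. Qed.

Lemma sqc_real (a : R) : sqc a%:C = a ^+ 2.
Proof. by rewrite /sqc /= expr0n addr0. Qed.
End complex_basics.

Section complex_integral.
Context {R : realType} {n : nat}.
Local Open Scope complex_scope.
Local Notation V := 'rV[R]_n.
Local Notation L := (lebesgue_rV R n).
Implicit Types (f g : V -> R[i]) (w : V -> R).

Definition cintegrable f :=
  L.-integrable setT (fun x => (complex.Re (f x))%:E) /\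
  L.-integrable setT (fun x => (complex.Im (f x))%:E).

(** The real and imaginary parts of [f - c * g] both have this three-term shape. *)
Lemma Rintegral_lin (p q r : V -> R) (s t : R) :
  L.-integrable setT (EFin \o p) -> L.-integrable setT (EFin \o q) ->
  L.-integrable setT (EFin \o r) ->
  L.-integrable setT (fun x => (p x + (s * q x + t * r x))%:E) /\
  \int[L]_x (p x + (s * q x + t * r x)) =
  \int[L]_x p x + (s * \int[L]_x q x + t * \int[L]_x r x).
Proof.
move=> pi qi ri.
have si : L.-integrable setT (EFin \o (fun x => s * q x)) by exact: (integrableZl measurableT s qi).
have ti : L.-integrable setT (EFin \o (fun x => t * r x)) by exact: (integrableZl measurableT t ri).
have sti : L.-integrable setT (EFin \o (fun x => s * q x + t * r x)).
  exact: (integrableD measurableT si ti).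
split; first exact: (integrableD measurableT pi sti).
by rewrite RintegralD// RintegralD// !RintegralZl.
Qed.

Lemma cintegralBZ f g (c : R[i]) : cintegrable f -> cintegrable g ->
  cintegral setT (fun x => f x - c * g x) = cintegral setT f - c * cintegral setT g.
Proof.
move=> [fr fi] [gr gi].
have [_ H1] := Rintegral_lin (- complex.Re c) (complex.Im c) fr gr gi.
have [_ H2] := Rintegral_lin (- complex.Re c) (- complex.Im c) fi gi gr.
apply: cplx_eq; rewrite !ReImE /cintegral /=.
  transitivity (\int[L]_x (complex.Re (f x) + (- complex.Re c * complex.Re (g x) + complex.Im c * complex.Im (g x)))).
    by apply: eq_Rintegral => x _; rewrite !ReImE; ring.
  by rewrite H1; ring.
transitivity (\int[L]_x (complex.Im (f x) + (- complex.Re c * complex.Im (g x) + - complex.Im c * complex.Re (g x)))).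
  by apply: eq_Rintegral => x _; rewrite !ReImE; ring.
by rewrite H2; ring.
Qed.

Lemma eq_cintegral f g : f =1 g -> cintegral setT f = cintegral setT g.
Proof. by move=> /funext ->. Qed.

Lemma cintegral_conj f : cintegrable f ->
  cintegral setT (fun x => (f x)^*) = (cintegral setT f)^*.
Proof.
move=> [_ fi]; apply: cplx_eq; rewrite !ReImE /cintegral /=.
  by apply: eq_Rintegral => x _; rewrite !ReImE.
rewrite -mulN1r -RintegralZl//; apply: eq_Rintegral => x _; rewrite !ReImE; ring.
Qed.

Lemma cmeasurableM f g : cmeasurable f -> cmeasurable g -> cmeasurable (fun x => f x * g x).
Proof.
move=> [fr fi] [gr gi]; split.
  by apply: (eq_measurable_fun _ (fun x _ => esym (ReM (f x) (g x)))); apply: measurable_funB; apply: measurable_funM.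
by apply: (eq_measurable_fun _ (fun x _ => esym (ImM (f x) (g x)))); apply: measurable_funD; apply: measurable_funM.
Qed.

Lemma cmeasurable_conj f : cmeasurable f -> cmeasurable (fun x => (f x)^*).
Proof.
move=> [fr fi]; split.
  by apply: eq_measurable_fun fr => x _; rewrite !ReImE.
by apply: (eq_measurable_fun _ (fun x _ => esym (Im_conj (f x)))); exact: measurable_funN.
Qed.

Lemma cmeasurable_cst (c : R[i]) : cmeasurable (fun _ : V => c).
Proof. by split; exact: measurable_cst. Qed.

Lemma cmeasurable_real w : measurable_fun setT w -> cmeasurable (fun x => (w x)%:C).
Proof. by move=> mw; split => //=; exact: measurable_cst. Qed.

Lemma cmeasurableBZ f g (c : R[i]) : cmeasurable f -> cmeasurable g ->
  cmeasurable (fun x => f x - c * g x).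
Proof.
move=> mf mg; have [mcr mci] := cmeasurableM (cmeasurable_cst c) mg; case: mf => fr fi; split.
  apply: (@eq_measurable_fun _ _ _ _ _ (fun x => complex.Re (f x) - complex.Re (c * g x))).
    by move=> x _; rewrite ReD ReN.
  exact: measurable_funB.
apply: (@eq_measurable_fun _ _ _ _ _ (fun x => complex.Im (f x) - complex.Im (c * g x))).
  by move=> x _; rewrite ImD ImN.
exact: measurable_funB.
Qed.

Lemma measurable_sqc f : cmeasurable f -> measurable_fun setT (fun x => sqc (f x)).
Proof. by move=> [fr fi]; apply: measurable_funD; exact: measurable_funX. Qed.

Lemma sqnorm2E f : sqnorm2 f = (\int[L]_x (sqc (f x))%:E)%E.
Proof. by apply: eq_integral => x _; rewrite normc_sqr. Qed.

Section weighted_form.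
Variable w : V -> R.
Hypothesis mw : measurable_fun setT w.

(** The absolute value is there because the weight may change sign. Two weights occur: 1, for the
    inner product of L^2, and [ln |xi|], for the logarithmic form on Fourier transforms. *)
Definition wL2 f := cmeasurable f /\ (\int[L]_x (`|w x| * sqc (f x))%:E < +oo)%E.

Definition wform f g : R[i] := cintegral setT (fun x => (w x)%:C * (f x * (g x)^*)).

Lemma wL2_integrable f : wL2 f -> L.-integrable setT (fun x => (`|w x| * sqc (f x))%:E).
Proof.
move=> [mf foo]; apply/integrableP; split.
  apply/measurable_EFinP; apply: measurable_funM; last exact: measurable_sqc.
  exact: measurableT_comp.
apply: le_lt_trans foo; rewrite le_eqVlt; apply/orP; left; apply/eqP.
apply: eq_integral => x _.
by rewrite gee0_abs// lee_fin mulr_ge0// sqc_ge0.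
Qed.

Lemma wL2_cintegrable f g : wL2 f -> wL2 g ->
  cintegrable (fun x => (w x)%:C * (f x * (g x)^*)).
Proof.
move=> wf wg.
have [mr mi] := cmeasurableM (cmeasurable_real mw) (cmeasurableM wf.1 (cmeasurable_conj wg.1)).
have I := integrableD measurableT (wL2_integrable wf) (wL2_integrable wg).
split; apply: (le_integrable _ _ _ I) => //=; try exact/measurable_EFinP.
- move=> x _; rewrite lee_fin [leRHS]ger0_norm ?addr_ge0 ?mulr_ge0 ?sqc_ge0//.
  rewrite ReM /= mul0r subr0 normrM -mulrDr ler_wpM2l// !ReImE ler_norml /sqc.
  set a := complex.Re _; set b := complex.Im _; set c := complex.Re _; set d := complex.Im _.
  have := sqr_ge0 (a - c); have := sqr_ge0 (a + c).
  have := sqr_ge0 (b - d); have := sqr_ge0 (b + d) => *; apply/andP; split; nra.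
- move=> x _; rewrite lee_fin [leRHS]ger0_norm ?addr_ge0 ?mulr_ge0 ?sqc_ge0//.
  rewrite ImM /= mul0r addr0 normrM -mulrDr ler_wpM2l// !ReImE ler_norml /sqc.
  set a := complex.Re _; set b := complex.Im _; set c := complex.Re _; set d := complex.Im _.
  have := sqr_ge0 (a - d); have := sqr_ge0 (a + d).
  have := sqr_ge0 (b - c); have := sqr_ge0 (b + c) => *; apply/andP; split; nra.
Qed.

Lemma wL2BZ f g (c : R[i]) : wL2 f -> wL2 g -> wL2 (fun x => f x - c * g x).
Proof.
move=> wf wg; have mfg := cmeasurableBZ c wf.1 wg.1; split => //.
have I := integrableD measurableT (integrableZl measurableT 2 (wL2_integrable wf))
  (integrableZl measurableT (2 * sqc c) (wL2_integrable wg)).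
have Ioo := integrable_lty measurableT I; apply: le_lt_trans Ioo.
have mw' : measurable_fun setT (fun x => `|w x|) by exact: measurableT_comp.
apply: ge0_le_integral => //.
- by move=> x _; rewrite lee_fin mulr_ge0// sqc_ge0.
- apply/measurable_EFinP; apply: measurable_funM => //; exact: (measurable_sqc mfg).
- exact: measurable_int I.
- move=> x _; rewrite -!EFinM -EFinD lee_fin.
  have h := sqcB_le (f x) (c * g x); rewrite sqcM in h.
  by apply: le_trans (ler_wpM2l (normr_ge0 (w x)) h) _; rewrite le_eqVlt; apply/orP; left; apply/eqP; ring.
Qed.

Lemma wform_BZl f g h (c : R[i]) : wL2 f -> wL2 g -> wL2 h ->
  wform (fun x => f x - c * g x) h = wform f h - c * wform g h.
Proof.
move=> wf wg wh; rewrite /wform -cintegralBZ; [|exact: wL2_cintegrable..].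
by apply: eq_cintegral => x; ring.
Qed.

Lemma wform_conj f g : wL2 f -> wL2 g -> wform g f = (wform f g)^*.
Proof.
move=> wf wg; rewrite /wform -cintegral_conj; last exact: wL2_cintegrable.
by apply: eq_cintegral => x; apply: cplx_eq; rewrite !ReImE /=; ring.
Qed.

Lemma wform_BZr f g h (c : R[i]) : wL2 f -> wL2 g -> wL2 h ->
  wform h (fun x => f x - c * g x) = wform h f - c^* * wform h g.
Proof.
move=> wf wg wh; rewrite wform_conj//; last exact: wL2BZ.
rewrite wform_BZl// (wform_conj wf wh) (wform_conj wg wh).
by apply: cplx_eq; rewrite !ReImE; ring.
Qed.

Lemma wform_self f : wL2 f ->
  wform f f = (\int[L]_x (w x * sqc (f x)))%:C.
Proof.
move=> wf; rewrite /wform /cintegral; apply: cplx_eq => /=.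
  by apply: eq_Rintegral => x _; rewrite mulc_conj !ReImE /= mul0r subr0.
rewrite (_ : (fun x => _) = cst 0).
  by rewrite Rintegral_cst// mul0r.
by apply/funext => x; rewrite mulc_conj !ReImE /= mulr0 mul0r addr0.
Qed.

(** Removing one component at a time matches the induction in Pythagoras' identity. The same
    residual is measured in L^2 and, after Fourier transform, in the logarithmic form. *)
Fixpoint residual (u : V -> R[i]) (c : nat -> R[i]) (e : nat -> V -> R[i]) N : V -> R[i] :=
  if N is N'.+1 then fun x => residual u c e N' x - c N' * e N' x else u.

Lemma residualE u c e N x : residual u c e N x = u x - \sum_(k < N) c k * e k x.
Proof.
elim: N => [|N IHN]; first by rewrite big_ord0 subr0.
by rewrite /= IHN big_ord_recr/= opprD addrA.
Qed.

Section pythagoras.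
Variables (u : V -> R[i]) (c : nat -> R[i]) (e : nat -> V -> R[i]) (l : nat -> R).
Hypotheses (wu : wL2 u) (we : forall k, wL2 (e k)).
Hypothesis eu : forall k, wform (e k) u = (l k)%:C * (c k)^*.
Hypothesis ee : forall j k, wform (e j) (e k) = (l j)%:C * (j == k)%:R.

Lemma wL2_residual N : wL2 (residual u c e N).
Proof. by elim: N => [//|N IHN] /=; exact: wL2BZ. Qed.

(** A component not yet removed is orthogonal to all removed ones, so its pairing with the residual
    is still its pairing with [u]. *)
Lemma wform_residual j N : (N <= j)%N -> wform (e j) (residual u c e N) = (l j)%:C * (c j)^*.
Proof.
elim: N => [_|N IHN Nj] /=; first exact: eu.
rewrite (wform_BZr _ (wL2_residual N) (we N) (we j)) IHN 1?ltnW// ee gtn_eqF//.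
by rewrite !mulr0 subr0.
Qed.

(* Each step removes the component along [e N], which is orthogonal to what
   remains, so the form decreases by exactly [l N * |c N|^2]. *)
Lemma wform_pythagoras N :
  complex.Re (wform (residual u c e N) (residual u c e N)) =
  complex.Re (wform u u) - \sum_(k < N) l k * sqc (c k).
Proof.
elim: N => [|N IHN]; first by rewrite big_ord0 subr0.
have wN := wL2_residual N.
have rS : residual u c e N.+1 = fun x => residual u c e N x - c N * e N x by [].
rewrite big_ord_recr opprD addrA -IHN rS.
rewrite (wform_BZl _ wN (we N)); last exact: wL2BZ.
rewrite (wform_BZr _ wN (we N) wN) (wform_BZr _ wN (we N) (we N)).
rewrite ee eqxx mulr1 (wform_conj (we N) wN) wform_residual//.
move: (wform _ _) => W; rewrite !ReImE /= /sqc; ring.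
Qed.

End pythagoras.
End weighted_form.
End complex_integral.

(** * Plancherel and Cauchy-Schwarz on sets of finite measure *)

Section fourier_L2.
Context {R : realType} {n : nat}.
Local Open Scope complex_scope.
Local Notation V := 'rV[R]_n.
Local Notation L := (lebesgue_rV R n).
Implicit Types (f g : V -> R[i]).

Lemma ge0_integral_eq_lty (f : V -> \bar R) : measurable_fun setT f -> (forall x, (0 <= f x)%E) ->
  (\int[L]_x f x < +oo)%E -> L.-integrable setT f.
Proof.
move=> mf f0 foo; apply/integrableP; split => //.
by under eq_integral do rewrite gee0_abs//.
Qed.

Lemma cintegrable_expi f xi : cintegrable f -> cintegrable (fun x => expi (- dotp x xi) * f x).
Proof.
move=> [fr fi].
have h1 := integrable_cosF xi fr; have h2 := integrable_sinF xi fr.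
have h3 := integrable_cosF xi fi; have h4 := integrable_sinF xi fi.
split.
  have := integrableD measurableT h1 h4; apply: eq_integrable => // x _.
  by rewrite ReM /= cosN sinN -EFinD; congr EFin; ring.
have := integrableB measurableT h3 h2; apply: eq_integrable => // x _.
by rewrite ImM /= cosN sinN -EFinB; congr EFin; ring.
Qed.

Lemma Re_fourier f xi : cintegrable f -> complex.Re (fourier f xi) =
  cosF (fun x => complex.Re (f x)) xi + sinF (fun x => complex.Im (f x)) xi.
Proof.
move=> [fr fi]; rewrite /cosF /sinF -RintegralD//; last 2 first.
- exact: integrable_cosF.
- exact: integrable_sinF.
by apply: eq_Rintegral => x _; rewrite ReM /= cosN sinN; ring.
Qed.

Lemma Im_fourier f xi : cintegrable f -> complex.Im (fourier f xi) =
  cosF (fun x => complex.Im (f x)) xi - sinF (fun x => complex.Re (f x)) xi.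
Proof.
move=> [fr fi]; rewrite /cosF /sinF -RintegralB//; last 2 first.
- exact: integrable_cosF.
- exact: integrable_sinF.
by apply: eq_Rintegral => x _; rewrite ImM /= cosN sinN; ring.
Qed.

Lemma cmeasurable_fourier f : cintegrable f -> cmeasurable (fourier f).
Proof.
move=> fi; split.
  apply: (eq_measurable_fun _ (fun x _ => esym (Re_fourier x fi))).
  by apply: measurable_funD; [apply: measurable_cosF; exact: fi.1|apply: measurable_sinF; exact: fi.2].
apply: (eq_measurable_fun _ (fun x _ => esym (Im_fourier x fi))).
by apply: measurable_funB; [apply: measurable_cosF; exact: fi.2|apply: measurable_sinF; exact: fi.1].
Qed.

Lemma fourierBZ f g (c : R[i]) xi : cintegrable f -> cintegrable g ->
  fourier (fun x => f x - c * g x) xi = fourier f xi - c * fourier g xi.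
Proof.
move=> fi gi; rewrite /fourier -cintegralBZ; [|exact: cintegrable_expi..].
by apply: eq_cintegral => x; ring.
Qed.

Lemma cosFN (a : V -> R) xi : cosF a (- xi) = cosF a xi.
Proof. by apply: eq_Rintegral => x _; rewrite dotpNr cosN. Qed.

Lemma sinFN (a : V -> R) xi : L.-integrable setT (EFin \o a) -> sinF a (- xi) = - sinF a xi.
Proof.
move=> ai; rewrite /sinF -mulN1r -RintegralZl//; last exact: integrable_sinF.
by apply: eq_Rintegral => x _; rewrite dotpNr sinN; ring.
Qed.

Lemma integral_rV_opp (F : V -> \bar R) : measurable_fun setT F ->
  (\int[L]_x F (- x)%R = \int[L]_x F x)%E.
Proof.
move=> mF; rewrite integralE [RHS]integralE; congr (_ - _)%E.
  transitivity (\int[L]_t (F^\+ (- t)%R))%E; first by apply: eq_integral => t _; rewrite !funeposE.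
  by apply: ge0_integral_rV_opp; [exact: measurable_funepos|].
transitivity (\int[L]_t (F^\- (- t)%R))%E; first by apply: eq_integral => t _; rewrite !funenegE.
by apply: ge0_integral_rV_opp; [exact: measurable_funeneg|].
Qed.

Lemma integral_rV_sub (c : V) (F : V -> \bar R) : measurable_fun setT F ->
  (\int[L]_x F (x - c)%R = \int[L]_x F x)%E.
Proof.
move=> mF; rewrite integralE [RHS]integralE; congr (_ - _)%E.
  transitivity (\int[L]_t (F^\+ (t - c)%R))%E; first by apply: eq_integral => t _; rewrite !funeposE.
  by apply: ge0_integral_rV_sub; [exact: measurable_funepos|].
transitivity (\int[L]_t (F^\- (t - c)%R))%E; first by apply: eq_integral => t _; rewrite !funenegE.
by apply: ge0_integral_rV_sub; [exact: measurable_funeneg|].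
Qed.

Section plancherel.
Local Open Scope ereal_scope.

(* For f = a + i b, |f^|^2 = |a^|^2 + |b^|^2 plus an odd term. *)
Lemma plancherel f : cintegrable f -> cmeasurable f -> sqnorm2 f < +oo ->
  \int[L]_xi (sqc (fourier f xi))%:E = ((2 * pi) ^+ n)%:E * sqnorm2 f.
Proof.
move=> fi [ma mb]; rewrite sqnorm2E => foo.
pose a x := complex.Re (f x); pose b x := complex.Im (f x).
have [ai bi] := fi.
have ma2 : measurable_fun setT (fun x => (a x ^+ 2)%:E).
  by apply/measurable_EFinP; exact: measurable_funX.
have mb2 : measurable_fun setT (fun x => (b x ^+ 2)%:E).
  by apply/measurable_EFinP; exact: measurable_funX.
have p2 (p : V -> R) x : 0 <= (p x ^+ 2)%:E by rewrite lee_fin sqr_ge0.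
have ab : \int[L]_x (sqc (f x))%:E = \int[L]_x (a x ^+ 2)%:E + \int[L]_x (b x ^+ 2)%:E.
  by rewrite -ge0_integralD//.
have ab0 (p : V -> R) : 0 <= \int[L]_x (p x ^+ 2)%:E by apply: integral_ge0 => x _; exact: p2.
have aoo : \int[L]_x (a x ^+ 2)%:E < +oo.
  by apply: le_lt_trans foo; rewrite ab leeDl.
have boo : \int[L]_x (b x ^+ 2)%:E < +oo.
  by apply: le_lt_trans foo; rewrite ab leeDr.
have Pa := plancherel_real ai aoo; have Pb := plancherel_real bi boo.
have mca := measurable_cosF ai; have msa := measurable_sinF ai.
have mcb := measurable_cosF bi; have msb := measurable_sinF bi.
pose A xi := (cosF a xi ^+ 2 + sinF a xi ^+ 2)%R.
pose B xi := (cosF b xi ^+ 2 + sinF b xi ^+ 2)%R.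
pose T xi := (2 * (cosF a xi * sinF b xi - cosF b xi * sinF a xi))%R.
have mA : measurable_fun setT A by apply: measurable_funD; exact: measurable_funX.
have mB : measurable_fun setT B by apply: measurable_funD; exact: measurable_funX.
have mT : measurable_fun setT T.
  by apply: measurable_funM => //; apply: measurable_funB; exact: measurable_funM.
have A0 xi : (0 <= A xi)%R by rewrite addr_ge0// sqr_ge0.
have B0 xi : (0 <= B xi)%R by rewrite addr_ge0// sqr_ge0.
have C0 : (0 <= (2 * pi) ^+ n :> R)%R by rewrite exprn_ge0// mulr_ge0// pi_ge0.
have Ai : L.-integrable setT (fun xi => (A xi)%:E).
  apply: ge0_integral_eq_lty; [exact/measurable_EFinP|by move=> xi; rewrite lee_fin|].
  by rewrite Pa lte_mul_pinfty.
have Bi : L.-integrable setT (fun xi => (B xi)%:E).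
  apply: ge0_integral_eq_lty; [exact/measurable_EFinP|by move=> xi; rewrite lee_fin|].
  by rewrite Pb lte_mul_pinfty.
have ABi := integrableD measurableT Ai Bi.
(* The cross term has to be integrable before its oddness can be used to cancel it. *)
have TAB xi : (`|T xi| <= A xi + B xi)%R.
  rewrite ler_norml /T /A /B.
  set p := cosF a xi; set q := sinF a xi; set r := cosF b xi; set s := sinF b xi.
  have := sqr_ge0 (p - s)%R; have := sqr_ge0 (p + s)%R.
  have := sqr_ge0 (q - r)%R; have := sqr_ge0 (q + r)%R => *; apply/andP; split; nra.
have Ti : L.-integrable setT (fun xi => (T xi)%:E).
  apply: (le_integrable _ _ _ ABi) => //; first exact/measurable_EFinP.
  move=> xi _; rewrite -EFinD [leRHS]gee0_abs; last by rewrite lee_fin addr_ge0.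
  by rewrite -[leLHS]/(`|T xi|%R%:E) lee_fin.
have T0 : \int[L]_xi (T xi)%:E = 0.
  have Tfin := integrable_fin_num measurableT Ti.
  have := integral_rV_opp (measurable_int _ Ti).
  under eq_integral => xi _.
    rewrite /T !cosFN !sinFN// (_ : _ * _ = - T xi)%R; last by rewrite /T; ring.
    rewrite EFinN; over.
  rewrite integralN/=; last exact: integrable_add_def.
  rewrite -(fineK Tfin) -EFinN => -[] H; congr EFin.
  by move: H; set t := fine _ => H; lra.
have E xi : sqc (fourier f xi) = (A xi + B xi + T xi)%R.
  by rewrite /sqc Re_fourier// Im_fourier// /A /B /T; ring.
under eq_integral do rewrite E EFinD.
rewrite integralD// T0 adde0.
under eq_integral do rewrite EFinD.
rewrite integralD// ab ge0_muleDr//; congr (_ + _); [exact: Pa|exact: Pb].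
Qed.

End plancherel.

Lemma sqnorm2_ge0 f : (0 <= sqnorm2 f)%E.
Proof. by rewrite sqnorm2E; apply: integral_ge0 => x _; rewrite lee_fin sqc_ge0. Qed.

Section L2_Omega.
Variable Omega : set V.
Hypothesis mO : measurable Omega.
Hypothesis Ooo : (L Omega < +oo)%E.

Let vol : R := fine (L Omega).

Lemma L2_lty f : L2 Omega f -> (\int[L]_x (sqc (f x))%:E < +oo)%E.
Proof. by move=> [_ _]; rewrite sqnorm2E. Qed.

Lemma L2_sqc_integrable f : L2 Omega f -> L.-integrable setT (fun x => (sqc (f x))%:E).
Proof.
move=> Lf; apply: ge0_integral_eq_lty; [|by move=> x; rewrite lee_fin sqc_ge0|exact: L2_lty].
by apply/measurable_EFinP; apply: measurable_sqc; case: Lf.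
Qed.

(** On a set of finite measure L^2 embeds in L^1, through [|p| <= p^2 + 1]. Hence Fourier transforms
    on [L2 Omega] are honest integrals. *)
Lemma L2_cintegrable f : L2 Omega f -> cintegrable f.
Proof.
move=> Lf; have [[ma mb] f0 _] := Lf.
have I := integrableD measurableT (L2_sqc_integrable Lf) (integrable_indic_lty mO Ooo).
have H x (p : R) : p ^+ 2 <= sqc (f x) -> (~ Omega x -> p = 0) -> `|p| <= sqc (f x) + \1_Omega x.
  move=> ps p0; rewrite indicE; have [Ox|nOx] := pselect (Omega x).
    rewrite mem_set//= ler_norml; apply/andP; split.
      by have := sqr_ge0 (p + 1); nra.
    by have := sqr_ge0 (p - 1); nra.
  by rewrite p0// normr0 addr_ge0// sqc_ge0.
have H0 x : 0 <= sqc (f x) + \1_Omega x by rewrite addr_ge0// sqc_ge0.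
split; apply: (le_integrable _ _ _ I) => //=; try exact/measurable_EFinP.
- move=> x _; rewrite lee_fin [leRHS]ger0_norm//; apply: H; first by rewrite /sqc lerDl sqr_ge0.
  by move=> /f0 ->.
- move=> x _; rewrite lee_fin [leRHS]ger0_norm//; apply: H; first by rewrite /sqc lerDr sqr_ge0.
  by move=> /f0 ->.
Qed.

Lemma plancherel_L2 f : L2 Omega f ->
  (\int[L]_xi (sqc (fourier f xi))%:E = ((2 * pi) ^+ n)%:E * sqnorm2 f)%E.
Proof. by move=> Lf; have [mf _ foo] := Lf; apply: plancherel => //; exact: L2_cintegrable. Qed.

Lemma L2_wL2 f : L2 Omega f -> wL2 (cst 1) f.
Proof.
move=> Lf; split; first by case: Lf.
by under eq_integral do rewrite normr1 mul1r; exact: L2_lty.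
Qed.

Lemma innerE f g : L2 Omega f -> inner Omega f g = wform (cst 1) f g.
Proof.
move=> [_ f0 _]; rewrite /inner /wform /cintegral; congr Complex.
  rewrite Rintegral_mkcond; apply: eq_Rintegral => x _; rewrite patchE.
  have [xO|xO] := boolP (x \in Omega); first by rewrite mul1r.
  by rewrite f0 ?mul0r ?mulr0//; move/negP: xO => h Ox; apply: h; exact: mem_set.
rewrite Rintegral_mkcond; apply: eq_Rintegral => x _; rewrite patchE.
have [xO|xO] := boolP (x \in Omega); first by rewrite mul1r.
by rewrite f0 ?mul0r ?mulr0//; move/negP: xO => h Ox; apply: h; exact: mem_set.
Qed.

Lemma wform1_self f : L2 Omega f -> wform (cst 1) f f = (fine (sqnorm2 f))%:C.
Proof.
move=> Lf; rewrite wform_self//; last exact: L2_wL2.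
by rewrite sqnorm2E /Rintegral; under eq_integral do rewrite mul1r.
Qed.

Lemma L2BZ f g (c : R[i]) : L2 Omega f -> L2 Omega g -> L2 Omega (fun x => f x - c * g x).
Proof.
move=> Lf Lg; have [mf f0 _] := Lf; have [mg g0 _] := Lg.
have [m w] := wL2BZ (measurable_cst _) c (L2_wL2 Lf) (L2_wL2 Lg); split => //.
  by move=> x nOx; rewrite f0// g0// mulr0 subr0.
by rewrite sqnorm2E; move: w; under eq_integral do rewrite normr1 mul1r.
Qed.

(** The phase is such that pairing [f] with it returns [fourier f xi], which turns pointwise bounds
    on transforms into Hilbert space inequalities. *)
Definition planewave (xi : V) (x : V) : R[i] := (\1_Omega x)%:C * expi (dotp x xi).

Lemma sqc_planewave xi x : sqc (planewave xi x) = \1_Omega x.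
Proof.
by rewrite /planewave sqcM sqc_real sqc_expi mulr1 indicE; case: (_ \in _); rewrite ?expr1n ?expr0n.
Qed.

Lemma measurable_cos_dotp (xi : V) : measurable_fun setT (fun x : V => cos (dotp x xi)).
Proof.
apply: (measurableT_comp (@measurable_cos R)).
by apply: eq_measurable_fun (measurable_dotpr xi) => x _; exact: dotpC.
Qed.

Lemma measurable_sin_dotp (xi : V) : measurable_fun setT (fun x : V => sin (dotp x xi)).
Proof.
apply: (measurableT_comp (@measurable_sin R)).
by apply: eq_measurable_fun (measurable_dotpr xi) => x _; exact: dotpC.
Qed.

Lemma cmeasurable_expi (xi : V) : cmeasurable (fun x : V => expi (dotp x xi)).
Proof. by split => /=; [exact: measurable_cos_dotp|exact: measurable_sin_dotp]. Qed.

Lemma sqnorm2_planewave xi : sqnorm2 (planewave xi) = L Omega.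
Proof.
by rewrite sqnorm2E; under eq_integral do rewrite sqc_planewave; rewrite integral_indic// setIT.
Qed.

Lemma L2_planewave xi : L2 Omega (planewave xi).
Proof.
split; last by rewrite sqnorm2_planewave.
- by apply: cmeasurableM; [apply: cmeasurable_real; exact: measurable_indic|exact: cmeasurable_expi].
- by move=> x nOx; rewrite /planewave indicE memNset// mul0r.
Qed.

Lemma fourierE_planewave f xi : L2 Omega f -> fourier f xi = wform (cst 1) f (planewave xi).
Proof.
move=> [_ f0 _]; apply: eq_cintegral => x /=; rewrite /planewave.
have [Ox|nOx] := pselect (Omega x); last by rewrite f0// mul0r !mulr0.
rewrite indicE mem_set//.
by apply: cplx_eq; rewrite !ReImE /= cosN sinN; ring.
Qed.

(** With [c] the inner product, the squared norm of [f - s c g] is a nonnegative quadratic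
    polynomial in the real number [s]. *)
Lemma wform1_CS f g : L2 Omega f -> L2 Omega g ->
  sqc (wform (cst 1) f g) <= fine (sqnorm2 f) * fine (sqnorm2 g).
Proof.
move=> Lf Lg; have wf := L2_wL2 Lf; have wg := L2_wL2 Lg.
have [c cE] : exists c, wform (cst 1) f g = c by eexists.
rewrite cE; set F := fine _; set G := fine _.
have F0 : 0 <= F by rewrite fine_ge0// sqnorm2_ge0.
have G0 : 0 <= G by rewrite fine_ge0// sqnorm2_ge0.
have m1 : measurable_fun setT (cst 1 : V -> R) by exact: measurable_cst.
have H (s : R) : 0 <= F - 2 * s * sqc c + s ^+ 2 * sqc c * G.
  have Lh := L2BZ (s%:C * c) Lf Lg.
  have := wform1_self Lh.
  rewrite (wform_BZl m1 _ wf wg (L2_wL2 Lh)) (wform_BZr m1 _ wf wg wf) (wform_BZr m1 _ wf wg wg).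
  rewrite !wform1_self// -/F -/G (wform_conj m1 wf wg) cE => /(congr1 (@complex.Re R)) /= h.
  suff -> : F - 2 * s * sqc c + s ^+ 2 * sqc c * G =
     fine (sqnorm2 (fun x : V => f x - s%:C * c * g x)) by rewrite fine_ge0// sqnorm2_ge0.
  by rewrite -h !ReImE /= /sqc; ring.
have := sqc_ge0 c; move: H; set q := sqc c => H q0.
move: G0; rewrite le_eqVlt => /predU1P[G0|G0].
  rewrite -G0 mulr0 leNgt; apply/negP => qp.
  (* For [G = 0] the polynomial is affine in [s], and this choice makes it equal to -1. *)
  have := H ((F + 1) / (2 * q)); rewrite -G0 mulr0 addr0.
  have -> : 2 * ((F + 1) / (2 * q)) * q = F + 1 by field; rewrite gt_eqF.
  by lra.
(* The minimiser of the quadratic polynomial. *)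
have := H G^-1; rewrite (_ : _ + _ = F - q / G); last by field; rewrite gt_eqF.
by rewrite subr_ge0 ler_pdivrMr.
Qed.

(** This pointwise bound tames the singularity of the logarithm at the origin. *)
Lemma sqc_fourier_le f xi : L2 Omega f -> sqc (fourier f xi) <= fine (sqnorm2 f) * vol.
Proof.
move=> Lf; rewrite fourierE_planewave// /vol -(sqnorm2_planewave xi).
by apply: wform1_CS => //; exact: L2_planewave.
Qed.

End L2_Omega.
End fourier_L2.

(** * Smooth functions and Fourier decay *)

Section smooth_algebra.
Context {R : realType} {n : nat}.
Local Notation V := 'rV[R]_n.
Implicit Types u w : V -> R.

(* Closed under directional derivatives, hence contained in the smooth functions. *)
Inductive smooth_alg : (V -> R) -> Prop :=
| SAsmooth u : smooth u -> smooth_alg u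
| SAcst (c : R) : smooth_alg (cst c)
| SAcoord i : smooth_alg (fun x => x ord0 i)
| SAadd u w : smooth_alg u -> smooth_alg w -> smooth_alg (u + w)
| SAmul u w : smooth_alg u -> smooth_alg w -> smooth_alg (u * w)
| SAsin u : smooth_alg u -> smooth_alg (sin \o u)
| SAcos u : smooth_alg u -> smooth_alg (cos \o u).

Lemma smooth_differentiable u x : smooth u -> differentiable u x.
Proof. by move=> /(_ [::] x). Qed.

(** In [foldr] the last direction of the list is differentiated first, so the new one goes to the
    end. *)
Lemma smooth_derive u v : smooth u -> smooth ('D_v u).
Proof. by move=> su s x; have := su (rcons s v) x; rewrite foldr_rcons. Qed.

Lemma differentiable_sin (t : R) : differentiable sin t.
Proof. by apply/derivable1_diffP. Qed.

Lemma differentiable_cos (t : R) : differentiable cos t.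
Proof. by apply/derivable1_diffP. Qed.

Lemma smooth_alg_differentiable u x : smooth_alg u -> differentiable u x.
Proof.
move=> su; elim: su x => {u}.
- by move=> u su x; exact: smooth_differentiable.
- by move=> c x; exact: differentiable_cst.
- by move=> i x; exact: differentiable_coord.
- by move=> u w _ du _ dw x; exact: differentiableD.
- by move=> u w _ du _ dw x; exact: differentiableM.
- by move=> u _ du x; apply: differentiable_comp => //; exact: differentiable_sin.
- by move=> u _ du x; apply: differentiable_comp => //; exact: differentiable_cos.
Qed.

Lemma derive_rV_coord (v x : V) i : 'D_v (fun y : V => y ord0 i) x = v ord0 i.
Proof.
apply: cvg_lim => //; apply: cvg_near_cst; near=> h.
have h0 : h != 0 by near: h; exact: nbhs_dnbhs_neq.
by rewrite /= !mxE addrK /GRing.scale/= mulrA mulVf// mul1r.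
Unshelve. all: by end_near. Qed.

Lemma derive_comp_real (f : R -> R) u (v x : V) : differentiable u x ->
  differentiable f (u x) -> 'D_v (f \o u) x = 'D_v u x * 'D_1 f (u x).
Proof.
move=> du df; rewrite deriveE; last exact: differentiable_comp.
rewrite diff_comp//= !deriveE// -[in LHS](mulr1 ('d u x v)).
by rewrite -[_ * 1]/('d u x v *: 1) linearZ.
Qed.

Lemma smooth_alg_derive u v : smooth_alg u -> smooth_alg ('D_v u).
Proof.
elim=> {u}.
- by move=> u su; apply: SAsmooth; exact: smooth_derive.
- move=> c; rewrite (_ : 'D_v _ = cst 0); first exact: SAcst.
  by apply/funext => x; rewrite derive_cst.
- move=> i; rewrite (_ : 'D_v _ = cst (v ord0 i)); first exact: SAcst.
  by apply/funext => x; rewrite derive_rV_coord.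
- move=> u w su du sw dw; rewrite (_ : 'D_v _ = 'D_v u + 'D_v w); first exact: SAadd.
  by apply/funext => x; rewrite deriveD//; apply: diff_derivable; exact: smooth_alg_differentiable.
- move=> u w su du sw dw.
  rewrite (_ : 'D_v _ = u * 'D_v w + w * 'D_v u); first by apply: SAadd; exact: SAmul.
  by apply/funext => x; rewrite deriveM//; apply: diff_derivable; exact: smooth_alg_differentiable.
- move=> u su du; rewrite (_ : 'D_v _ = 'D_v u * (cos \o u)).
    by apply: SAmul => //; exact: SAcos.
  apply/funext => x; rewrite derive_comp_real ?derive_val//; first exact: smooth_alg_differentiable.
  exact: differentiable_sin.
- move=> u su du; rewrite (_ : 'D_v _ = cst (-1) * ('D_v u * (sin \o u))).
    by apply: SAmul; [exact: SAcst|apply: SAmul => //; exact: SAsin].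
  apply/funext => x; rewrite derive_comp_real ?derive_val//; last exact: differentiable_cos.
    by rewrite /= mulN1r mulrN.
  exact: smooth_alg_differentiable.
Qed.

Lemma smooth_algP u : smooth_alg u -> smooth u.
Proof.
move=> su s x; apply: smooth_alg_differentiable.
by elim: s => [//|v s IHs] /=; exact: smooth_alg_derive.
Qed.

Lemma smooth_alg_dotp (xi : V) : smooth_alg (fun x => dotp x xi).
Proof.
rewrite /dotp; elim: (index_enum _) => [|i s IHs].
  rewrite (_ : (fun _ => _) = cst 0); first exact: SAcst.
  by apply/funext => x; rewrite big_nil.
rewrite (_ : (fun _ => _) = (fun x : V => x ord0 i) * cst (xi ord0 i) +
   (fun x : V => \sum_(j <- s) x ord0 j * xi ord0 j)).
  by apply: SAadd => //; apply: SAmul; [exact: SAcoord|exact: SAcst].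
by apply/funext => x; rewrite big_cons.
Qed.

Lemma smooth_continuous u : smooth u -> continuous u.
Proof. by move=> su x; apply: differentiable_continuous; exact: smooth_differentiable. Qed.

Lemma smooth_measurable u : smooth u -> measurable_fun setT u.
Proof. by move=> su; apply: continuous_measurable_rV; exact: smooth_continuous. Qed.

Lemma compact_box (r : R) : compact [set x : V | forall i, `[- r, r]%classic (x ord0 i)].
Proof. apply: (@rV_compact _ _ (fun=> `[- r, r]%classic)) => i; exact: segment_compact. Qed.

Lemma continuous_compact_bounded u (K : set V) : continuous u -> compact K ->
  exists M : R, 0 <= M /\ forall x, K x -> `|u x| <= M.
Proof.
move=> cu cK.
have : compact (u @` K) by apply: continuous_compact => //; exact: continuous_subspaceT.
move=> /compact_bounded[M [Mr HM]].
exists (`|M| + 1); split; first by rewrite addr_ge0.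
move=> x Kx; apply: (HM (`|M| + 1)); last by exists x.
by rewrite (le_lt_trans (ler_norm _))// ltrDl.
Qed.

Lemma coord_le_norm (x : V) i : `|x ord0 i| <= `|x|.
Proof.
have /mapP[j Hj ->] : `|x ord0 i| \in [seq `|x y.1 y.2| | y : 'I_1 * 'I_n].
  by apply/mapP; exists (ord0, i) => //=; rewrite mem_enum.
by rewrite [leRHS]/Num.norm /= mx_normrE; apply/bigmax_geP; right => /=; exists j.
Qed.

Lemma compact_coord_bounded (K : set V) : compact K ->
  exists r : R, 0 <= r /\ forall x i, K x -> `|x ord0 i| <= r.
Proof.
move=> /compact_bounded[M [Mr HM]].
exists (`|M| + 1); split; first by rewrite addr_ge0.
move=> x i Kx; apply: (le_trans (coord_le_norm x i)); apply: (HM (`|M| + 1)) => //.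
by rewrite (le_lt_trans (ler_norm _))// ltrDl.
Qed.

(** Mean value theorem: for [h <= 1] the segment stays in the box of half-side [r + 1], where the
    continuous function ['D_v u] is bounded. *)
Lemma smooth_lipschitz u (v : V) (r : R) : smooth u -> (forall i, `|v ord0 i| <= 1) ->
  exists M : R, 0 <= M /\ forall (x : V) (h : R), (forall i, `|x ord0 i| <= r) -> 0 <= h <= 1 ->
    `|u (x + h *: v) - u x| <= M * h.
Proof.
move=> su v1.
have [M [M0 HM]] := continuous_compact_bounded (smooth_continuous (smooth_derive v su))
  (@compact_box (r + 1)).
exists M; split => // x h xr /andP[h0 h1].
have dg (t : R) : is_derive t 1 (fun t : R => u (x + t *: v)) ('D_v u (x + t *: v)).
  have du : derivable u (x + t *: v) v by apply: diff_derivable; exact: smooth_differentiable.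
  (* Along the line the one-variable difference quotient is the directional one; this transfers both
     derivability and the value. *)
  have E : (fun h0 : R => h0^-1 *: (((fun t : R => u (x + t *: v)) \o shift t) (h0 *: 1) - u (x + t *: v))) =
           (fun h0 : R => h0^-1 *: ((u \o shift (x + t *: v)) (h0 *: v) - u (x + t *: v))).
    apply/funext => k /=; congr (_ *: (u _ - _)).
    have -> : (k%:A : R) = k by exact: mulr1.
    by rewrite scalerDl addrCA.
  apply: DeriveDef; first by rewrite /derivable E.
  by rewrite /derive E.
have [|c /andP[c0 ch]] := @MVT_segment R (fun t => u (x + t *: v)) (fun t => 'D_v u (x + t *: v)) 0 h h0 (fun t _ => dg t).
  apply: continuous_subspaceT => t; apply: differentiable_continuous.
  by apply/derivable1_diffP; apply: ex_derive.
rewrite scale0r addr0 subr0 => ->; rewrite normrM (ger0_norm h0) ler_wpM2r//.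
apply: HM => i /=; rewrite in_itv/= -ler_norml !mxE.
rewrite !bnd_simp in c0 ch.
rewrite (le_trans (ler_normD _ _))// lerD// normrM (ger0_norm c0).
by rewrite mulr_ile1// (le_trans ch).
Qed.

End smooth_algebra.

(** * Finite Sobolev energy of smooth functions with bounded support *)

Section fourier_decay.
Context {R : realType} {n : nat}.
Local Notation V := 'rV[R]_n.
Local Notation L := (lebesgue_rV R n).
Implicit Types u w : V -> R.
Local Open Scope ereal_scope.

Definition sqF u (xi : V) : R := (cosF u xi ^+ 2 + sinF u xi ^+ 2)%R.

Lemma sqF_ge0 u xi : (0 <= sqF u xi)%R. Proof. by rewrite addr_ge0// sqr_ge0. Qed.

Lemma measurable_sqF u : L.-integrable setT (EFin \o u) -> measurable_fun setT (sqF u).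
Proof.
by move=> ui; apply: measurable_funD; apply: measurable_funX; [exact: measurable_cosF|exact: measurable_sinF].
Qed.

Lemma integrable_rV_sub (F : V -> \bar R) (c : V) : L.-integrable setT F ->
  L.-integrable setT (fun x => F (x - c)%R).
Proof.
move=> Fi; have mF := measurable_int _ Fi.
have mFc : measurable_fun setT (fun x : V => F (x - c)%R).
  have := measurableT_comp mF (@measurable_rV_affine R n 1 (- c)).
  by apply: eq_measurable_fun => x _ /=; rewrite scale1r.
apply/integrableP; split => //.
rewrite (integral_rV_sub c (F := fun x => `|F x|)).
  by have /integrableP[] := Fi.
exact: measurableT_comp.
Qed.

(** Translation by [c] multiplies the transform by the phase [expi (dotp c xi)]; this and
    [sinF_shift] are its two components. *)
Lemma cosF_shift u (c xi : V) : L.-integrable setT (EFin \o u) ->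
  cosF (fun x : V => u (x + c)%R) xi =
  (cos (dotp c xi) * cosF u xi + sin (dotp c xi) * sinF u xi)%R.
Proof.
move=> ui; have ci := integrable_cosF xi ui; have si := integrable_sinF xi ui.
have [H1 H2] := Rintegral_lin (cos (dotp c xi)) (sin (dotp c xi)) (integrable0 L setT) ci si.
rewrite [RHS](_ : _ = \int[L]_x (0 + (cos (dotp c xi) * (u x * cos (dotp x xi)) + sin (dotp c xi) * (u x * sin (dotp x xi)))))%R; last first.
  by rewrite H2 {1}/Rintegral integral0 add0r.
rewrite /cosF /Rintegral; congr fine.
rewrite -(integral_rV_sub (- c)%R (measurable_int _ H1)).
apply: eq_integral => x _; rewrite opprK; congr EFin.
rewrite dotpDl cosD sinD.
have E := cos2Dsin2 (dotp c xi); set p := u (x + c)%R.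
set a := cos (dotp c xi) in E *; set b := sin (dotp c xi) in E *.
set k := cos (dotp x xi); set l := sin (dotp x xi).
(* Inserting cos^2 + sin^2 = 1 makes the remaining identity polynomial. *)
transitivity ((a ^+ 2 + b ^+ 2) * (p * k))%R; first by rewrite E mul1r.
by ring.
Qed.

Lemma sinF_shift u (c xi : V) : L.-integrable setT (EFin \o u) ->
  sinF (fun x : V => u (x + c)%R) xi =
  (cos (dotp c xi) * sinF u xi - sin (dotp c xi) * cosF u xi)%R.
Proof.
move=> ui; have ci := integrable_cosF xi ui; have si := integrable_sinF xi ui.
have [H1 H2] := Rintegral_lin (cos (dotp c xi)) (- sin (dotp c xi)) (integrable0 L setT) si ci.
rewrite [RHS](_ : _ = \int[L]_x (0 + (cos (dotp c xi) * (u x * sin (dotp x xi)) + - sin (dotp c xi) * (u x * cos (dotp x xi)))))%R; last first.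
  by rewrite H2 {1}/Rintegral integral0 add0r mulNr.
rewrite /sinF /Rintegral; congr fine.
rewrite -(integral_rV_sub (- c)%R (measurable_int _ H1)).
apply: eq_integral => x _; rewrite opprK; congr EFin.
rewrite dotpDl cosD sinD.
have E := cos2Dsin2 (dotp c xi); set p := u (x + c)%R.
set a := cos (dotp c xi) in E *; set b := sin (dotp c xi) in E *.
set k := cos (dotp x xi); set l := sin (dotp x xi).
transitivity ((a ^+ 2 + b ^+ 2) * (p * l))%R; first by rewrite E mul1r.
by ring.
Qed.

(** The factor is [|e^(i s) - 1|^2 = 2 - 2 cos s] with [s = dotp c xi]. *)
Lemma sqF_difference u (c xi : V) : L.-integrable setT (EFin \o u) ->
  sqF (fun x => u (x + c) - u x)%R xi = ((2 - 2 * cos (dotp c xi)) * sqF u xi)%R.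
Proof.
move=> ui.
have uci : L.-integrable setT (EFin \o (fun x : V => u (x + c)%R)).
  have := integrable_rV_sub (- c)%R ui; apply: eq_integrable => // x _ /=.
  by rewrite opprK.
have -> : sqF (fun x => u (x + c) - u x)%R xi =
  ((cosF (fun x : V => u (x + c)%R) xi - cosF u xi) ^+ 2 + (sinF (fun x : V => u (x + c)%R) xi - sinF u xi) ^+ 2)%R.
  rewrite /sqF; congr (_ ^+ 2 + _ ^+ 2)%R.
    rewrite /cosF -RintegralB//; [|exact: integrable_cosF..].
    by apply: eq_Rintegral => x _; rewrite mulrBl.
  rewrite /sinF -RintegralB//; [|exact: integrable_sinF..].
  by apply: eq_Rintegral => x _; rewrite mulrBl.
rewrite cosF_shift// sinF_shift// /sqF.
have E := cos2Dsin2 (dotp c xi).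
set a := cos (dotp c xi) in E *; set b := sin (dotp c xi) in E *.
set p := cosF u xi; set q := sinF u xi.
transitivity ((a ^+ 2 + b ^+ 2 + 1 - 2 * a) * (p ^+ 2 + q ^+ 2))%R; first by ring.
by rewrite E.
Qed.

Lemma limn_einf_le_cst (v : nat -> \bar R) (B : \bar R) :
  (forall m, v m <= B) -> limn_einf v <= B.
Proof.
move=> vB; apply: (le_trans (limn_einf_sup v)).
rewrite limn_esup_lim; apply: lime_le; first exact: is_cvg_esups.
apply: nearW => m; apply: ub_ereal_sup => _ [k _ <-]; exact: vB.
Qed.

(** Since 2 - 2 cos (h t) = (2 sin (h t / 2))^2, the sequence is the square of the difference
    quotient at 0 of a function with derivative [t]. *)
Lemma cvg_difference_quotient (t : R) :
  (fun m => (@epsn R m) ^- 2 * (2 - 2 * cos (@epsn R m * t)))%R @ \oo --> (t ^+ 2)%R.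
Proof.
pose f (h : R) : R := (2 * sin (t / 2 * h))%R.
have df : is_derive (0 : R)%R 1%R f t.
  apply: is_derive_eq.
  by rewrite /GRing.scale/= mulr0 cos0; field.
have H : (fun h : R => h^-1 *: (f h - f 0))%R @ (0 : R)%R^' --> t.
  have [df1 df2] := df.
  have := df1; rewrite /derivable => /cvg_ex[l Hl].
  have lt : l = t by rewrite -df2; apply/esym/cvg_lim.
  rewrite -lt; move: Hl; apply: cvg_trans; apply: near_eq_cvg; near=> h.
  by rewrite /= addr0 /GRing.scale/= mulr1.
have eN : (forall m, @epsn R m != 0)%R /\ @epsn R @ \oo --> (0 : R)%R.
  by split; [move=> m; rewrite gt_eqF// epsn_gt0|exact: cvg_harmonic].
have /(cvgr_dnbhsP _ _ _).1/(_ _ eN) {}H := H.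
rewrite [X in X @ _](_ : _ = (fun m => ((@epsn R m)^-1 *: (f (@epsn R m) - f 0)) ^+ 2))%R; last first.
  apply/funext => m; rewrite /f mulr0 sin0 mulr0 subr0 /GRing.scale/=.
  set y := (t / 2 * epsn m)%R.
  have -> : (epsn m * t = y *+ 2)%R by rewrite /y -mulr_natr; field.
  have E := cos2Dsin2 y; rewrite cos_mulr2n.
  transitivity (epsn m ^- 2 * (2 ^+ 2 * sin y ^+ 2))%R; last first.
    by rewrite [RHS]exprMn [in RHS]exprMn -exprVn.
  congr (_ * _)%R.
  have -> : (sin y ^+ 2 = 1 - cos y ^+ 2)%R by rewrite -E addrAC subrr add0r.
  by rewrite -mulr_natr; ring.
apply: (@cvg_comp _ _ _ _ (fun z : R => z ^+ 2)%R _ (nbhs t)); first exact: H.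
exact: exprn_continuous.
Unshelve. all: by end_near. Qed.

(* Difference quotients and Fatou's lemma replace an integration by parts. *)
Lemma sobolev_coord u (r : R) (j : 'I_n) : smooth u ->
  (forall x i, u x != 0%R -> `|x ord0 i| <= r)%R -> L.-integrable setT (EFin \o u) ->
  \int[L]_xi (xi ord0 j ^+ 2 * sqF u xi)%:E < +oo.
Proof.
move=> su ur ui; pose e : V := delta_mx ord0 j.
have e1 i : (`|e ord0 i| <= 1)%R.
  by rewrite mxE; case: (_ && _); rewrite ?normr1 ?normr0.
have [M [M0 HM]] := smooth_lipschitz (r + 1) su e1.
(* Translations have length at most 1, so off this enlarged box both [u] and its translate
   vanish. *)
pose B := [set x : V | forall i, `|x ord0 i| <= r + 1]%R.
have mB : measurable B by exact: measurable_box.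
have Boo : L B < +oo by apply: (bounded_lebesgue_rV_lty (r := r + 1) mB) => x i; exact.
have mu := smooth_measurable su.
pose a m (x : V) := (u (x + epsn m *: e) - u x)%R.
have uci m : L.-integrable setT (EFin \o (fun x : V => u (x + epsn m *: e)%R)).
  have := integrable_rV_sub (- (epsn m *: e))%R ui; apply: eq_integrable => // x _ /=.
  by rewrite opprK.
have ai m : L.-integrable setT (EFin \o a m) by exact: (integrableB measurableT (uci m) ui).
have aB m x : (a m x ^+ 2 <= (M * epsn m) ^+ 2 * \1_B x)%R.
  have e0 := @epsn_gt0 R m.
  have e1' : (@epsn R m <= 1)%R by rewrite invf_le1 ?ler1n.
  rewrite indicE; have [xB|xB] := pselect (B x).
    rewrite (mem_set xB) mulr1 -(@real_normK _ (a m x)) ?num_real//.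
    have Me : (0 <= M * epsn m)%R by apply: mulr_ge0 => //; exact: ltW.
    rewrite ler_sqr ?nnegrE//.
    by apply: HM => //; apply/andP; split => //; exact: ltW.
  rewrite memNset// mulr0 /a.
  have [i xi] : exists i, (r + 1 < `|x ord0 i|)%R.
    apply: contrapT => H; apply: xB => i; rewrite leNgt; apply/negP => Hi.
    by apply: H; exists i.
  have -> : u x = 0%R.
    apply/eqP; apply: contraT => /(ur _ i) h; move: xi; rewrite ltNge => /negP; case.
    by rewrite (le_trans h)// lerDl.
  have -> : (u (x + epsn m *: e) = 0)%R.
    apply/eqP; apply: contraT => /(ur _ i) h; move: xi; rewrite ltNge => /negP; case.
    have -> : x ord0 i = ((x + epsn m *: e) ord0 i - (epsn m *: e) ord0 i)%R.
      by rewrite mxE addrK.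
    rewrite (le_trans (ler_normB _ _))// lerD// mxE normrM (gtr0_norm e0).
    by rewrite mulr_ile1// ltW.
  by rewrite subr0 expr0n.
have a2 m : \int[L]_x (a m x ^+ 2)%:E <= ((M * epsn m) ^+ 2)%:E * L B.
  rewrite -[X in L X]setIT -integral_indic// -ge0_integralZl_EFin//; last 2 first.
  - by apply/measurable_EFinP; exact: measurable_indic.
  - exact: sqr_ge0.
  apply: ge0_le_integral => //.
  - by move=> x _; rewrite lee_fin sqr_ge0.
  - by apply/measurable_EFinP; apply: measurable_funX; apply/measurable_EFinP; exact: (measurable_int _ (ai m)).
  - by apply/measurable_EFinP; apply: measurable_funM => //; exact: measurable_indic.
  - by move=> x _; rewrite -EFinM lee_fin.
have a2oo m : \int[L]_x (a m x ^+ 2)%:E < +oo.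
  by apply: (le_lt_trans (a2 m)); rewrite lte_mul_pinfty// lee_fin sqr_ge0.
have mG := measurable_sqF ui.
have mxi : measurable_fun setT (fun xi : V => xi ord0 j) by exact: measurable_rV_coord.
pose F m (xi : V) := (epsn m ^- 2 * (2 - 2 * cos (epsn m * xi ord0 j)) * sqF u xi)%:E.
have q0 (s : R) : (0 <= 2 - 2 * cos s)%R by have := cos_le1 s; lra.
have F0 m xi : 0 <= F m xi.
  by rewrite lee_fin !mulr_ge0 ?invr_ge0 ?sqr_ge0 ?sqF_ge0.
have mF m : measurable_fun setT (F m).
  apply/measurable_EFinP; apply: measurable_funM => //; apply: measurable_funM => //.
  apply: measurable_funB => //; apply: measurable_funM => //.
  by apply: (measurableT_comp (@measurable_cos R)); exact: measurable_funM.
have C0 : (0 <= (2 * pi) ^+ n :> R)%R by rewrite exprn_ge0// mulr_ge0// pi_ge0.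
(* By Plancherel the left side is [epsn m ^- 2] times the squared norm of the increment; the
   Lipschitz bound supplies a factor [epsn m ^+ 2], so the bound is uniform in [m], as Fatou's lemma
   needs. *)
have FM m : \int[L]_xi F m xi <= ((2 * pi) ^+ n)%:E * ((M ^+ 2)%:E * L B).
  have e2 : (0 < @epsn R m ^+ 2)%R by rewrite exprn_gt0// epsn_gt0.
  have -> : \int[L]_xi F m xi = (epsn m ^- 2)%:E * \int[L]_xi (sqF (a m) xi)%:E.
    rewrite -ge0_integralZl_EFin//; last 3 first.
    - by move=> xi _; rewrite lee_fin sqF_ge0.
    - by apply/measurable_EFinP; exact: measurable_sqF.
    - by rewrite invr_ge0 ltW.
    apply: eq_integral => xi _; rewrite /F /a sqF_difference// -EFinM mulrA; congr EFin.
    congr (_ * (2 - 2 * cos _) * _)%R.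
    rewrite dotpC dotpZr; congr (_ * _)%R; rewrite /dotp (bigD1 j)//= mxE !eqxx mulr1.
    by rewrite big1 ?addr0// => i ij; rewrite mxE (negbTE ij) andbF mulr0.
  have := plancherel_real (ai m) (a2oo m); rewrite -/(sqF (a m) _) => ->.
  rewrite muleCA lee_wpmul2l ?lee_fin//.
  have e2' : 0 <= (epsn m ^- 2)%:E :> \bar R by rewrite lee_fin invr_ge0; exact: ltW.
  apply: (le_trans (lee_wpmul2l e2' (a2 m))).
  rewrite muleA -EFinM exprMn mulrCA mulVf ?mulr1//.
  by rewrite gt_eqF.
rewrite (eq_integral (fun xi => limn_einf (F ^~ xi))); last first.
  move=> xi _; apply/esym.
  have Fc : F ^~ xi @ \oo --> (xi ord0 j ^+ 2 * sqF u xi)%:E.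
    apply: cvg_EFin; first exact: nearW.
    by apply: cvgM; [exact: cvg_difference_quotient|exact: cvg_cst].
  by have [-> _] := cvg_limn_einf_sup Fc.
apply: (le_lt_trans (fatou L measurableT mF (fun m x _ => F0 m x))).
apply: (le_lt_trans (limn_einf_le_cst FM)).
rewrite lte_mul_pinfty// ?lee_fin// ?lte_mul_pinfty// ?lee_fin ?sqr_ge0//.
Qed.

Lemma measurable_sqnorm : measurable_fun setT (fun xi : V => dotp xi xi).
Proof.
by apply: measurable_sum => i; apply: measurable_funM; exact: measurable_rV_coord.
Qed.

Lemma dotp_ge0 (x : V) : (0 <= dotp x x)%R.
Proof. by apply: sumr_ge0 => i _; rewrite -expr2 sqr_ge0. Qed.

Lemma sobolev_real u (r : R) : smooth u ->
  (forall x i, u x != 0%R -> `|x ord0 i| <= r)%R -> L.-integrable setT (EFin \o u) ->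
  \int[L]_x (u x ^+ 2)%:E < +oo ->
  \int[L]_xi ((1 + dotp xi xi) * sqF u xi)%:E < +oo.
Proof.
move=> su ur ui u2; have mG := measurable_sqF ui.
have mc i : measurable_fun setT (fun xi : V => (xi ord0 i ^+ 2 * sqF u xi)%:E).
  apply/measurable_EFinP; apply: measurable_funM => //; apply: measurable_funX.
  exact: measurable_rV_coord.
have c0 (i : 'I_n) (xi : V) : 0 <= (xi ord0 i ^+ 2 * sqF u xi)%:E.
  by rewrite lee_fin mulr_ge0 ?sqr_ge0 ?sqF_ge0.
have -> : \int[L]_xi ((1 + dotp xi xi) * sqF u xi)%:E =
  \int[L]_xi (sqF u xi)%:E + \sum_(i < n) \int[L]_xi (xi ord0 i ^+ 2 * sqF u xi)%:E.
  rewrite -ge0_integral_sum// -ge0_integralD//; last 4 first.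
  - by move=> xi _; rewrite lee_fin sqF_ge0.
  - exact/measurable_EFinP.
  - by move=> xi _; apply: sume_ge0.
  - exact: emeasurable_sum.
  apply: eq_integral => xi _; rewrite sumEFin -EFinD; congr EFin.
  rewrite mulrDl mul1r; congr (_ + _)%R; rewrite /dotp mulr_suml.
  by apply: eq_bigr => i _; rewrite expr2.
rewrite lte_add_pinfty//.
  by rewrite (plancherel_real ui u2) lte_mul_pinfty// lee_fin exprn_ge0// mulr_ge0// ?pi_ge0.
apply: lte_sum_pinfty => i _; exact: (sobolev_coord i su ur ui).
Qed.

End fourier_decay.

(** * The Euclidean norm *)

Section enorm_theory.
Context {R : realType} {n : nat}.
Local Notation V := 'rV[R]_n.
Implicit Types x y : V.

Lemma enorm_ge0 x : 0 <= enorm x. Proof. exact: sqrtr_ge0. Qed.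

Lemma enorm_sqr x : enorm x ^+ 2 = dotp x x.
Proof. by rewrite sqr_sqrtr// dotp_ge0. Qed.

Lemma enorm0 : enorm (0 : V) = 0.
Proof. by rewrite /enorm /dotp big1 ?sqrtr0// => i _; rewrite mxE mul0r. Qed.

Lemma measurable_enorm : measurable_fun setT (@enorm R n).
Proof.
apply: (measurableT_comp _ measurable_sqnorm).
by apply: continuous_measurable_fun; exact: sqrt_continuous.
Qed.

Lemma measurable_ln_enorm : measurable_fun setT (fun x : V => ln (enorm x)).
Proof. exact: (measurableT_comp (@measurable_ln R) measurable_enorm). Qed.

Lemma enorm_eq0 x : enorm x = 0 -> x = 0.
Proof.
move=> x0; have := enorm_sqr x; rewrite x0 expr0n/= => /esym xx.
apply/rowP => i; rewrite mxE; apply/eqP; rewrite -sqrf_eq0.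
suff : \sum_i x ord0 i ^+ 2 == 0.
  rewrite psumr_eq0 => [/allP/(_ i)|j _]; last exact: sqr_ge0.
  by rewrite mem_index_enum => /(_ isT).
by apply/eqP; rewrite -[RHS]xx; apply: eq_bigr => j _; rewrite expr2.
Qed.

Lemma dotp0r x : dotp x 0 = 0.
Proof. by rewrite /dotp big1// => i _; rewrite mxE mulr0. Qed.

(** The squared norm of |y| x - |x| y equals 2 |x| |y| (|x| |y| - x.y) and is nonnegative. *)
Lemma dotp_CS x y : dotp x y <= enorm x * enorm y.
Proof.
have [/enorm_eq0 ->|x0] := eqVneq (enorm x) 0; first by rewrite dotpC dotp0r enorm0 mul0r.
have [/enorm_eq0 ->|y0] := eqVneq (enorm y) 0; first by rewrite dotp0r enorm0 mulr0.
have := dotp_ge0 (enorm y *: x - enorm x *: y).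
rewrite !(dotpBl, dotpBr) !dotpZr !(dotpC (_ *: _)) !dotpZr -!enorm_sqr (dotpC y x).
have a0 : 0 < enorm x by rewrite lt_def x0 enorm_ge0.
have b0 : 0 < enorm y by rewrite lt_def y0 enorm_ge0.
set a := enorm x in a0 *; set b := enorm y in b0 *; set p := dotp x y => h.
have ab : 0 < 2 * (a * b) by rewrite mulr_gt0// mulr_gt0.
rewrite -(ler_pM2l ab) -subr_ge0; apply: (le_trans h).
by rewrite le_eqVlt; apply/orP; left; apply/eqP; ring.
Qed.

Lemma enormD x y : enorm (x + y) <= enorm x + enorm y.
Proof.
rewrite -ler_sqr ?nnegrE ?addr_ge0 ?enorm_ge0// sqrrD !enorm_sqr.
rewrite dotpDl !dotpDr (dotpC y x) mulr2n.
by have := dotp_CS x y; lra.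
Qed.

Lemma enorm_le x : enorm x <= 1 + dotp x x.
Proof. by rewrite -enorm_sqr; have := sqr_ge0 (enorm x - 1); have := enorm_ge0 x; nra. Qed.

Lemma enormZ (s : R) x : 0 <= s -> enorm (s *: x) = s * enorm x.
Proof.
move=> s0; rewrite /enorm dotpZr dotpC dotpZr mulrA -expr2 sqrtrM ?sqr_ge0//.
by rewrite sqrtr_sqr ger0_norm.
Qed.

End enorm_theory.

(** * Test functions and the form domain *)

Section test_functions.
Context {R : realType} {n : nat}.
Local Open Scope complex_scope.
Local Notation V := 'rV[R]_n.
Local Notation L := (lebesgue_rV R n).
Implicit Types (f g phi : V -> R[i]).

Variable Omega : set V.
Hypothesis mO : measurable Omega.
Hypothesis Ooo : (L Omega < +oo)%E.

Lemma test_subset f g : test_function Omega f -> smooth (fun x => complex.Re (g x)) ->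
  smooth (fun x => complex.Im (g x)) -> (forall x, f x = 0 -> g x = 0) -> test_function Omega g.
Proof.
move=> [_ _ cf fO] sr si fg.
have S : closure [set x | g x != 0] `<=` closure [set x | f x != 0].
  by apply: closureS => x /=; apply: contra_neq; exact: fg.
split => //; last exact: subset_trans fO.
by apply: (subclosed_compact _ cf S); exact: closed_closure.
Qed.

Lemma test_BZ f g (c : R[i]) : test_function Omega f -> test_function Omega g ->
  test_function Omega (fun x => f x - c * g x).
Proof.
move=> [fr fi cf fO] [gr gi cg gO].
have S : closure [set x | f x - c * g x != 0] `<=`
    closure [set x | f x != 0] `|` closure [set x | g x != 0].
  rewrite -closureU; apply: closureS => x /= h.
  have [f0|f0] := eqVneq (f x) 0; last by left.
  by right; apply: contra_neq h => ->; rewrite f0 mulr0 subr0.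
split.
- apply: smooth_algP; rewrite (_ : (fun x => _) = (fun x => complex.Re (f x)) +
    (cst (- complex.Re c) * (fun x => complex.Re (g x)) + cst (complex.Im c) * (fun x => complex.Im (g x)))).
    by apply: SAadd; [|apply: SAadd; apply: SAmul; try exact: SAcst]; exact: SAsmooth.
  apply/funext => x.
  transitivity (complex.Re (f x) + (- complex.Re c * complex.Re (g x) + complex.Im c * complex.Im (g x))) => //.
  by rewrite !ReImE /=; ring.
- apply: smooth_algP; rewrite (_ : (fun x => _) = (fun x => complex.Im (f x)) +
    (cst (- complex.Re c) * (fun x => complex.Im (g x)) + cst (- complex.Im c) * (fun x => complex.Re (g x)))).
    by apply: SAadd; [|apply: SAadd; apply: SAmul; try exact: SAcst]; exact: SAsmooth.
  apply/funext => x.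
  transitivity (complex.Im (f x) + (- complex.Re c * complex.Im (g x) + - complex.Im c * complex.Re (g x))) => //.
  by rewrite !ReImE /=; ring.
- by apply: (subclosed_compact _ (compactU cf cg) S); exact: closed_closure.
- by move=> x /S[/fO|/gO].
Qed.

Definition wave (h : V -> R) (xi x : V) : R[i] := (h x)%:C * expi (dotp x xi).

(** The sine vanishes at 0, so the support does not grow; smoothness holds because [smooth_alg] is
    closed under products, sines and cosines. *)
Lemma test_wave f (xi : V) : test_function Omega f ->
  test_function Omega (wave (fun x => sin (pi / 2 * complex.Re (f x))) xi).
Proof.
move=> tf; apply: (test_subset tf); last first.
- by move=> x fx; rewrite /wave fx /= mulr0 sin0 mul0r.
- have [fr _ _ _] := tf; apply: smooth_algP.
  rewrite (_ : (fun x => _) = (sin \o (cst (pi / 2) * (fun x => complex.Re (f x)))) * (sin \o (fun x => dotp x xi))).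
    apply: SAmul; apply: SAsin; last exact: smooth_alg_dotp.
    by apply: SAmul; [exact: SAcst|exact: SAsmooth].
  by apply/funext => x; rewrite !ReImE /= mul0r addr0.
have [fr _ _ _] := tf; apply: smooth_algP.
rewrite (_ : (fun x => _) = (sin \o (cst (pi / 2) * (fun x => complex.Re (f x)))) * (cos \o (fun x => dotp x xi))).
  apply: SAmul; last by apply: SAcos; exact: smooth_alg_dotp.
  by apply: SAsin; apply: SAmul; [exact: SAcst|exact: SAsmooth].
by apply/funext => x; rewrite !ReImE /= mul0r subr0.
Qed.

Lemma test_L2 f : test_function Omega f -> L2 Omega f.
Proof.
move=> [fr fi cf fO].
have [A [A0 HA]] := continuous_compact_bounded (smooth_continuous fr) cf.
have [B [B0 HB]] := continuous_compact_bounded (smooth_continuous fi) cf.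
have f0 x : ~ Omega x -> f x = 0.
  move=> nOx; apply/eqP; apply: contraT => fx; exfalso; apply: nOx; apply: fO.
  exact: subset_closure.
have cmf : cmeasurable f by split; exact: smooth_measurable.
split => //; rewrite sqnorm2E.
have fM x : sqc (f x) <= (A ^+ 2 + B ^+ 2) * \1_Omega x.
  have [fx|fx] := eqVneq (f x) 0.
    by rewrite fx sqc_real expr0n/= mulr_ge0// addr_ge0// sqr_ge0.
  have Ox : Omega x by apply: contrapT => /f0/eqP; exact/negP.
  have cx : closure [set x | f x != 0] x by exact: subset_closure.
  rewrite indicE mem_set// mulr1 /sqc -(@real_normK _ (complex.Re _)) ?num_real//.
  rewrite -(@real_normK _ (complex.Im _)) ?num_real//.
  by apply: lerD; rewrite ler_sqr ?nnegrE//; [exact: HA|exact: HB].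
apply: (@le_lt_trans _ _ (\int[L]_x ((A ^+ 2 + B ^+ 2)%:E * (\1_Omega x)%:E))%E).
  apply: ge0_le_integral => //.
  - by move=> x _; rewrite lee_fin sqc_ge0.
  - by apply/measurable_EFinP; exact: measurable_sqc.
  - by apply/measurable_EFinP; apply: measurable_funM => //; exact: measurable_indic.
  - by move=> x _; rewrite -EFinM lee_fin.
have C0 : 0 <= A ^+ 2 + B ^+ 2 by rewrite addr_ge0// sqr_ge0.
rewrite ge0_integralZl_EFin//; last by apply/measurable_EFinP; exact: measurable_indic.
by rewrite integral_indic// setIT lte_mul_pinfty// lee_fin.
Qed.

Lemma test_sobolev f : test_function Omega f ->
  (\int[L]_xi ((1 + dotp xi xi) * sqc (fourier f xi))%:E < +oo)%E.
Proof.
move=> tf; have Lf := test_L2 tf; have [fr fi cf fO] := tf.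
have fI := L2_cintegrable mO Ooo Lf; have [ai bi] := fI.
have [r [r0 Hr]] := compact_coord_bounded cf.
have f2 := L2_lty Lf.
have part (p : V -> R) : measurable_fun setT p -> (forall x, p x ^+ 2 <= sqc (f x)) ->
    (\int[L]_x (p x ^+ 2)%:E < +oo)%E.
  move=> mp ps; apply: le_lt_trans f2; apply: ge0_le_integral => //.
  - by move=> x _; rewrite lee_fin sqr_ge0.
  - by apply/measurable_EFinP; exact: measurable_funX.
  - by apply/measurable_EFinP; apply: measurable_sqc; case: Lf.
  - by move=> x _; rewrite lee_fin.
have [mfr mfi] : cmeasurable f by case: Lf.
have supp (p : V -> R) : (forall x, f x = 0 -> p x = 0) ->
    forall x i, p x != 0 -> `|x ord0 i| <= r.
  move=> pf x i px; apply: Hr; apply: subset_closure => /=.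
  by apply: contra_neq px; exact: pf.
have Sa : (\int[L]_xi ((1 + dotp xi xi) * sqF (fun x => complex.Re (f x)) xi)%:E < +oo)%E.
  apply: (sobolev_real fr _ ai); first by apply: supp => x ->.
  by apply: part => // x; rewrite /sqc lerDl sqr_ge0.
have Sb : (\int[L]_xi ((1 + dotp xi xi) * sqF (fun x => complex.Im (f x)) xi)%:E < +oo)%E.
  apply: (sobolev_real fi _ bi); first by apply: supp => x ->.
  by apply: part => // x; rewrite /sqc lerDr sqr_ge0.
have mw : measurable_fun setT (fun xi : V => 1 + dotp xi xi).
  by apply: measurable_funD => //; exact: measurable_sqnorm.
pose P (xi : V) := (1 + dotp xi xi) * sqF (fun x => complex.Re (f x)) xi.
pose Q (xi : V) := (1 + dotp xi xi) * sqF (fun x => complex.Im (f x)) xi.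
have ma : measurable_fun setT P := measurable_funM mw (measurable_sqF ai).
have mb : measurable_fun setT Q := measurable_funM mw (measurable_sqF bi).
have w0 (xi : V) : 0 <= 1 + dotp xi xi by rewrite addr_ge0// dotp_ge0.
have P0 xi : 0 <= P xi by rewrite mulr_ge0// sqF_ge0.
have Q0 xi : 0 <= Q xi by rewrite mulr_ge0// sqF_ge0.
apply: (@le_lt_trans _ _ (\int[L]_xi (2%:E * ((P xi)%:E + (Q xi)%:E)))%E).
  apply: ge0_le_integral => //.
  - by move=> x _; rewrite lee_fin mulr_ge0// sqc_ge0.
  - apply/measurable_EFinP; apply: measurable_funM => //; apply: measurable_sqc.
    exact: cmeasurable_fourier.
  - apply: emeasurable_funM => //; apply: emeasurable_funD; exact/measurable_EFinP.
  - move=> x _; rewrite -EFinD -EFinM lee_fin /P /Q -mulrDr mulrCA ler_wpM2l//.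
    rewrite /sqc Re_fourier// Im_fourier// /sqF.
    set A := cosF _ x; set B := sinF _ x; set C := cosF _ x; set D := sinF _ x.
    have := sqr_ge0 (A - B); have := sqr_ge0 (C + D); lra.
rewrite ge0_integralZl_EFin//; last 2 first.
- by move=> x _; rewrite -EFinD lee_fin addr_ge0.
- by apply: emeasurable_funD; exact/measurable_EFinP.
rewrite ge0_integralD//; last 4 first.
- by move=> x _; rewrite lee_fin.
- exact/measurable_EFinP.
- by move=> x _; rewrite lee_fin.
- exact/measurable_EFinP.
apply: lte_mul_pinfty; rewrite ?lee_fin//; exact: lte_add_pinfty.
Qed.

Let e0 : 0 < expR 1 :> R. Proof. exact: expR_gt0. Qed.

Lemma star_weight_gt0 (xi : V) : 0 < expR 1 + enorm xi.
Proof. by rewrite ltr_wpDr// enorm_ge0. Qed.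

Lemma star_weight_ge1 (xi : V) : 1 <= ln (expR 1 + enorm xi).
Proof. by rewrite -[leLHS](@expRK R) ler_ln ?posrE ?star_weight_gt0// lerDl enorm_ge0. Qed.

Lemma measurable_star_weight : measurable_fun setT (fun xi : V => ln (expR 1 + enorm xi)).
Proof.
apply: (measurableT_comp (@measurable_ln R)).
by apply: measurable_funD => //; exact: measurable_enorm.
Qed.

Lemma sqnorm_starE f : sqnorm_star f =
  (\int[L]_xi (ln (expR 1 + enorm xi) * sqc (fourier f xi))%:E)%E.
Proof. by apply: eq_integral => xi _; rewrite normc_sqr. Qed.

(** The logarithmic weight is dominated by the Sobolev weight: ln (e + t) <= e + t <= (e + 1) (1 +
    t^2). *)
Lemma test_star f : test_function Omega f -> (sqnorm_star f < +oo)%E.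
Proof.
move=> tf; have Lf := test_L2 tf; have fI := L2_cintegrable mO Ooo Lf.
have mf := measurable_sqc (cmeasurable_fourier fI).
have mw : measurable_fun setT (fun xi : V => 1 + dotp xi xi).
  by apply: measurable_funD => //; exact: measurable_sqnorm.
rewrite sqnorm_starE.
apply: (@le_lt_trans _ _ (\int[L]_xi ((expR 1 + 1)%:E * ((1 + dotp xi xi) * sqc (fourier f xi))%:E))%E).
  apply: ge0_le_integral => //.
  - move=> xi _; rewrite lee_fin mulr_ge0 ?sqc_ge0//.
    by rewrite (le_trans _ (star_weight_ge1 xi)).
  - by apply/measurable_EFinP; apply: measurable_funM => //; exact: measurable_star_weight.
  - by apply: emeasurable_funM => //; apply/measurable_EFinP; exact: measurable_funM.
  - move=> xi _; rewrite -EFinM lee_fin mulrA ler_wpM2r ?sqc_ge0//.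
    have := ln_sublinear (star_weight_gt0 xi); have := enorm_le xi.
    have := dotp_ge0 xi; have := e0; nra.
rewrite ge0_integralZl_EFin//; last 2 first.
- by move=> x _; rewrite lee_fin mulr_ge0// ?sqc_ge0// addr_ge0// dotp_ge0.
- by apply/measurable_EFinP; exact: measurable_funM.
rewrite lte_mul_pinfty// ?lee_fin ?addr_ge0 ?ltW//.
exact: test_sobolev.
Qed.

Lemma test_HH f : test_function Omega f -> HH Omega f.
Proof.
move=> tf; split; first exact: test_L2.
move=> eps eps0; exists f => //; rewrite sqnorm_starE integral0_eq ?lte_fin// => xi _.
rewrite (_ : fourier _ xi = 0) ?sqc_real ?expr0n ?mulr0//.
rewrite /fourier /cintegral /Rintegral !integral0_eq//= => x _; by rewrite subrr mulr0.
Qed.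

(** One test function at squared distance below 1 suffices, the norm being finite on it and on the
    difference. *)
Lemma HH_star phi : HH Omega phi -> (sqnorm_star phi < +oo)%E.
Proof.
move=> [Lphi /(_ 1 ltr01)[f tf pf]].
have Lf := test_L2 tf; have fs := test_star tf.
have Lg : L2 Omega (fun x => phi x - f x).
  have := L2BZ 1 Lphi Lf; congr L2; apply/funext => x; by rewrite mul1r.
have pI := L2_cintegrable mO Ooo Lphi.
have fI := L2_cintegrable mO Ooo Lf; have gI := L2_cintegrable mO Ooo Lg.
have mp := measurable_sqc (cmeasurable_fourier pI).
have mf := measurable_sqc (cmeasurable_fourier fI); have mg := measurable_sqc (cmeasurable_fourier gI).
have mw := measurable_star_weight.
have w0 (xi : V) : 0 <= ln (expR 1 + enorm xi) by rewrite (le_trans _ (star_weight_ge1 xi)).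
move: pf fs; rewrite !sqnorm_starE.
set P := (fun xi : V => (_ * sqc (fourier (fun x : V => phi x - f x) xi))%:E).
set Q := (fun xi : V => (_ * sqc (fourier f xi))%:E) => Poo Qoo.
have P0 xi : (0 <= P xi)%E by rewrite lee_fin mulr_ge0// sqc_ge0.
have Q0 xi : (0 <= Q xi)%E by rewrite lee_fin mulr_ge0// sqc_ge0.
have mP : measurable_fun setT P by apply/measurable_EFinP; exact: measurable_funM.
have mQ : measurable_fun setT Q by apply/measurable_EFinP; exact: measurable_funM.
apply: (@le_lt_trans _ _ (\int[L]_xi (2%:E * (P xi + Q xi)))%E).
  apply: ge0_le_integral => //.
  - by move=> xi _; rewrite lee_fin mulr_ge0// sqc_ge0.
  - by apply/measurable_EFinP; exact: measurable_funM.
  - by apply: emeasurable_funM => //; exact: emeasurable_funD.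
  - move=> xi _; rewrite /P /Q -EFinD -EFinM lee_fin -mulrDr mulrCA ler_wpM2l//.
    have -> : fourier phi xi = fourier (fun x => phi x - f x) xi + fourier f xi.
      have -> : fourier (fun x => phi x - f x) xi = fourier phi xi - 1 * fourier f xi.
        by rewrite -fourierBZ//; congr (fourier _ xi); apply/funext => x; rewrite mul1r.
      by rewrite mul1r subrK.
    by rewrite mulrDr; exact: sqcD_le.
rewrite ge0_integralZl_EFin//; last 2 first.
- by move=> x _; exact: adde_ge0.
- exact: emeasurable_funD.
have PQ : (\int[L]_x (P x + Q x) = \int[L]_x P x + \int[L]_x Q x)%E.
  by apply: ge0_integralD.
have {}Poo : (\int[L]_x P x < +oo)%E := lt_trans Poo (ltry 1).
have : (0 <= \int[L]_x P x + \int[L]_x Q x)%E by apply: adde_ge0; exact: integral_ge0.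
rewrite PQ; move: Poo Qoo; move: (integral _ _ P) (integral _ _ Q) => p q poo qoo pq0.
apply: lte_mul_pinfty; rewrite ?lee_fin//; exact: lte_add_pinfty.
Qed.

End test_functions.

(** * Logarithmic moments of balls *)

Section log_moments.
Context {R : realType} {n : nat}.
Local Notation V := 'rV[R]_n.
Local Notation L := (lebesgue_rV R n).
Local Notation mu := (@lebesgue_measure R).
Local Open Scope ereal_scope.

Lemma measurable_eball_lt (r : R) : measurable [set x : V | (enorm x < r)%R].
Proof.
rewrite (_ : [set _ | _] = @enorm R n @^-1` `]-oo, r[); last first.
  by apply/seteqP; split=> x /=; rewrite in_itv.
by rewrite -[X in measurable X]setTI; exact: measurable_enorm.
Qed.

Lemma coord_le_enorm (x : V) i : (`|x ord0 i| <= enorm x)%R.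
Proof.
rewrite -ler_sqr ?nnegrE ?enorm_ge0// real_normK ?num_real// enorm_sqr.
rewrite /dotp (bigD1 i)//= -expr2 lerDl; apply: sumr_ge0 => j _.
by rewrite -expr2 sqr_ge0.
Qed.

Lemma eball_lty : L (@eball R n) < +oo.
Proof.
apply: (bounded_lebesgue_rV_lty (r := 1)) => [|x i xB]; first exact: measurable_eball_lt.
by apply: (le_trans (coord_le_enorm x i)); exact: ltW.
Qed.

Lemma lebesgue_eball (r : R) : (0 < r)%R ->
  L [set x : V | (enorm x < r)%R] = (r ^+ n)%:E * L (@eball R n).
Proof.
move=> r0; have mB := measurable_eball_lt r; have mB1 := measurable_eball_lt 1.
have rn : (r ^+ n != 0)%R by rewrite expf_neq0// gt_eqF.
have := @ge0_integral_rV_affine R n r 0 (fun x : V => (\1_[set x : V | (enorm x < r)%R] x)%:E) r0.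
rewrite [X in _ = _ * X]integral_indic// setIT => H.
have {}H : \int[L]_x (\1_(@eball R n) x)%:E = (r ^- n)%:E * L [set x : V | (enorm x < r)%R].
  rewrite -H; last 2 first.
  - by apply/measurable_EFinP; exact: measurable_indic.
  - by move=> x; rewrite lee_fin.
  apply: eq_integral => x _; rewrite addr0 !indicE; congr ((nat_of_bool _)%:R%:E).
  apply/idP/idP; rewrite !inE /eball /= enormZ ?ltW// => h.
    by rewrite -[ltRHS]mulr1 ltr_pM2l.
  by move: h; rewrite -{2}[r]mulr1 ltr_pM2l.
move: H; rewrite integral_indic// setIT => ->.
by rewrite muleA -EFinM mulfV// mul1e.
Qed.

Lemma measurable_set1_0 : measurable [set (0%R : V)].
Proof.
rewrite (_ : [set _] = ~` \bigcup_k [set x : V | (k.+1%:R^-1 <= enorm x)%R]); last first.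
  apply/seteqP; split=> x /=.
    by move=> -> [k _] /=; rewrite enorm0 leNgt invr_gt0 ltr0n//.
  move=> H; apply: enorm_eq0; apply/eqP; rewrite eq_le enorm_ge0 andbT.
  rewrite leNgt; apply/negP => x0; apply: H.
  have [k _ /(_ _ (leqnn _)) hk] := @near_infty_natSinv_lt R (PosNum x0).
  by exists k => //=; apply: ltW.
apply: measurableC; apply: bigcup_measurable => k _.
rewrite (_ : [set _ | _] = ~` [set x : V | (enorm x < k.+1%:R^-1)%R]).
  by apply: measurableC; exact: measurable_eball_lt.
by apply/seteqP; split=> x /=; [move=> h; apply/negP; rewrite -leNgt|move/negP; rewrite -leNgt].
Qed.

Hypothesis n0 : (0 < n)%N.

(** Small balls have measure proportional to [r ^+ n], with [n] positive. The origin has to be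
    negligible because [ln 0 = 0] there instead of minus infinity. *)
Lemma lebesgue_rV_set1_0 : L [set (0%R : V)] = 0.
Proof.
have m0 := measurable_set1_0.
apply/eqP; rewrite eq_le measure_ge0 andbT; apply/lee_addgt0Pr => e e0; rewrite add0e.
have Boo := eball_lty; have B0 := measure_ge0 L (@eball R n).
pose b := fine (L (@eball R n)).
have bE : L (@eball R n) = b%:E by rewrite fineK// ge0_fin_numE.
have b0 : (0 <= b)%R by rewrite -lee_fin -bE.
(* [r <= 1] gives [r ^+ n <= r], and then [r * (b + 1) <= e]; the added 1 avoids a division by 0. *)
pose r := Num.min 1%R (e / (b + 1))%R.
have r0 : (0 < r)%R by rewrite lt_min ltr01 divr_gt0// ltr_wpDl.
have r1 : (r <= 1)%R by rewrite ge_min lexx.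
apply: (@le_trans _ _ (L [set x : V | (enorm x < r)%R])).
  apply: le_measure; rewrite ?inE//; first exact: measurable_eball_lt.
  by move=> x /= ->; rewrite enorm0.
rewrite lebesgue_eball// bE -EFinM lee_fin.
apply: (@le_trans _ _ (r * (b + 1))%R).
  apply: ler_pM => //; [exact/exprn_ge0/ltW| |by rewrite lerDl].
  by rewrite -[leRHS]expr1 ler_wiXn2l// ltW.
by rewrite -ler_pdivlMr ?ltr_wpDl// ge_min lexx orbT.
Qed.

(** At the origin [ln 0 = 0] makes the value [Num.max l 0] rather than infinity, on a null set. *)
Definition logp (l : R) (xi : V) : R := Num.max (l - ln (enorm xi))%R 0%R.

Lemma logp_ge0 l xi : (0 <= logp l xi)%R. Proof. by rewrite le_max lexx orbT. Qed.

Lemma measurable_logp l : measurable_fun setT (logp l).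
Proof.
apply: measurable_maxr => //; apply: measurable_funB => //.
exact: measurable_ln_enorm.
Qed.

(* Layer cake: [(l - ln |xi|)_+] is the length of [{t >= 0 | |xi| < e^(l - t)}]. *)
Lemma integral_logp l :
  \int[L]_xi (logp l xi)%:E = (expR (n%:R * l) / n%:R)%:E * L (@eball R n).
Proof.
pose A := [set p : R * V | (0 <= p.1)%R /\ (enorm p.2 < expR (l - p.1))%R].
have mA : measurable A.
  rewrite (_ : A = (fst @^-1` `[0%R, +oo[) `&`
      ((fun p : R * V => (expR (l - p.1) - enorm p.2)%R) @^-1` `]0%R, +oo[)).
    apply: measurableI; first by rewrite -[X in measurable X]setTI; exact: measurable_fst.
    rewrite -[X in measurable X]setTI.
    have : measurable_fun setT (fun p : R * V => (expR (l - p.1) - enorm p.2)%R).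
      apply: measurable_funB.
        by apply: (measurableT_comp (@measurable_expR R)); apply: measurable_funB.
      by apply: (measurableT_comp measurable_enorm).
    by apply.
  by apply/seteqP; split=> -[t x] /= []; rewrite !in_itv/= !andbT subr_gt0.
have mF : measurable_fun setT (fun p => (\1_A p)%:E : \bar R).
  by apply/measurable_EFinP; exact: measurable_indic.
have F0 p : 0 <= (\1_A p)%:E :> \bar R by rewrite lee_fin.
have H := @fubini_tonelli _ _ _ _ R mu L (fun p => (\1_A p)%:E) mF F0.
have n0' : (0 < n%:R :> R)%R by rewrite ltr0n.
transitivity (\int[L]_xi \int[mu]_t (\1_A (t, xi))%:E).
  (* The identity fails only at the origin, where the slice in [t] is a whole half-line. *)
  apply: ge0_ae_eq_integral => //.
  - by apply/measurable_EFinP; exact: measurable_logp.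
  - exact: (measurable_fun_fubini_tonelli_G (m1 := mu) _ mF F0).
  - by move=> xi _; rewrite lee_fin logp_ge0.
  - by move=> xi _; apply: integral_ge0.
  exists [set (0%R : V)]; split; [exact: measurable_set1_0|exact: lebesgue_rV_set1_0|].
  move=> xi /= /not_implyP[_ h]; apply: contrapT => x0; apply: h.
  have e0 : (0 < enorm xi)%R.
    by rewrite lt_def enorm_ge0 andbT; apply/eqP => /enorm_eq0.
  have -> : (fun t : R => (\1_A (t, xi))%:E) = (fun t => (\1_(`[0%R, (l - ln (enorm xi))%R[) t)%:E) :> (R -> \bar R).
    apply/funext => t; rewrite !indicE; congr ((nat_of_bool _)%:R%:E); apply/idP/idP; rewrite !inE /A /= in_itv/=.
      move=> [-> h] /=; rewrite ltrBrDl -ltrBrDr.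
      by rewrite -[ltRHS]expRK ltr_ln ?posrE ?expR_gt0.
    move=> /andP[-> h]; split => //; rewrite -[ltLHS]lnK ?posrE// ltr_expR.
    by rewrite ltrBrDl -ltrBrDr.
  transitivity (mu [set` `[0%R, (l - ln (enorm xi))%R[]); last first.
    have := @integral_indic _ _ R mu setT measurableT [set` `[0%R, (l - ln (enorm xi))%R[].
    by rewrite setIT => ->.
  rewrite lebesgue_measure_itv/= lte_fin /logp.
  by case: ltP => h //; rewrite -EFinD subr0.
rewrite -H.
have bE : L (@eball R n) = (fine (L (@eball R n)))%:E.
  by rewrite fineK// ge0_fin_numE// eball_lty.
(* For fixed [t] the slice is a ball of radius [expR (l - t)]; the remaining exponential integral
   gives the factor 1/n. *)
transitivity (\int[mu]_(t in `[0%R, +oo[) ((expR (n%:R * l))%:E * L (@eball R n) * (expR (- (n%:R * t)))%:E)).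
  rewrite [RHS]integral_mkcond; apply: eq_integral => t _; rewrite patchE.
  have [t0|t0] := leP (0 : R)%R t.
    rewrite mem_set /= ?in_itv/= ?t0//.
    rewrite (eq_integral (fun xi => (\1_[set x : V | (enorm x < expR (l - t))%R] xi)%:E)); last first.
      move=> xi _; rewrite !indicE; congr ((nat_of_bool _)%:R%:E); apply/idP/idP; rewrite !inE /A /=.
        by move=> [].
      by move=> ?; split.
    rewrite integral_indic ?setIT//; last exact: measurable_eball_lt.
    transitivity ((expR (l - t) ^+ n)%:E * L (@eball R n)).
      exact: (lebesgue_eball (expR_gt0 (l - t)%R)).
    rewrite muleAC -EFinM; congr (_%:E * _).
    by rewrite -expRM_natl -expRD; congr expR; ring.
  rewrite memNset /= ?in_itv/= ?leNgt ?t0//.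
  rewrite integral0_eq// => xi _; rewrite indicE memNset// /A /= => -[].
  by rewrite leNgt t0.
rewrite bE ge0_integralZl//; last 2 first.
- apply: measurable_funTS; apply/measurable_EFinP; apply: measurableT_comp => //.
  by apply: measurable_funN; exact: measurable_funM.
- by rewrite -EFinM lee_fin mulr_ge0 ?expR_ge0// fine_ge0.
by rewrite integral0y_expR// -!EFinM; congr EFin; rewrite mulrAC.
Qed.

End log_moments.

(** * The upper bound *)

Section log_weight.
Context {R : realType} {n : nat}.
Local Open Scope complex_scope.
Local Notation V := 'rV[R]_n.
Local Notation L := (lebesgue_rV R n).
Implicit Types (f g phi psi : V -> R[i]).

Definition lnw (xi : V) : R := ln (enorm xi).

Lemma measurable_lnw : measurable_fun setT lnw.
Proof. exact: measurable_ln_enorm. Qed.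

Lemma log_formE phi psi :
  log_form phi psi = ((2 * pi) ^- n)%:C * wform lnw (fourier phi) (fourier psi).
Proof. by []. Qed.

Lemma wL2_lnw_integrable (F : V -> R[i]) : wL2 lnw F ->
  L.-integrable setT (fun xi => (lnw xi * sqc (F xi))%:E).
Proof.
move=> wF; apply: (le_integrable _ _ _ (wL2_integrable measurable_lnw wF)) => //.
  apply/measurable_EFinP; apply: measurable_funM; first exact: measurable_lnw.
  by apply: measurable_sqc; case: wF.
by move=> xi _ /=; rewrite lee_fin !normrM normr_id.
Qed.

(** The star weight covers the positive part of the logarithm, [logp 0] the negative part. *)
Lemma lnw_le (xi : V) : `|lnw xi| <= ln (expR 1 + enorm xi) + logp 0 xi.
Proof.
have w1 := star_weight_ge1 xi; have l0 := logp_ge0 0 xi.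
rewrite ler_norml; apply/andP; split.
  have : 0 - lnw xi <= logp 0 xi by rewrite le_max lexx.
  lra.
apply: (@le_trans _ _ (ln (expR 1 + enorm xi))); last by rewrite lerDl.
have := enorm_ge0 xi; rewrite le_eqVlt => /predU1P[x0|x0].
  by rewrite /lnw -{1}x0 (ln0 (lexx 0)); exact: le_trans ler01 w1.
by rewrite /lnw ler_ln ?posrE ?star_weight_gt0// lerDr expR_ge0.
Qed.

Hypothesis n0 : (0 < n)%N.
Variable Omega : set V.
Hypothesis mO : measurable Omega.
Hypothesis Ooo : (L Omega < +oo)%E.

Let vol : R := fine (L Omega).
Let bv : R := fine (L (@eball R n)).

Lemma volE : L Omega = vol%:E.
Proof. by rewrite fineK// ge0_fin_numE. Qed.

Lemma vol_ge0 : 0 <= vol. Proof. exact: fine_ge0. Qed.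

Lemma eball_volE : L (@eball R n) = bv%:E.
Proof. by rewrite fineK// ge0_fin_numE// eball_lty. Qed.

Lemma fourier_sqc_integrable f : L2 Omega f ->
  L.-integrable setT (fun xi => (sqc (fourier f xi))%:E).
Proof.
move=> Lf; apply: ge0_integral_eq_lty; last 2 first.
- by move=> xi; rewrite lee_fin sqc_ge0.
- rewrite (plancherel_L2 mO Ooo Lf) lte_mul_pinfty//; last by case: Lf.
  by rewrite lee_fin exprn_ge0// mulr_ge0// pi_ge0.
- apply/measurable_EFinP; apply: measurable_sqc; apply: cmeasurable_fourier.
  exact: L2_cintegrable Lf.
Qed.

(** The star norm handles large frequencies; near the origin the transform is bounded and [logp 0]
    has finite integral. Hence the logarithmic form converges absolutely on [HH Omega]. *)
Lemma HH_wL2 phi : HH Omega phi -> wL2 lnw (fourier phi).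
Proof.
move=> Hphi; have [Lphi _] := Hphi; have pI := L2_cintegrable mO Ooo Lphi.
have mf := cmeasurable_fourier pI; have mq := measurable_sqc mf; split => //.
pose P (xi : V) := ln (expR 1 + enorm xi) * sqc (fourier phi xi).
pose C := fine (sqnorm2 phi) * vol.
have C0 : 0 <= C by rewrite mulr_ge0 ?vol_ge0// fine_ge0// sqnorm2_ge0.
have w0 (xi : V) : 0 <= ln (expR 1 + enorm xi) by rewrite (le_trans _ (star_weight_ge1 xi)).
have P0 xi : (0 <= (P xi)%:E)%E by rewrite lee_fin mulr_ge0// sqc_ge0.
have Q0 (xi : V) : (0 <= C%:E * (logp 0 xi)%:E)%E by rewrite mule_ge0// lee_fin ?logp_ge0.
have mP : measurable_fun setT (fun xi => (P xi)%:E).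
  by apply/measurable_EFinP; apply: measurable_funM => //; exact: measurable_star_weight.
have mQ : measurable_fun setT (fun xi : V => (C%:E * (logp 0 xi)%:E)%E).
  by apply: emeasurable_funM => //; apply/measurable_EFinP; exact: measurable_logp.
apply: (@le_lt_trans _ _ (\int[L]_xi ((P xi)%:E + C%:E * (logp 0 xi)%:E))%E).
  apply: ge0_le_integral => //.
  - by move=> xi _; rewrite lee_fin mulr_ge0// sqc_ge0.
  - apply/measurable_EFinP; apply: measurable_funM => //.
    by apply: measurableT_comp => //; exact: measurable_lnw.
  - exact: emeasurable_funD.
  - move=> xi _; rewrite -EFinM -EFinD lee_fin.
    apply: (le_trans (ler_wpM2r (sqc_ge0 _) (lnw_le xi))).
    rewrite mulrDl lerD2l mulrC ler_wpM2r ?logp_ge0//.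
    exact: sqc_fourier_le.
rewrite ge0_integralD//; apply: lte_add_pinfty.
  by have := HH_star mO Ooo Hphi; rewrite sqnorm_starE.
rewrite ge0_integralZl_EFin//; last 2 first.
- by move=> xi _; rewrite lee_fin logp_ge0.
- by apply/measurable_EFinP; exact: measurable_logp.
by rewrite (integral_logp n0) eball_volE -!EFinM ltry.
Qed.

Section orthonormal.
Variable phi : nat -> V -> R[i].
Hypothesis Lphi : forall k, L2 Omega (phi k).
Hypothesis ophi : orthonormal_system Omega phi.

Lemma wform1_orthonormal j k : wform (cst 1) (phi j) (phi k) = (1 : R)%:C * (j == k)%:R.
Proof. by rewrite -(innerE _ (Lphi j)) ophi mul1r. Qed.

Lemma sqnorm2_orthonormal k : sqnorm2 (phi k) = 1%E.
Proof.
have := wform1_orthonormal k k; rewrite (wform1_self (Lphi k)) eqxx mulr1.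
move=> /(congr1 (@complex.Re R)) /= => h.
by rewrite -[LHS]fineK ?h// ge0_fin_numE ?sqnorm2_ge0//; case: (Lphi k).
Qed.

Lemma bessel u N : L2 Omega u ->
  \sum_(k < N) sqc (inner Omega u (phi k)) <= fine (sqnorm2 u).
Proof.
move=> Lu; have m1 : measurable_fun setT (cst 1 : V -> R) by exact: measurable_cst.
have wu := L2_wL2 Lu; have we k := L2_wL2 (Lphi k).
have eu k : wform (cst 1) (phi k) u = (1 : R)%:C * (inner Omega u (phi k))^*.
  by rewrite mul1r (innerE _ Lu); exact: wform_conj.
have := wform_pythagoras m1 wu we eu wform1_orthonormal N.
have wr := wL2_residual m1 (fun k => inner Omega u (phi k)) wu we N.
rewrite wform_self// (wform1_self Lu) /= => H.
have : 0 <= \int[L]_x (1 * sqc (residual u (fun k => inner Omega u (phi k)) phi N x)).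
  by apply: Rintegral_ge0 => x _; rewrite mul1r sqc_ge0.
by rewrite H subr_ge0; under eq_bigr do rewrite mul1r.
Qed.

Lemma sum_sqc_fourier_le xi N : \sum_(k < N) sqc (fourier (phi k) xi) <= vol.
Proof.
have Lw := L2_planewave mO Ooo xi.
have := bessel N Lw; rewrite sqnorm2_planewave// -/vol; apply: le_trans.
rewrite le_eqVlt; apply/orP; left; apply/eqP; apply: eq_bigr => k _.
rewrite (fourierE_planewave xi (Lphi k)) (innerE _ Lw).
by rewrite (wform_conj _ (L2_wL2 (Lphi k)) (L2_wL2 Lw)) ?sqc_conj.
Qed.

End orthonormal.

Section eigensystem.
Variables (lam : nat -> R) (phi : nat -> V -> R[i]).
Hypothesis ephi : forall k, eigenfunction Omega (lam k) (phi k).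
Hypothesis ophi : orthonormal_system Omega phi.

Let c2 : R := (2 * pi) ^+ n.
Let c2_gt0 : 0 < c2. Proof. by rewrite exprn_gt0// mulr_gt0// pi_gt0. Qed.

Lemma eigen_HH k : HH Omega (phi k). Proof. by case: (ephi k). Qed.
Lemma eigen_L2 k : L2 Omega (phi k). Proof. by case: (eigen_HH k). Qed.

(** Clearing the factor [(2 * pi) ^- n] puts the weak eigenvalue equation in the shape required by
    [wform_pythagoras], with [l j = c2 * lam j]. *)
Lemma eigen_wform k psi : HH Omega psi ->
  wform lnw (fourier (phi k)) (fourier psi) = (c2 * lam k)%:C * inner Omega (phi k) psi.
Proof.
move=> Hpsi; have [_ _ /(_ _ Hpsi)] := ephi k; rewrite log_formE => H.
rewrite rmorphM /= -mulrA -H mulrA -rmorphM /= /c2.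
by rewrite mulfV ?rmorph1 ?mul1r// gt_eqF.
Qed.

Lemma eigenvalueE k : \int[L]_xi (lnw xi * sqc (fourier (phi k) xi)) = c2 * lam k.
Proof.
have := eigen_wform k (eigen_HH k); rewrite wform_self; last exact: HH_wL2 (eigen_HH k).
by rewrite ophi eqxx mulr1 => /(congr1 (@complex.Re R)).
Qed.

Lemma eigenvalue_gap l k :
  ((c2 * Num.max (l - lam k) 0)%:E <= \int[L]_xi (logp l xi * sqc (fourier (phi k) xi))%:E)%E.
Proof.
have Lk := eigen_L2 k; have kI := L2_cintegrable mO Ooo Lk.
have mq := measurable_sqc (cmeasurable_fourier kI).
have wk := HH_wL2 (eigen_HH k).
have I1 := fourier_sqc_integrable Lk; have I2 := wL2_lnw_integrable wk.
have I3 := integrableB measurableT (integrableZl measurableT l I1) I2.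
have m3 : measurable_fun setT (fun xi => logp l xi * sqc (fourier (phi k) xi)).
  by apply: measurable_funM => //; exact: measurable_logp.
have p0 xi : 0 <= logp l xi * sqc (fourier (phi k) xi) by rewrite mulr_ge0 ?logp_ge0 ?sqc_ge0.
rewrite (maxr_pMr _ _ (ltW c2_gt0)) mulr0 EFin_max ge_max; apply/andP; split; last first.
  by apply: integral_ge0 => xi _; rewrite lee_fin.
apply: (@le_trans _ _ (\int[L]_xi (l%:E * (sqc (fourier (phi k) xi))%:E - (lnw xi * sqc (fourier (phi k) xi))%:E))%E).
  rewrite integralB//; last exact: integrableZl.
  rewrite integralZl// (plancherel_L2 mO Ooo Lk) (sqnorm2_orthonormal eigen_L2 ophi) mule1.
  have -> : (\int[L]_xi (lnw xi * sqc (fourier (phi k) xi))%:E = (c2 * lam k)%:E)%E.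
    rewrite -eigenvalueE fineK//; exact: integrable_fin_num.
  by rewrite -EFinM -EFinB mulrBr [l * _]mulrC.
apply: le_integral => //.
  apply: (le_integrable _ _ _ I3) => //; first exact/measurable_EFinP.
  move=> xi _; rewrite -EFinM -EFinB -mulrBl /= lee_fin !normrM ler_wpM2r//.
  by rewrite ger0_norm ?logp_ge0// /logp ge_max normr_ge0 ler_norm.
move=> xi _; rewrite -EFinM -EFinB -mulrBl lee_fin ler_wpM2r ?sqc_ge0//.
by rewrite le_max lexx.
Qed.

(** The bound does not depend on [N], so it passes to the full series. *)
Lemma riesz_upper l N :
  (\sum_(k < N) Num.max (l - lam k) 0 <= c2^-1 * vol * bv * (expR (n%:R * l) / n%:R)).
Proof.
have mk k : measurable_fun setT (fun xi => sqc (fourier (phi k) xi)).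
  apply: measurable_sqc; apply: cmeasurable_fourier; exact: L2_cintegrable (eigen_L2 k).
have H : ((c2 * \sum_(k < N) Num.max (l - lam k) 0)%:E <= \int[L]_xi (vol%:E * (logp l xi)%:E))%E.
  rewrite mulr_sumr -sumEFin.
  apply: (@le_trans _ _ (\sum_(k < N) \int[L]_xi (logp l xi * sqc (fourier (phi k) xi))%:E)%E).
    by apply: lee_sum => k _; exact: eigenvalue_gap.
  rewrite -ge0_integral_sum//; last 2 first.
  - by move=> k; apply/measurable_EFinP; apply: measurable_funM => //; exact: measurable_logp.
  - by move=> k xi _; rewrite lee_fin mulr_ge0 ?logp_ge0 ?sqc_ge0.
  apply: ge0_le_integral => //.
  - by move=> xi _; apply: sume_ge0 => k _; rewrite lee_fin mulr_ge0 ?logp_ge0 ?sqc_ge0.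
  - apply: emeasurable_sum => k; apply/measurable_EFinP; apply: measurable_funM => //.
    exact: measurable_logp.
  - by apply: emeasurable_funM => //; apply/measurable_EFinP; exact: measurable_logp.
  - move=> xi _; rewrite sumEFin -mulr_sumr -EFinM lee_fin [leRHS]mulrC ler_wpM2l ?logp_ge0//.
    exact: sum_sqc_fourier_le eigen_L2 ophi xi N.
move: H; rewrite ge0_integralZl_EFin//; last 3 first.
- by move=> xi _; rewrite lee_fin logp_ge0.
- by apply/measurable_EFinP; exact: measurable_logp.
- exact: vol_ge0.
rewrite (integral_logp n0) eball_volE -!EFinM lee_fin => H.
rewrite -(ler_pM2l c2_gt0); apply: (le_trans H).
by rewrite !mulrA mulfV ?gt_eqF// mul1r le_eqVlt; apply/orP; left; apply/eqP; ring.
Qed.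

End eigensystem.
End log_weight.

(** * Density of test functions *)

Section density.
Context {R : realType} {n : nat}.
Local Open Scope complex_scope.
Local Notation V := 'rV[R]_n.
Local Notation L := (lebesgue_rV R n).
Implicit Types (f g u v phi psi : V -> R[i]).

Variable Omega : set V.
Hypothesis mO : measurable Omega.
Hypothesis Ooo : (L Omega < +oo)%E.

Lemma sqnorm2_fineK f : L2 Omega f -> sqnorm2 f = (fine (sqnorm2 f))%:E.
Proof. by move=> [_ _ foo]; rewrite fineK// ge0_fin_numE// sqnorm2_ge0. Qed.

Lemma fine_sqnorm2_ge0 f : 0 <= fine (sqnorm2 f).
Proof. by rewrite fine_ge0// sqnorm2_ge0. Qed.

Lemma sqnorm2BZ_le f g (c : R[i]) : L2 Omega f -> L2 Omega g ->
  fine (sqnorm2 (fun x => f x - c * g x)) <=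
    2 * fine (sqnorm2 f) + 2 * sqc c * fine (sqnorm2 g).
Proof.
move=> Lf Lg; have Lh := L2BZ c Lf Lg.
have [mf _ _] := Lf; have [mg _ _] := Lg; have [mh _ _] := Lh.
rewrite -lee_fin -(sqnorm2_fineK Lh) EFinD !EFinM -(sqnorm2_fineK Lf) -(sqnorm2_fineK Lg) !sqnorm2E.
have e2 : (2%:E * (sqc c)%:E = (2 * sqc c)%:E :> \bar R)%E by rewrite EFinM.
have m2f := measurable_sqc mf; have m2g := measurable_sqc mg; have m2h := measurable_sqc mh.
rewrite e2 -!ge0_integralZl_EFin//; first last.
- exact/measurable_EFinP.
- by move=> x _; rewrite lee_fin sqc_ge0.
- by rewrite mulr_ge0// sqc_ge0.
- exact/measurable_EFinP.
- by move=> x _; rewrite lee_fin sqc_ge0.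
rewrite -ge0_integralD//; first last.
- by apply: emeasurable_funM => //; exact/measurable_EFinP.
- by move=> x _; rewrite -EFinM lee_fin !mulr_ge0// sqc_ge0.
- by apply: emeasurable_funM => //; exact/measurable_EFinP.
- by move=> x _; rewrite -EFinM lee_fin !mulr_ge0// sqc_ge0.
apply: ge0_le_integral => //.
- by move=> x _; rewrite lee_fin sqc_ge0.
- exact/measurable_EFinP.
- by apply: emeasurable_funD; apply: emeasurable_funM => //; exact/measurable_EFinP.
- by move=> x _; rewrite -!EFinM -EFinD lee_fin -mulrA -sqcM; exact: sqcB_le.
Qed.

Lemma sqnorm2_le_star f : L2 Omega f -> (((2 * pi) ^+ n)%:E * sqnorm2 f <= sqnorm_star f)%E.
Proof.
move=> Lf; rewrite -(plancherel_L2 mO Ooo Lf) sqnorm_starE.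
have mf := measurable_sqc (cmeasurable_fourier (L2_cintegrable mO Ooo Lf)).
apply: ge0_le_integral => //.
- by move=> x _; rewrite lee_fin sqc_ge0.
- exact/measurable_EFinP.
- by apply/measurable_EFinP; apply: measurable_funM => //; exact: measurable_star_weight.
- move=> x _; rewrite lee_fin -[leLHS]mul1r ler_wpM2r ?sqc_ge0//; exact: star_weight_ge1.
Qed.

(** The L^2 closure of the test functions. It contains [HH Omega] and is stable under linear
    combinations; L^2 closeness is all that the choice of a cutoff near the indicator requires. *)
Definition approximable u := L2 Omega u /\ forall eps : R, 0 < eps ->
  exists2 f, test_function Omega f & fine (sqnorm2 (fun x => u x - f x)) < eps.

Lemma L2B f g : L2 Omega f -> L2 Omega g -> L2 Omega (fun x => f x - g x).
Proof.
move=> Lf Lg; have := L2BZ 1 Lf Lg; congr (L2 Omega).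
by apply/funext => x; rewrite mul1r.
Qed.

Lemma HH_approximable phi : HH Omega phi -> approximable phi.
Proof.
move=> [Lphi Hphi]; split => // eps e0.
have c2 : 0 < (2 * pi) ^+ n :> R by rewrite exprn_gt0// mulr_gt0// pi_gt0.
have [|f tf fe] := Hphi ((2 * pi) ^+ n * eps); first exact: mulr_gt0.
exists f => //; have Lg := L2B Lphi (test_L2 mO Ooo tf).
have := le_lt_trans (sqnorm2_le_star Lg) fe.
by rewrite (sqnorm2_fineK Lg) -EFinM lte_fin ltr_pM2l.
Qed.

Lemma approximableBZ u v (c : R[i]) : approximable u -> approximable v ->
  approximable (fun x => u x - c * v x).
Proof.
move=> [Lu Hu] [Lv Hv]; split; first exact: L2BZ.
move=> eps e0; have c0 := sqc_ge0 c.
have [|f tf fe] := Hu (eps / 4); first by rewrite divr_gt0.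
(* With these tolerances the error is at most 2 eps/4 + 2 |c|^2 eps / (4 (|c|^2 + 1)) < eps. *)
have c4 : 0 < 4 * (sqc c + 1) by rewrite mulr_gt0// ltr_wpDl.
have [|g tg ge] := Hv (eps / (4 * (sqc c + 1))); first by rewrite divr_gt0.
exists (fun x => f x - c * g x); first exact: test_BZ.
have Lf := L2B Lu (test_L2 mO Ooo tf); have Lg := L2B Lv (test_L2 mO Ooo tg).
have -> : (fun x => u x - c * v x - (f x - c * g x)) = (fun x => (u x - f x) - c * (v x - g x)).
  by apply/funext => x; ring.
apply: (le_lt_trans (sqnorm2BZ_le c Lf Lg)).
move: ge; rewrite ltr_pdivlMr// => ge.
move: fe; rewrite ltr_pdivlMr// => fe.
have g0 := fine_sqnorm2_ge0 (fun x => v x - g x).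
by nra.
Qed.

Lemma approximable_sub0 u : approximable u -> approximable (fun=> 0).
Proof.
move=> au; have := approximableBZ 1 au au; congr approximable.
by apply/funext => x; rewrite mul1r subrr.
Qed.

Lemma approximable_residual u (c : nat -> R[i]) (e : nat -> V -> R[i]) N :
  approximable u -> (forall k, approximable (e k)) -> approximable (residual u c e N).
Proof. by move=> au ae; elim: N => [//|N IHN] /=; exact: approximableBZ. Qed.

(** Partial sums of the eigenfunction expansion approximate [u], and test functions approximate the
    partial sums. *)
Lemma complete_approximable (phi : nat -> V -> R[i]) u : (forall k, approximable (phi k)) ->
  complete_system Omega phi -> L2 Omega u -> approximable u.
Proof.
move=> aphi cphi Lu; split => // eps e0.
have e4 : 0 < eps / 4 by rewrite divr_gt0.
have /ge0_cvg0P := cphi _ Lu.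
move=> /(_ (fun n => sqnorm2_ge0 _)) /(_ _ e4)[N _ /(_ _ (leqnn N))] /= HN.
(* The residual of 0 with negated coefficients is the partial sum itself. *)
have [Lw /(_ _ e4)[f tf fe]] := approximable_residual (fun k => - inner Omega u (phi k)) N
   (approximable_sub0 (aphi 0%N)) aphi.
exists f => //.
set w := residual _ _ _ _ in Lw fe.
have wE x : w x = \sum_(k < N) inner Omega u (phi k) * phi k x.
  by rewrite /w residualE sub0r -sumrN; apply: eq_bigr => k _; rewrite mulNr opprK.
have Luw := L2B Lu Lw; have Lwf := L2B Lw (test_L2 mO Ooo tf).
have -> : (fun x => u x - f x) = (fun x => (u x - w x) - (-1) * (w x - f x)).
  by apply/funext => x; ring.
apply: (le_lt_trans (sqnorm2BZ_le (-1) Luw Lwf)).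
have -> : sqc (-1 : R[i]) = 1 by rewrite /sqc /= oppr0 expr0n addr0 sqrrN expr1n.
have {}HN : fine (sqnorm2 (fun x => u x - w x)) <= eps / 4.
  rewrite -lee_fin -(sqnorm2_fineK Luw); apply: le_trans HN.
  by rewrite le_eqVlt; apply/orP; left; apply/eqP; congr sqnorm2; apply/funext => x; rewrite wE.
by lra.
Qed.

End density.

(** * The lower bound *)

Section lower_bound.
Context {R : realType} {n : nat}.
Local Open Scope complex_scope.
Local Notation V := 'rV[R]_n.
Local Notation L := (lebesgue_rV R n).

Hypothesis n0 : (0 < n)%N.
Variable Omega : set V.
Hypothesis mO : measurable Omega.
Hypothesis Ooo : (L Omega < +oo)%E.

Let vol : R := fine (L Omega).
Let bv : R := fine (L (@eball R n)).
Let c2 : R := (2 * pi) ^+ n.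
Let c2_gt0 : 0 < c2. Proof. by rewrite exprn_gt0// mulr_gt0// pi_gt0. Qed.

Lemma integrable_logp l : L.-integrable setT (fun xi => (logp l xi)%:E).
Proof.
apply: ge0_integral_eq_lty; first by apply/measurable_EFinP; exact: measurable_logp.
  by move=> xi; rewrite lee_fin logp_ge0.
by rewrite (integral_logp n0) eball_volE -EFinM ltry.
Qed.

Lemma Rintegral_logp l : \int[L]_xi logp l xi = expR (n%:R * l) / n%:R * bv.
Proof. by rewrite /Rintegral (integral_logp n0) eball_volE. Qed.

Lemma Rintegral_rV_sub (c : V) (F : V -> R) : L.-integrable setT (EFin \o F) ->
  \int[L]_x F (x - c) = \int[L]_x F x.
Proof. by move=> /measurable_int mF; exact: (congr1 fine (integral_rV_sub c mF)). Qed.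

Lemma L2_residual (u : V -> R[i]) (c : nat -> R[i]) (e : nat -> V -> R[i]) N :
  L2 Omega u -> (forall k, L2 Omega (e k)) -> L2 Omega (residual u c e N).
Proof. by move=> Lu Le; elim: N => [//|N IHN] /=; exact: L2BZ. Qed.

Lemma fourier_residual (u : V -> R[i]) (c : nat -> R[i]) (e : nat -> V -> R[i]) N :
  L2 Omega u -> (forall k, L2 Omega (e k)) ->
  fourier (residual u c e N) = residual (fourier u) c (fun k => fourier (e k)) N.
Proof.
move=> Lu Le; elim: N => [//|N IHN] /=; rewrite -IHN; apply/funext => xi.
rewrite -fourierBZ//; apply: (L2_cintegrable mO Ooo) => //; exact: L2_residual.
Qed.

Lemma Rintegral_sqc_fourier (f : V -> R[i]) : L2 Omega f ->
  \int[L]_xi sqc (fourier f xi) = c2 * fine (sqnorm2 f).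
Proof. by move=> Lf; rewrite /Rintegral (plancherel_L2 mO Ooo Lf) (sqnorm2_fineK Lf) -EFinM. Qed.

(** Only [|xi| < 1] contributes negatively. There [|r^|^2] is at most [vol] times the squared norm
    of [r], and the integral of [logp 0] is [bv / n]. *)
Lemma energy_ge (r : V -> R[i]) : L2 Omega r -> wL2 lnw (fourier r) ->
  - (vol * bv / n%:R * fine (sqnorm2 r)) <= \int[L]_xi (lnw xi * sqc (fourier r xi)).
Proof.
move=> Lr wr.
have -> : - (vol * bv / n%:R * fine (sqnorm2 r)) =
    \int[L]_xi (- (fine (sqnorm2 r) * vol) * logp 0 xi).
  by rewrite RintegralZl ?Rintegral_logp ?mulr0 ?expR0//; [ring|exact: integrable_logp].
apply: le_Rintegral => //.
- by have := integrableZl measurableT (- (fine (sqnorm2 r) * vol)) (integrable_logp 0).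
- exact: wL2_lnw_integrable.
move=> xi _; have h := sqc_fourier_le mO Ooo xi Lr; have q0 := sqc_ge0 (fourier r xi).
have l0 := logp_ge0 0 xi; have : - lnw xi <= logp 0 xi by rewrite -sub0r le_max lexx.
rewrite -/vol in h; move: h q0 l0; set q := sqc _; set K := _ * vol; set p := logp 0 xi.
move=> qK q0 p0 lp; have : p * q <= p * K by rewrite ler_wpM2l.
by have : - lnw xi * q <= p * q; [rewrite ler_wpM2r|nra].
Qed.

Variable f : V -> R[i].
Hypothesis tf : test_function Omega f.

(* Composing with a sine keeps smoothness and support while bounding the
   function by 1; [1 - cutoff^2 <= (pi/2)^2 (1 - Re f)^2]. *)
Definition cutoff (x : V) : R := sin (pi / 2 * complex.Re (f x)).
Local Notation u := (wave cutoff).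

Lemma sqc_wave xi x : sqc (u xi x) = cutoff x ^+ 2.
Proof. by rewrite /wave sqcM sqc_expi mulr1 sqc_real. Qed.

Lemma wave_test xi : test_function Omega (u xi). Proof. exact: test_wave. Qed.
Lemma wave_L2 xi : L2 Omega (u xi). Proof. exact: test_L2 (wave_test xi). Qed.
Lemma wave_HH xi : HH Omega (u xi). Proof. exact: test_HH (wave_test xi). Qed.

Let G : R := fine (sqnorm2 (u 0)).

Lemma sqnorm2_wave xi : fine (sqnorm2 (u xi)) = G.
Proof. by rewrite /G !sqnorm2E; under eq_integral do rewrite sqc_wave; under [in RHS]eq_integral do rewrite sqc_wave. Qed.

(** Modulation becomes translation, so one profile, that of [u 0], serves all frequencies. *)
Lemma fourier_wave xi eta : fourier (u xi) eta = fourier (u 0) (eta - xi).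
Proof.
apply: eq_cintegral => x; rewrite /wave dotp0r.
by apply: cplx_eq; rewrite !ReImE /= !cosN !sinN cos0 sin0 dotpBr cosB sinB; ring.
Qed.

(** The Sobolev energy density of the cutoff; its integral [S] is the error constant of the lower
    bound, finite but dependent on the cutoff. *)
Let W (zeta : V) : R := (1 + dotp zeta zeta) * sqc (fourier (u 0) zeta).
Let S : R := \int[L]_zeta W zeta.

Lemma W_ge0 zeta : 0 <= W zeta.
Proof. by rewrite mulr_ge0 ?sqc_ge0// addr_ge0// dotp_ge0. Qed.

Lemma integrable_W : L.-integrable setT (EFin \o W).
Proof.
apply: ge0_integral_eq_lty; last 2 first.
- by move=> zeta; rewrite lee_fin W_ge0.
- exact: test_sobolev (wave_test 0).
apply/measurable_EFinP; apply: measurable_funM.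
  by apply: measurable_funD => //; exact: measurable_sqnorm.
apply: measurable_sqc; apply: cmeasurable_fourier; exact: L2_cintegrable (wave_L2 0).
Qed.

Lemma S_ge0 : 0 <= S. Proof. by apply: Rintegral_ge0 => x _; exact: W_ge0. Qed.

Lemma Rintegral_W_sub xi : \int[L]_eta W (eta - xi) = S.
Proof.
exact: Rintegral_rV_sub integrable_W.
Qed.

(** With m = max(|xi|, M): |eta| <= m (1 + |eta - xi| / m) and ln (1 + s) <= s. The distance is then
    enlarged to 1 + |eta - xi|^2, the weight occurring in [W]. *)
Lemma lnw_shift_le (M : R) (xi eta : V) : 1 <= M ->
  lnw eta <= ln (Num.max (enorm xi) M) + (1 + dotp (eta - xi) (eta - xi)) / M.
Proof.
move=> M1; set m := Num.max _ _; have M0 : 0 < M by exact: lt_le_trans M1.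
have mM : M <= m by rewrite le_max lexx orbT.
have m0 : 0 < m by exact: lt_le_trans mM.
have d0 : 0 <= (1 + dotp (eta - xi) (eta - xi)) / M.
  by rewrite divr_ge0// ?addr_ge0 ?dotp_ge0// ltW.
have lm0 : 0 <= ln m by rewrite ln_ge0// (le_trans M1).
have := enorm_ge0 eta; rewrite le_eqVlt => /predU1P[e0|e0].
  by rewrite /lnw -e0 (ln0 (lexx 0)) addr_ge0.
pose s := enorm (eta - xi) / m.
have s0 : 0 <= s by rewrite divr_ge0 ?enorm_ge0// ltW.
apply: (@le_trans _ _ (ln (m * (1 + s)))).
  rewrite ler_ln ?posrE//; last by rewrite mulr_gt0// ltr_wpDr.
  rewrite mulrDr mulr1 /s mulrCA mulfV ?mulr1 ?gt_eqF//.
  rewrite -[X in enorm X](subrK xi) addrC; apply: (le_trans (enormD _ _)).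
  by rewrite lerD2r le_max lexx.
rewrite lnM ?posrE//; last by rewrite ltr_wpDr.
rewrite lerD2l; apply: (le_trans (le_ln1Dx _)); first by rewrite (lt_le_trans _ s0).
rewrite /s; apply: ler_pM; [exact: enorm_ge0|by rewrite invr_ge0 ltW|exact: enorm_le|].
by rewrite lef_pV2.
Qed.

Lemma energy_wave_le (M : R) xi : 1 <= M ->
  \int[L]_eta (lnw eta * sqc (fourier (u xi) eta)) <=
    ln (Num.max (enorm xi) M) * (c2 * G) + S / M.
Proof.
move=> M1; have Iw := integrable_rV_sub xi integrable_W.
have Iq := fourier_sqc_integrable mO Ooo (wave_L2 xi).
set lm := ln _.
have <- : \int[L]_eta (lm * sqc (fourier (u xi) eta) + M^-1 * W (eta - xi)) =
    lm * (c2 * G) + S / M.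
  rewrite RintegralD//; [|exact: (integrableZl measurableT lm Iq)|exact: (integrableZl measurableT M^-1 Iw)].
  rewrite RintegralZl// RintegralZl// (Rintegral_sqc_fourier (wave_L2 xi)) sqnorm2_wave.
  by rewrite Rintegral_W_sub [M^-1 * _]mulrC.
apply: le_Rintegral => //.
- apply: wL2_lnw_integrable; apply: (HH_wL2 n0 mO Ooo); exact: wave_HH.
- have := integrableD measurableT (integrableZl measurableT lm Iq) (integrableZl measurableT M^-1 Iw).
  by [].
move=> eta _; rewrite /W -fourier_wave mulrA -mulrDl ler_wpM2r ?sqc_ge0//.
by rewrite [M^-1 * _]mulrC; exact: lnw_shift_le.
Qed.

Variables (lam : nat -> R) (phi : nat -> V -> R[i]).
Hypothesis ephi : forall k, eigenfunction Omega (lam k) (phi k).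
Hypothesis ophi : orthonormal_system Omega phi.

Definition coef xi k : R[i] := inner Omega (u xi) (phi k).

Let Lphi k : L2 Omega (phi k). Proof. exact: eigen_L2 ephi k. Qed.

Let rest xi N : R := fine (sqnorm2 (residual (u xi) (coef xi) phi N)).

Lemma coef_rest xi N : \sum_(k < N) sqc (coef xi k) = G - rest xi N.
Proof.
have m1 : measurable_fun setT (cst 1 : V -> R) by exact: measurable_cst.
have Lu := wave_L2 xi; have wu := L2_wL2 Lu; have we k := L2_wL2 (Lphi k).
have eu k : wform (cst 1) (phi k) (u xi) = (1 : R)%:C * (coef xi k)^*.
  by rewrite mul1r /coef (innerE _ Lu); exact: wform_conj.
have := wform_pythagoras m1 wu we eu (wform1_orthonormal Lphi ophi) N.
rewrite (wform1_self Lu) (wform1_self (L2_residual (coef xi) N Lu Lphi)) /= sqnorm2_wave -/(rest xi N) => ->.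
by rewrite opprB addrC subrK; apply: eq_bigr => k _; rewrite mul1r.
Qed.

(* The form is bounded below on [L2 Omega] because Fourier transforms there are
   bounded, so the part of [u xi] orthogonal to the first [N] eigenfunctions
   costs at most a constant times its squared norm. *)
Lemma energy_pythagoras xi N :
  \sum_(k < N) c2 * lam k * sqc (coef xi k) <=
  \int[L]_eta (lnw eta * sqc (fourier (u xi) eta)) + vol * bv / n%:R * rest xi N.
Proof.
have m1 : measurable_fun setT (cst 1 : V -> R) by exact: measurable_cst.
have Lu := wave_L2 xi; have wu := HH_wL2 n0 mO Ooo (wave_HH xi).
have we k := HH_wL2 n0 mO Ooo (eigen_HH ephi k).
have eu k : wform lnw (fourier (phi k)) (fourier (u xi)) = (c2 * lam k)%:C * (coef xi k)^*.
  rewrite (eigen_wform ephi k (wave_HH xi)); congr (_ * _).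
  rewrite /coef (innerE _ Lu) (innerE _ (Lphi k)); exact: (wform_conj m1 (L2_wL2 Lu) (L2_wL2 (Lphi k))).
have ee j k : wform lnw (fourier (phi j)) (fourier (phi k)) = (c2 * lam j)%:C * (j == k)%:R.
  by rewrite (eigen_wform ephi j (eigen_HH ephi k)) ophi.
have := wform_pythagoras measurable_lnw wu we eu ee N.
have wr := wL2_residual measurable_lnw (coef xi) wu we N.
rewrite !wform_self// -(fourier_residual _ _ Lu Lphi) /= => H.
have := energy_ge (L2_residual (coef xi) N Lu Lphi); rewrite (fourier_residual _ _ Lu Lphi).
move=> /(_ wr); rewrite -(fourier_residual _ _ Lu Lphi) H -/(rest xi N).
by rewrite lerBrDl lerBlDr.
Qed.

(** As a function of the frequency, a coefficient is itself a Fourier transform, so Plancherel in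
    [xi] evaluates its integral. *)
Lemma coef_fourier xi k : (coef xi k)^* = fourier (fun x => (cutoff x)%:C * phi k x) xi.
Proof.
have Lu := wave_L2 xi.
rewrite /coef (innerE _ Lu) -(wform_conj _ (L2_wL2 Lu) (L2_wL2 (Lphi k)))//.
apply: eq_cintegral => x; rewrite /wave.
by apply: cplx_eq; rewrite !ReImE /= cosN sinN; ring.
Qed.

Lemma cutoff_phi_L2 k : L2 Omega (fun x => (cutoff x)%:C * phi k x) /\
  fine (sqnorm2 (fun x => (cutoff x)%:C * phi k x)) <= 1.
Proof.
have [mp p0 poo] := Lphi k; have [mu u0 uoo] := wave_L2 0.
have mc : measurable_fun setT cutoff.
  apply: (measurableT_comp (@measurable_sin R)); apply: measurable_funM => //.
  by have [[]] := test_L2 mO Ooo tf.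
have mcp : cmeasurable (fun x => (cutoff x)%:C * phi k x).
  by apply: cmeasurableM => //; exact: cmeasurable_real.
have le1 : (sqnorm2 (fun x => ((cutoff x)%:C * phi k x)%R) <= 1)%E.
  rewrite -(sqnorm2_orthonormal Lphi ophi k) !sqnorm2E; apply: ge0_le_integral => //.
  - by move=> x _; rewrite lee_fin sqc_ge0.
  - by apply/measurable_EFinP; exact: measurable_sqc.
  - by apply/measurable_EFinP; exact: measurable_sqc.
  - move=> x _; rewrite lee_fin sqcM sqc_real -[leRHS]mul1r ler_wpM2r ?sqc_ge0//.
    by have := cos2Dsin2 (pi / 2 * complex.Re (f x)); have := sqr_ge0 (cos (pi / 2 * complex.Re (f x))); rewrite /cutoff; lra.
have Lc : L2 Omega (fun x => (cutoff x)%:C * phi k x).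
  split => //; first by move=> x /p0 ->; rewrite mulr0.
  by apply: (le_lt_trans le1); rewrite ltry.
by split => //; rewrite -lee_fin -(sqnorm2_fineK Lc).
Qed.

Lemma integrable_coef k : L.-integrable setT (fun xi => (sqc (coef xi k))%:E).
Proof.
have [Lc _] := cutoff_phi_L2 k; have := fourier_sqc_integrable mO Ooo Lc.
by apply: eq_integrable => // xi _; rewrite -coef_fourier sqc_conj.
Qed.

Lemma Rintegral_coef_le k : \int[L]_xi sqc (coef xi k) <= c2.
Proof.
have [Lc c1] := cutoff_phi_L2 k; have := Rintegral_sqc_fourier Lc.
under eq_Rintegral do rewrite -coef_fourier sqc_conj.
by move=> ->; rewrite -[leRHS]mulr1 ler_wpM2l// ltW.
Qed.

Hypothesis cphi : complete_system Omega phi.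

Lemma rest_cvg0 xi (eps : R) : 0 < eps -> \forall N \near \oo, rest xi N <= eps.
Proof.
move=> e0; have Lu := wave_L2 xi.
have /ge0_cvg0P := cphi Lu; move=> /(_ (fun N => sqnorm2_ge0 _)) /(_ _ e0).
apply: filterS => N; rewrite /rest -lee_fin -(sqnorm2_fineK (L2_residual (coef xi) N Lu Lphi)).
by apply: le_trans; rewrite le_eqVlt; apply/orP; left; apply/eqP; congr sqnorm2; apply/funext => x; rewrite residualE.
Qed.

(** Terms with index at least [N] vanish, so the sum may be lengthened until the remainder of the
    expansion of [u xi] is negligible; the length needed depends on [xi], the bound obtained does
    not. *)
Lemma riesz_density_ge (l M : R) xi N : 1 <= M -> (forall k, (N <= k)%N -> l <= lam k) ->
  l * G - (ln (Num.max (enorm xi) M) * G + S / (M * c2)) <=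
    \sum_(k < N) Num.max (l - lam k) 0 * sqc (coef xi k).
Proof.
move=> M1 lN; apply/ler_addgt0Pr => eps e0.
(* The remainder enters with the coefficient [l] from the norm identity and [vol * bv / n%:R / c2]
   from the energy; [K] majorises their sum, and the 1 keeps it positive. *)
pose K := `|l| + vol * bv / n%:R / c2 + 1.
have K0 : 0 < K.
  by rewrite ltr_wpDl// addr_ge0// !divr_ge0 ?mulr_ge0 ?fine_ge0// ltW.
have [N1 _ HN1] := rest_cvg0 xi (divr_gt0 e0 K0).
pose N' := maxn N N1.
have NN' : (N <= N')%N by exact: leq_maxl.
have rN : rest xi N' * K <= eps by rewrite -ler_pdivlMr//; apply: HN1; exact: leq_maxr.
have -> : \sum_(k < N) Num.max (l - lam k) 0 * sqc (coef xi k) =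
    \sum_(k < N') Num.max (l - lam k) 0 * sqc (coef xi k).
  rewrite -!(big_mkord xpredT (fun k => Num.max (l - lam k) 0 * sqc (coef xi k))).
  rewrite [RHS](big_cat_nat (leq0n N) NN')//= [X in _ + X]big_nat_cond [X in _ + X]big1 ?addr0//.
  by move=> k; rewrite andbT => /andP[/lN lk _]; rewrite max_r ?mul0r// subr_le0.
have r0 : 0 <= rest xi N' by exact: fine_sqnorm2_ge0.
have H1 := energy_pythagoras xi N'; have H2 := energy_wave_le xi M1; have H3 := coef_rest xi N'.
have H4 : l * (G - rest xi N') - \sum_(k < N') lam k * sqc (coef xi k) <=
    \sum_(k < N') Num.max (l - lam k) 0 * sqc (coef xi k).
  rewrite -H3 mulr_sumr -sumrB; apply: ler_sum => k _.
  by rewrite -mulrBl ler_wpM2r ?sqc_ge0// le_max lexx.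
have H5 : \sum_(k < N') lam k * sqc (coef xi k) <=
    ln (Num.max (enorm xi) M) * G + S / (M * c2) + vol * bv / n%:R / c2 * rest xi N'.
  rewrite -(ler_pM2l c2_gt0) mulr_sumr.
  have -> : \sum_(k < N') c2 * (lam k * sqc (coef xi k)) = \sum_(k < N') c2 * lam k * sqc (coef xi k).
    by apply: eq_bigr => k _; rewrite mulrA.
  apply: (le_trans H1); apply: (le_trans (lerD H2 (lexx _))).
  rewrite le_eqVlt; apply/orP; left; apply/eqP; field.
  by rewrite !gt_eqF ?ltr0n// (lt_le_trans _ M1).
have H6 : (l + vol * bv / n%:R / c2) * rest xi N' <= eps.
  apply: le_trans rN; rewrite mulrC ler_wpM2l// /K.
  by have := ler_norm l; lra.
move: H4 H5 H6; move: (\sum_(k < N') _ * _) (\sum_(k < N') _ * _) => X Y.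
move: (ln _ * G + _) (vol * bv / n%:R / c2) (rest xi N') => Z C r; lra.
Qed.

(** Replaces the logarithm of a maximum by a difference of two [logp], whose integrals are known.
    Outside the ball [logp l] vanishes. *)
Lemma logp_sub_le (l M : R) (xi : V) : 1 <= M -> M <= expR l ->
  logp l xi - logp (ln M) xi <= (l - ln (Num.max (enorm xi) M)) * \1_[set x : V | enorm x < expR l] xi.
Proof.
move=> M1 Ml; have M0 : 0 < M by exact: lt_le_trans M1.
have lMl : ln M <= l by rewrite -[leRHS]expRK ler_ln ?posrE ?expR_gt0.
have lM0 : 0 <= ln M by exact: ln_ge0.
rewrite indicE; have [xl|xl] := ltP (enorm xi) (expR l).
  rewrite mem_set//= mulr1.
  have xil : ln (enorm xi) <= l.
    have := enorm_ge0 xi; rewrite le_eqVlt => /predU1P[<-|x0].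
      by rewrite ln0// (le_trans lM0).
    by rewrite -[leRHS]expRK ler_ln ?posrE ?expR_gt0// ltW.
  rewrite /logp (max_l (x := l - _)) ?subr_ge0//.
  have [xM|xM] := leP (enorm xi) M.
    have : ln M - ln (enorm xi) <= Num.max (ln M - ln (enorm xi)) 0 by rewrite le_max lexx.
    lra.
  have : 0 <= Num.max (ln M - ln (enorm xi)) 0 by rewrite le_max lexx orbT.
  lra.
rewrite memNset/=; last by apply/negP; rewrite -leNgt.
rewrite mulr0; have -> : logp l xi = 0.
  rewrite /logp max_r// subr_le0 -[leLHS]expRK ler_ln ?posrE ?expR_gt0//.
  exact: lt_le_trans (expR_gt0 l) xl.
by rewrite sub0r oppr_le0 logp_ge0.
Qed.

(** The pointwise bound is integrated over [|xi| < expR l]. The two losses are the moment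
    [M ^+ n * bv / n%:R], from frequencies below [M], and [S / (M * c2)] times the volume of that
    ball. *)
Lemma riesz_lower (l M : R) N : 1 <= M -> M <= expR l ->
  (forall k, (N <= k)%N -> l <= lam k) ->
  G * (bv / n%:R * (expR (n%:R * l) - M ^+ n)) - S / (M * c2) * (expR (n%:R * l) * bv) <=
    c2 * \sum_(k < N) Num.max (l - lam k) 0.
Proof.
move=> M1 Ml lN; have M0 : 0 < M by exact: lt_le_trans M1.
pose B := [set x : V | enorm x < expR l].
have mB : measurable B by exact: measurable_eball_lt.
have LB : L B = (expR (n%:R * l) * bv)%:E.
  rewrite (lebesgue_eball (expR_gt0 l)) eball_volE -EFinM; congr (_ * _)%:E.
  by rewrite -expRM_natl mulrC.
have G0 : 0 <= G by exact: fine_sqnorm2_ge0.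
have SM0 : 0 <= S / (M * c2) by rewrite divr_ge0 ?S_ge0// mulr_ge0// ltW.
have m0 k : 0 <= Num.max (l - lam k) 0 by rewrite le_max lexx orbT.
pose F xi := \sum_(k < N) Num.max (l - lam k) 0 * sqc (coef xi k).
have F0 xi : 0 <= F xi by apply: sumr_ge0 => k _; rewrite mulr_ge0 ?sqc_ge0.
have mq k : measurable_fun setT (fun xi => sqc (coef xi k)).
  by apply/measurable_EFinP; exact: measurable_int (integrable_coef k).
have mF : measurable_fun setT F by apply: measurable_sum => k; exact: measurable_funM.
have mlog t : measurable_fun setT (EFin \o @logp R n t).
  by apply/measurable_EFinP; exact: measurable_logp.
(* The negative terms are moved to the right, so that both sides are nonnegative and integrate
   without integrability conditions. *)
have pt xi : G * logp l xi <= F xi + (S / (M * c2) * \1_B xi + G * logp (ln M) xi).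
  have h := ler_wpM2l G0 (logp_sub_le xi M1 Ml).
  rewrite -/B in h; move: h; rewrite indicE.
  have := F0 xi; case: (xi \in B) => /= F0x.
    have := riesz_density_ge xi M1 lN; rewrite -/(F xi) mulr1 => h1 h2; rewrite mulr1.
    by move: h2; rewrite mulrBr [G * (l - _)]mulrBr [G * l]mulrC [G * ln _]mulrC; lra.
  by rewrite !mulr0 => h; rewrite mulrBr in h; lra.
have IF : (\int[L]_xi (F xi)%:E <= (c2 * \sum_(k < N) Num.max (l - lam k) 0)%:E)%E.
  under eq_integral do rewrite /F -sumEFin.
  rewrite ge0_integral_sum//; last 2 first.
  - by move=> k; apply/measurable_EFinP; exact: measurable_funM.
  - by move=> k xi _; rewrite lee_fin mulr_ge0// sqc_ge0.
  rewrite mulr_sumr -sumEFin; apply: lee_sum => k _.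
  under eq_integral do rewrite EFinM.
  rewrite ge0_integralZl_EFin//; last 2 first.
  - by move=> xi _; rewrite lee_fin sqc_ge0.
  - exact/measurable_EFinP.
  rewrite mulrC EFinM lee_wpmul2l ?lee_fin//.
  have := Rintegral_coef_le k; rewrite -lee_fin /Rintegral fineK//.
  exact: integrable_fin_num (integrable_coef k).
have IG t : (\int[L]_xi (G * logp t xi)%:E = (G * (expR (n%:R * t) / n%:R * bv))%:E)%E.
  under eq_integral do rewrite EFinM.
  rewrite ge0_integralZl_EFin//; last 2 first.
  - by move=> xi _; rewrite lee_fin logp_ge0.
  - exact: mlog.
  by rewrite (integral_logp n0) eball_volE -!EFinM.
have IB : (\int[L]_xi (S / (M * c2) * \1_B xi)%:E = (S / (M * c2) * (expR (n%:R * l) * bv))%:E)%E.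
  under eq_integral do rewrite EFinM.
  rewrite ge0_integralZl_EFin//; last by apply/measurable_EFinP; exact: measurable_indic.
  have IB1 : (\int[L]_xi (\1_B xi)%:E = L B)%E by rewrite integral_indic// setIT.
  by rewrite IB1 LB -EFinM.
have mI : measurable_fun setT (fun xi : V => (S / (M * c2) * \1_B xi)%:E).
  by apply/measurable_EFinP; apply: measurable_funM => //; exact: measurable_indic.
have mG t : measurable_fun setT (fun xi : V => (G * logp t xi)%:E).
  by apply/measurable_EFinP; apply: measurable_funM => //; exact: measurable_logp.
have H : (\int[L]_xi (G * logp l xi)%:E <= \int[L]_xi ((F xi)%:E + ((S / (M * c2) * \1_B xi)%:E + (G * logp (ln M) xi)%:E)))%E.
  apply: ge0_le_integral => //.
  - by move=> xi _; rewrite lee_fin mulr_ge0// logp_ge0.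
  - apply: emeasurable_funD; first exact/measurable_EFinP.
    exact: emeasurable_funD.
  - by move=> xi _; rewrite -!EFinD lee_fin; exact: pt.
have eM : expR (n%:R * ln M) = M ^+ n by rewrite expRM_natl lnK.
rewrite ge0_integralD// in H; last 4 first.
- by move=> xi _; rewrite lee_fin.
- exact/measurable_EFinP.
- by move=> xi _; rewrite -EFinD lee_fin addr_ge0// mulr_ge0// logp_ge0.
- exact: emeasurable_funD.
rewrite ge0_integralD// in H; last 2 first.
- by move=> xi _; rewrite lee_fin mulr_ge0.
- by move=> xi _; rewrite lee_fin mulr_ge0// logp_ge0.
have := le_trans H (leeD IF (lexx _)); rewrite !IG IB eM -!EFinD lee_fin.
move: (c2 * _) => X.
have -> : bv / n%:R * (expR (n%:R * l) - M ^+ n) = expR (n%:R * l) / n%:R * bv - M ^+ n / n%:R * bv by ring.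
by rewrite mulrBr; lra.
Qed.

Lemma sqr_sin_le (t : R) : sin t ^+ 2 <= t ^+ 2.
Proof.
wlog t0 : t / 0 <= t.
  move=> H; have [/H//|t0] := leP 0 t.
  by have := H (- t); rewrite sinN !sqrrN oppr_ge0; apply; exact: ltW.
have [|c /andP[c0 ct]] := @MVT_segment R sin cos 0 t t0 (fun x _ => is_derive_sin x).
  by apply: continuous_subspaceT; exact: continuous_sin.
rewrite sin0 !subr0 => ->; rewrite exprMn -[leRHS]mul1r ler_wpM2r ?sqr_ge0//.
Qed.

(** [planewave Omega 0] is the indicator of [Omega]: the loss in norm of the cutoff is bounded by
    the L^2 distance from [f] to it. *)
Lemma vol_sub_le : vol - G <= (pi / 2) ^+ 2 * fine (sqnorm2 (fun x => planewave Omega 0 x - f x)).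
Proof.
have Lf := test_L2 mO Ooo tf; have Lp := L2_planewave mO Ooo (0 : V).
have Lg := L2B Lp Lf; have Lu := wave_L2 0; have [_ f0 _] := Lf.
rewrite lerBlDl -lee_fin EFinD EFinM -(sqnorm2_fineK Lg) -(sqnorm2_fineK Lu) -volE//.
rewrite -(sqnorm2_planewave mO (0 : V)) !sqnorm2E.
have mg : measurable_fun setT (fun x => (sqc (planewave Omega 0 x - f x))%:E).
  by apply/measurable_EFinP; apply: measurable_sqc; case: Lg.
have mu : measurable_fun setT (fun x => (sqc (u 0 x))%:E).
  by apply/measurable_EFinP; apply: measurable_sqc; case: Lu.
have mp : measurable_fun setT (fun x => (sqc (planewave Omega 0 x))%:E).
  by apply/measurable_EFinP; apply: measurable_sqc; case: Lp.
have p0 : 0 <= (pi / 2) ^+ 2 :> R by exact: sqr_ge0.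
rewrite -ge0_integralZl_EFin//; last by move=> x _; rewrite lee_fin sqc_ge0.
rewrite -ge0_integralD//; last 3 first.
- by move=> x _; rewrite lee_fin sqc_ge0.
- by move=> x _; rewrite -EFinM lee_fin mulr_ge0// sqc_ge0.
- exact: emeasurable_funM.
apply: ge0_le_integral => //.
- by move=> x _; rewrite lee_fin sqc_ge0.
- by apply: emeasurable_funD => //; exact: emeasurable_funM.
move=> x _; rewrite -EFinM -EFinD lee_fin sqc_planewave sqc_wave indicE.
have [Ox|Ox] := pselect (Omega x); last first.
  by rewrite memNset// addr_ge0 ?sqr_ge0// mulr_ge0// sqc_ge0.
rewrite mem_set//= /cutoff; set r := complex.Re (f x).
have -> : planewave Omega 0 x = 1.
  by rewrite /planewave indicE mem_set// dotp0r /expi cos0 sin0 mul1r.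
have h1 : (1 - r) ^+ 2 <= sqc (1 - f x).
  by rewrite /sqc !ReImE /= -/r lerDl sqr_ge0.
have h2 := sqr_sin_le (pi / 2 * (1 - r)).
(* So 1 - cutoff^2 = cos^2 (pi r / 2) is the square of a sine that is small when [r] is near 1. *)
have h3 : sin (pi / 2 * (1 - r)) = cos (pi / 2 * r).
  by rewrite mulrBr mulr1 sinB sin_pihalf cos_pihalf mul1r mul0r subr0.
rewrite h3 exprMn in h2.
have h4 := ler_wpM2l p0 h1; have h5 := cos2Dsin2 (pi / 2 * r).
by move: h2 h4 h5; lra.
Qed.

End lower_bound.

(** * The limit of the Riesz means *)

Section riesz_asymptotics.
Context {R : realType} {n : nat}.
Local Notation V := 'rV[R]_n.
Local Notation L := (lebesgue_rV R n).

Hypothesis n0 : (0 < n)%N.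
Variable Omega : set V.
Hypothesis mO : measurable Omega.
Hypothesis Ooo : (L Omega < +oo)%E.
Variables (lam : nat -> R) (phi : nat -> V -> R[i]).
Hypothesis ephi : forall k, eigenfunction Omega (lam k) (phi k).
Hypothesis ophi : orthonormal_system Omega phi.
Hypothesis cphi : complete_system Omega phi.
Hypothesis lamoo : lam @ \oo --> +oo.

Let vol : R := fine (L Omega).
Let bv : R := fine (L (@eball R n)).
Let c2 : R := (2 * pi) ^+ n.
Let c2_gt0 : 0 < c2. Proof. by rewrite exprn_gt0// mulr_gt0// pi_gt0. Qed.
Let n0' : 0 < n%:R :> R. Proof. by rewrite ltr0n. Qed.
Let bv0 : 0 <= bv. Proof. exact: fine_ge0. Qed.

Lemma riesz_mean_le l :
  (riesz_mean lam l <= (c2^-1 * vol * bv * (expR (n%:R * l) / n%:R))%:E)%E.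
Proof.
apply: lime_le.
  by apply: is_cvg_nneseries => k _ _; rewrite lee_fin le_max lexx orbT.
apply: nearW => N; rewrite big_mkord sumEFin lee_fin.
exact: (riesz_upper n0 mO Ooo ephi ophi).
Qed.

Lemma riesz_mean_ge l N : ((\sum_(k < N) Num.max (l - lam k) 0)%:E <= riesz_mean lam l)%E.
Proof.
rewrite -sumEFin -(big_mkord xpredT (fun k => (Num.max (l - lam k) 0)%:E)).
by apply: nneseries_lim_ge => k _ _; rewrite lee_fin le_max lexx orbT.
Qed.

Lemma riesz_mean_fin l : riesz_mean lam l \is a fin_num.
Proof.
rewrite ge0_fin_numE; first by rewrite (le_lt_trans (riesz_mean_le l))// ltry.
by apply: nneseries_ge0 => k _ _; rewrite lee_fin le_max lexx orbT.
Qed.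

Let Lphi k : L2 Omega (phi k). Proof. exact: eigen_L2 ephi k. Qed.

(** Completeness of the eigenfunctions makes the indicator of [Omega] an L^2 limit of test
    functions. *)
Lemma cutoff_approx (delta : R) : 0 < delta -> exists2 f, test_function Omega f &
  vol - delta <= fine (sqnorm2 (wave (cutoff f) 0)).
Proof.
move=> d0; have p0 : 0 < (pi / 2) ^+ 2 :> R by rewrite exprn_gt0// divr_gt0// pi_gt0.
have [_ H] := complete_approximable mO Ooo (fun k => HH_approximable mO Ooo (eigen_HH ephi k))
  cphi (L2_planewave mO Ooo 0).
have [f tf fd] := H _ (divr_gt0 d0 p0).
exists f => //; have := vol_sub_le mO Ooo tf; rewrite -/vol.
move: fd; rewrite ltr_pdivlMr// [X in X < _]mulrC => fd h.
by rewrite lerBlDr addrC -lerBlDr (le_trans h)// ltW.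
Qed.

(* The cutoff radius [M = e^(l/2)] makes both error terms of [riesz_lower] of
   relative size at most [e^(- l/2)]. *)
Lemma riesz_mean_ge_cutoff f : test_function Omega f -> exists2 K : R, 0 <= K &
  forall l, 0 <= l ->
    c2^-1 * (fine (sqnorm2 (wave (cutoff f) 0)) * bv / n%:R) - K * expR (- (l / 2)) <=
    expR (- (n%:R * l)) * fine (riesz_mean lam l).
Proof.
move=> tf; set G := fine _.
set S := \int[L]_zeta ((1 + dotp zeta zeta) * sqc (fourier (wave (cutoff f) 0) zeta)).
have G0 : 0 <= G by exact: fine_sqnorm2_ge0.
have S0 : 0 <= S by exact: S_ge0.
exists (c2^-1 * (G * bv / n%:R + S / c2 * bv)).
  apply: mulr_ge0; first by rewrite invr_ge0; exact: ltW.
  by apply: addr_ge0; [rewrite divr_ge0// mulr_ge0|apply: mulr_ge0 => //; rewrite divr_ge0// ltW].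
move=> l l0; pose M := expR (l / 2).
have M1 : 1 <= M by rewrite -expR0 ler_expR divr_ge0.
have Ml : M <= expR l by rewrite ler_expR; lra.
have [N _ HN] : \forall k \near \oo, l <= lam k by move/cvgryPge : lamoo; exact.
have := riesz_lower n0 mO Ooo tf ephi ophi cphi M1 Ml HN.
rewrite -/G -/S -/bv -/c2 => H.
have sZ : \sum_(k < N) Num.max (l - lam k) 0 <= fine (riesz_mean lam l).
  by rewrite -lee_fin (fineK (riesz_mean_fin l)); exact: riesz_mean_ge.
move: (fine (riesz_mean _ _)) sZ => Z sZ; set s := \sum_(_ < _) _ in H sZ.
set E := expR (n%:R * l) in H.
have E0 : 0 < E by exact: expR_gt0.
have -> : expR (- (n%:R * l)) = E^-1 by rewrite expRN.
rewrite [E^-1 * _]mulrC ler_pdivlMr//.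
have MV : M * expR (- (l / 2)) = 1 by rewrite /M -expRD subrr expR0.
set m := expR (- (l / 2)) in MV *.
have m0 : 0 < m by exact: expR_gt0.
(* This is [n l / 2 <= n l - l / 2], which uses [n >= 1] and [l >= 0]. *)
have ME : M ^+ n <= m * E.
  rewrite /M /m /E -expRM_natl -expRD ler_expR.
  have : 1 <= n%:R :> R by rewrite ler1n.
  by nra.
rewrite -(ler_pM2l c2_gt0); apply: (@le_trans _ _ (c2 * s)); last by rewrite ler_wpM2l// ltW.
apply: le_trans H.
have -> : S / (M * c2) * (E * bv) = S / c2 * bv * (m * E).
  have -> : (M * c2)^-1 = m / c2.
    have M0 : M != 0 by rewrite gt_eqF// expR_gt0.
    by rewrite invfM; congr (_ / _); rewrite -[LHS]mulr1 -MV mulrA mulVf// mul1r.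
  by ring.
rewrite !mulrA; have -> : (c2 * (c2^-1 * G * bv / n%:R - c2^-1 * (G * bv / n%:R + S / c2 * bv) * m)) * E =
   G * bv / n%:R * E - (G * bv / n%:R + S / c2 * bv) * (m * E).
  by field; rewrite !gt_eqF.
have Gb : 0 <= G * bv / n%:R by rewrite divr_ge0// mulr_ge0.
have := ler_wpM2l Gb ME.
rewrite mulrBr; move: (S / c2 * bv) => P.
move: (G * bv / n%:R) (M ^+ n) => Q Mn; lra.
Qed.

(** The upper bound holds for every [l]. For the lower one the cutoff is fixed first, and [l] is
    taken large in terms of its constant [K]. *)
Lemma riesz_mean_cvg :
  expR (- (n%:R * l)) * fine (riesz_mean lam l) @[l --> +oo] --> c2^-1 * (vol * bv / n%:R).
Proof.
apply/cvgrPdist_le => eps e0; have c20 := c2_gt0.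
pose B := c2^-1 * (bv / n%:R).
have B0 : 0 <= B by apply: mulr_ge0; [rewrite invr_ge0 ltW|rewrite divr_ge0].
(* The norm defect of the cutoff is multiplied by [B] in the limit; dividing by [B + 1] keeps the
   loss below [eps / 2] even when [B] is 0. *)
pose D := B + 1; have D0 : 0 < D by rewrite ltr_wpDl.
have [f tf fd] := cutoff_approx (divr_gt0 (divr_gt0 e0 (ltr0n _ 2)) D0).
have [K K0 HK] := riesz_mean_ge_cutoff tf.
near=> l.
have l0 : 0 <= l by near: l; exact: nbhs_pinfty_ge.
have H1 := HK l l0; have H2 := riesz_mean_le l.
move: fd H1; set G := fine (sqnorm2 _) => fd H1.
have {}H2 : expR (- (n%:R * l)) * fine (riesz_mean lam l) <= c2^-1 * (vol * bv / n%:R).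
  have E0 : 0 < expR (n%:R * l) by exact: expR_gt0.
  have {H2} : fine (riesz_mean lam l) <= c2^-1 * vol * bv * (expR (n%:R * l) / n%:R).
    by rewrite -lee_fin (fineK (riesz_mean_fin l)).
  move: E0; set E := expR (n%:R * l) => E0.
  have -> : expR (- (n%:R * l)) = E^-1 by rewrite expRN.
  rewrite [E^-1 * _]mulrC ler_pdivrMr//.
  move=> /le_trans; apply; rewrite le_eqVlt; apply/orP; left; apply/eqP; ring.
have H3 : K * expR (- (l / 2)) <= eps / 2.
  (* From [expR (l / 2) >= 1 + l / 2 >= 2 * K / eps]. *)
  have lK : 4 * K / eps <= l by near: l; apply: nbhs_pinfty_ge; exact: num_real.
  rewrite ler_pdivrMr// in lK.
  rewrite expRN ler_pdivrMr ?expR_gt0//.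
  by have := expR_ge1Dx (l / 2); nra.
have H4 : c2^-1 * (vol * bv / n%:R) - eps / 2 <= c2^-1 * (G * bv / n%:R).
  have h : (vol - G) * D <= eps / 2 by rewrite -ler_pdivlMr//; lra.
  suff : B * (vol - G) <= eps / 2.
    rewrite /B lerBlDr -lerBlDl; apply: le_trans.
    by rewrite le_eqVlt; apply/orP; left; apply/eqP; ring.
  rewrite mulrDr mulr1 in h.
  by have [vG|vG] := leP 0 (vol - G); [lra|have := e0; nra].
rewrite ler_norml; apply/andP; split; lra.
Unshelve. all: by end_near. Qed.

End riesz_asymptotics.

Theorem theorem6p1 (R : realType) (d : nat) (Omega : set 'rV[R]_d)
    (lam : nat -> R) :
  (0 < d)%N ->
  open Omega ->
  Omega !=set0 ->
  (lebesgue_rV R d Omega < +oo)%E ->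
  dirichlet_eigenvalues Omega lam ->
  ((expR (- (d%:R * l)))%:E * riesz_mean lam l)%E @[l --> +oo] -->
    (((2 * pi) ^- d)%:E * lebesgue_rV R d Omega
       * lebesgue_rV R d (@eball R d) * (d%:R^-1)%:E)%E.
Proof.
move=> d0 oO _ Ooo [_ _ lamoo [phi [ephi ophi cphi]]].
have mO := open_measurable_rV oO.
have H := riesz_mean_cvg d0 mO Ooo ephi ophi cphi lamoo.
rewrite (volE Ooo) eball_volE -!EFinM.
rewrite (_ : _ * _ * _ * _ = ((2 * pi) ^+ d)^-1 * (fine (lebesgue_rV R d Omega) * fine (lebesgue_rV R d (@eball R d)) / d%:R)); last by ring.
(* The Riesz means are finite, so the extended real limit is a real one. *)
have -> : (fun l : R => (expR (- (d%:R * l)))%:E * riesz_mean lam l)%E =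
  EFin \o (fun l => expR (- (d%:R * l)) * fine (riesz_mean lam l)).
  by apply/funext => l /=; rewrite EFinM (fineK (riesz_mean_fin d0 mO Ooo ephi ophi l)).
by apply: cvg_EFin => //; exact: nearW.
Qed.
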